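(* For each of the following values of $(p,q,r,s;\lambda)$, $\overline{\mathcal{F}(p,q,r,s;\lambda,3)}$ is an irreducible component of $\mathscr{F}_2(3,4)$: $(15,14,12,8;16)$, $(15,7,6,4;8)$, $(14,11,6,4;8)$, $(12,8,3,2;4)$, $(8,7,6,4;8)$, $(8,4,3,2;4)$, $(7,4,3,2;4)$, $(6,5,4,2;4)$, $(6,5,3,2;4)$, $(4,3,2,1;2)$.
   Context: $R_{5}$ is the radial vector field on $\mathbb{C}^{5}$, $i_Z$ is contraction by $Z$, and $\mathrm{Sing}$ of a form is its zero set. A two-dimensional holomorphic foliation of degree $e$ on $\mathbb{P}^4$ (complex projective space) is given by an integrable $2$-form $\Omega$ on $\mathbb{C}^{5}$ (i.e. at generic points locally decomposable, $\Omega=\theta_1\wedge\theta_2$ with $d\theta_k\wedge\Omega=0$), with homogeneous polynomial coefficients of degree $e+1$, with $i_{R_5}\Omega=0$ and $\mathrm{codim}\,\mathrm{Sing}(\Omega)\ge 2$; $\Omega$ is taken up to multiplication by a nonzero scalar. The set of these foliations is $\mathscr{F}_2(e,4)$, a Zariski open subset of a projective variety. An affine chart is the composition of $(x_1,\dots,x_4)\mapsto(x_1:\cdots:x_4:1)$ with an automorphism of $\mathbb{P}^4$. For relatively prime positive integers $p>q>r>s$ (i.e. $\gcd(p,q,r,s)=1$), let $S=p x_1\,\partial/\partial x_1+q x_2\,\partial/\partial x_2+r x_3\,\partial/\partial x_3+s x_4\,\partial/\partial x_4$ on $\mathbb{C}^4$ and $\nu_4=dx_1\wedge\cdots\wedge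 dx_4$. For $\lambda\in\mathbb{Z}$, $\mathcal{F}(p,q,r,s;\lambda,d+1)$ is the set of $\mathcal{F}\in\mathscr{F}_2(d+1,4)$ that in some affine chart are defined by $\omega=i_Si_X\nu_4$ for some polynomial vector field $X$ on $\mathbb{C}^4$ with $[S,X]=\lambda X$. The bar denotes Zariski closure in $\mathscr{F}_2(d+1,4)$. *)

(* Defs.v *)
From HB Require Import structures.
From mathcomp Require Import all_boot all_order all_algebra.
From mathcomp Require Export complex.
From mathcomp Require Import classical_sets topology normedtype derive.
From mathcomp Require Export reals.
(* The notations of mpoly clash with those of topology and normedtype. *)
From mathcomp Require Import -(notations) mpoly.

Set Implicit Arguments.
Unset Strict Implicit.
Unset Printing Implicit Defensive.

Import GRing.Theory Num.Theory numFieldNormedType.Exports.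

Local Open Scope ring_scope.

Local Notation "{ 'mpoly' T [ n ] }" := (mpoly n T)
  (at level 0, T, n at level 2, format "{ 'mpoly'  T [ n ] }").
Local Notation "''X_' i" := (mpolyX _ (mnm1 i))
  (at level 8, i at level 2, format "''X_' i").

(* A differential form on an n-dimensional affine space is its family of
   coefficients: alpha = \sum_I alpha(I) dx_I, where dx_I is the wedge product
   of the dx_i, i in I, taken in increasing order. *)
Definition form (n : nat) (A : Type) := {ffun {set 'I_n} -> A}.

(* dx_I /\ dx_J = (-1)^(inversions I J) dx_(I u J) for disjoint I and J. *)
Definition inversions n (I J : {set 'I_n}) : nat :=
  #|[set u : 'I_n * 'I_n | [&& u.1 \in I, u.2 \in J & (u.2 < u.1)%N]]|.

Section Forms.
Variables (n : nat) (A : pzRingType).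
Implicit Types alpha beta : form n A.

Definition is_kform (k : nat) alpha :=
  forall I : {set 'I_n}, #|I| != k -> alpha I = 0.

Definition form0 (f : A) : form n A :=
  [ffun I : {set 'I_n} => if I == finset.set0 then f else 0].

Definition wedge alpha beta : form n A :=
  [ffun K : {set 'I_n} => \sum_(I : {set 'I_n} | I \subset K)
     (-1) ^+ inversions I (K :\: I) * (alpha I * beta (K :\: I))].

Definition contraction (Z : 'I_n -> A) alpha : form n A :=
  [ffun K : {set 'I_n} => \sum_(i : 'I_n | i \notin K)
     (-1) ^+ inversions [set i] K * (Z i * alpha (i |: K))].

Definition volume : form n A :=
  [ffun I : {set 'I_n} => if I == [set: 'I_n] then 1 else 0].

End Forms.

(* The exterior derivative, for given partial derivatives partial i. The types
   A and B differ when the derivatives are taken at a fixed point. *)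
Definition ext_deriv n (A : Type) (B : pzRingType) (partial : 'I_n -> A -> B)
    (alpha : form n A) : form n B :=
  [ffun K : {set 'I_n} => \sum_(i in K)
     (-1) ^+ inversions [set i] (K :\ i) * partial i (alpha (K :\ i))].

Local Open Scope classical_set_scope.

(* Zariski topologies are given by their closed sets. *)
Section Irreducibility.
Variables (T : Type) (closed_set : set (set T)).

Definition irreducible (Z : set T) :=
  Z !=set0 /\
  forall A B, closed_set A -> closed_set B ->
    Z `<=` A `|` B -> Z `<=` A \/ Z `<=` B.

Definition irreducible_component_of (X Z : set T) :=
  [/\ Z `<=` X, irreducible Z &
      forall Y, Y `<=` X -> irreducible Y -> Z `<=` Y -> Y = Z].

Definition closure_of (Z : set T) : set T :=
  \bigcap_(Y in [set Y | closed_set Y /\ Z `<=` Y]) Y.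

(* codim Z >= k: every irreducible closed subset of Z is the start of a chain
   of irreducible closed subsets of the ambient space, of length k. *)
Definition codim_ge (k : nat) (Z : set T) :=
  forall Y, closed_set Y -> irreducible Y -> Y `<=` Z ->
  exists C : nat -> set T,
    [/\ C 0%N = Y,
        forall i, (i <= k)%N -> closed_set (C i) /\ irreducible (C i) &
        forall i, (i < k)%N -> C i `<` C i.+1].

End Irreducibility.

Section ComplexForms.
Variable C : numClosedFieldType.

Section AffineSpace.
Variable n : nat.
Local Notation poly := {mpoly C[n]}.

Definition eval_at (x : 'rV[C]_n) (P : poly) : C := meval (fun i => x 0 i) P.

Definition zariski_closed (Z : set 'rV[C]_n) :=
  exists E : set poly, Z = [set x | forall P, E P -> eval_at x P = 0].

Definition form_at (x : 'rV[C]_n) (Omega : form n poly) : form n C :=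
  [ffun I => eval_at x (Omega I)].

Definition Sing (Omega : form n poly) : set 'rV[C]_n :=
  [set x | forall I, eval_at x (Omega I) = 0].

Definition radial : 'I_n -> poly := fun i => 'X_i.

Definition bracket (V W : 'I_n -> poly) : 'I_n -> poly := fun i =>
  \sum_(j < n) (V j * mderiv j (W i) - W j * mderiv j (V i)).

Definition poly_ext_deriv : form n poly -> form n poly :=
  ext_deriv (fun i P => mderiv i P).

(* Holomorphic forms on an open set U are represented by total functions, whose
   values off U are irrelevant. *)
Definition fun_form_at (x : 'rV[C]_n) (theta : form n ('rV[C]_n -> C)) :
  form n C := [ffun I => theta I x].

Definition fun_ext_deriv_at (x : 'rV[C]_n) (theta : form n ('rV[C]_n -> C)) :
    form n C :=
  ext_deriv (fun i (f : 'rV[C]_n -> C) => 'D_(delta_mx 0 i) f x : C) theta.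

Definition holomorphic_1form_on (U : set 'rV[C]_n)
    (theta : form n ('rV[C]_n -> C)) :=
  forall x, U x ->
    is_kform 1 (fun_form_at x theta) /\
    forall I, differentiable (theta I) x.

Definition locally_decomposable (Omega : form n poly) (x : 'rV[C]_n) :=
  exists (U : set 'rV[C]_n) (theta1 theta2 : form n ('rV[C]_n -> C)),
    [/\ open U /\ U x,
        holomorphic_1form_on U theta1,
        holomorphic_1form_on U theta2 &
        forall y, U y ->
          [/\ form_at y Omega =
                wedge (fun_form_at y theta1) (fun_form_at y theta2),
              wedge (fun_ext_deriv_at y theta1) (form_at y Omega) = 0 &
              wedge (fun_ext_deriv_at y theta2) (form_at y Omega) = 0]].

(* Generic points: those off some proper Zariski closed subset. *)
Definition integrable (Omega : form n poly) :=
  exists Z : set 'rV[C]_n,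
    [/\ zariski_closed Z, Z <> setT &
        forall x, ~ Z x -> locally_decomposable Omega x].

End AffineSpace.

Definition pullback m n (phi : n.-tuple {mpoly C[m]})
    (alpha : form n {mpoly C[n]}) : form m {mpoly C[m]} :=
  \sum_(I : {set 'I_n})
    wedge (form0 m (comp_mpoly phi (alpha I)))
      (\big[@wedge m _/form0 m 1]_(i <- enum I)
         poly_ext_deriv (form0 m (tnth phi i))).

Local Notation form5 := (form 5 {mpoly C[5]}).

Definition foliation_form (e : nat) (Omega : form5) :=
  [/\ is_kform 2 Omega,
      forall I, Omega I \is ishomog1 e.+1 mdeg,
      contraction (@radial 5) Omega = 0,
      integrable Omega &
      codim_ge (@zariski_closed 5) 2 (Sing Omega)].

(* The point [Omega] of the projective space of forms, as a punctured line. *)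
Definition proj_class (Omega : form5) : set form5 :=
  [set Omega' | exists c : C, c != 0 /\ Omega' = c *: Omega].

(* The space F_2(e, 4). *)
Definition foliations (e : nat) : set (set form5) :=
  [set F | exists Omega, foliation_form e Omega /\ F = proj_class Omega].

(* The coordinates of a form: the coefficients of the monomials of degree at
   most e + 1 in each of its coefficients. On the forms of foliation_form e, all
   of these vanish except in 2-form components and degree e + 1. *)
Definition coord_index (e : nat) : finType :=
  ({set 'I_5} * bmultinom 5 e.+2)%type.

Definition coordinates (e : nat) (Omega : form5) :
    'I_#|coord_index e| -> C :=
  fun k => mcoeff (bmnm (enum_val k).2) (Omega (enum_val k).1).

(* The Zariski topology of F_2(e, 4), induced by the projective space of
   2-forms with coefficients of degree e + 1. *)
Definition foliations_closed (e : nat) (Z : set (set form5)) :=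
  exists E : set {mpoly C[#|coord_index e|]},
    (forall P, E P -> exists d, P \is ishomog1 d mdeg) /\
    Z = [set F | foliations e F /\
           forall P, E P -> forall Omega, F Omega ->
             meval (coordinates Omega) P = 0].

(* The affine chart x |-> A (x_1 : ... : x_4 : 1). *)
Definition chart (A : 'M[C]_5) : 5.-tuple {mpoly C[4]} :=
  [tuple \sum_(j < 4) A i (widen_ord (leqnSn 4) j) *: 'X_j
         + mpolyC 4 (A i ord_max) | i < 5].

Definition diagonal_field (p q r s : nat) : 'I_4 -> {mpoly C[4]} :=
  fun i => (tnth [tuple p; q; r; s] i)%:R *: 'X_i.

(* The set F(p, q, r, s; lam, e) of foliations of degree e. *)
Definition affine_family (p q r s : nat) (lam : int) (e : nat) :
    set (set form5) :=
  [set F | foliations e F /\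
     exists (Omega : form5) (A : 'M[C]_5) (X : 'I_4 -> {mpoly C[4]}),
       let S := diagonal_field p q r s in
       [/\ F Omega,
           A \in unitmx,
           forall i, bracket S X i = lam%:~R *: X i &
           pullback (chart A) Omega =
             contraction S (contraction X (volume 4 _))]].

Definition family_closure (p q r s : nat) (lam : int) (e : nat) :=
  closure_of (@foliations_closed e) (affine_family p q r s lam e).

Definition is_foliation_component (e : nat) (Z : set (set form5)) :=
  irreducible_component_of (@foliations_closed e) (foliations e) Z.

End ComplexForms.

(* Main.v *)
From Stdlib Require Import ZArith FMapPositive.
From HB Require Import structures.
From mathcomp Require Import complex classical_sets boolp functions topology normedtype derive reals.
From mathcomp Require Import all_boot all_order all_algebra.
From mathcomp Require Import -(notations) mpoly.
From mathcomp Require Import ring zify ssrZ.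
Require Import Defs.

Set Implicit Arguments.
Unset Strict Implicit.
Unset Printing Implicit Defensive.
Import Order.TTheory GRing.Theory Num.Theory.
Local Open Scope ring_scope.

(** Fix weights and [lam]. Let V be the linear space [base] of 2-forms on C^5 with coefficients of
    degree 4 that are killed by the radial field and restrict on the hyperplane x_5 = 1 to i_S i_X
    nu_4 with [S, X] = lam X. Every form of V satisfies the Plücker and Frobenius relations
    ([base_plucker], [base_frob]), and the foliations of the family are the pullbacks [act B Om]
    with B in GL_5 and Om in V that define a foliation ([family_sub], [family_sup]). The pairs (B,
    Om) range over a linear space up to open conditions, so the closure is irreducible
    ([closure_irreducible]).

    Maximality is infinitesimal. The family through a form Om0 of V contains arcs with every
    velocity L_B Om0 + Om1, where B is in gl_5 and Om1 in V. Integrable forms satisfy the quadratic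
    equations i_v Om /\ d Om = 0 ([integrable_frob]), whose linearization at Om0 bounds the Zariski
    tangent space of the space of foliations from above. When the two spaces agree, nothing larger
    than the closure passes through Om0. The algebraic form of this principle is [rigid_at]: if each
    Zariski tangent vector of an ideal I at a point is the velocity of an arc on which I and h
    vanish, then u * h lies in I for some u not vanishing at the point. Indeed h lies in I modulo
    every power of the maximal ideal ([ord_all]), and Krull's intersection theorem concludes
    ([krull_intersection]). For I the ideal of an irreducible Y containing the family and h an
    equation of the closure, Y lies in the union of the zeros of u and of h, and irreducibility
    leaves the zeros of h ([rigid_component]).

    Equality of the two spaces is turned into uniqueness for a linear system. If T is contained in K
    and no nonzero vector of K is orthogonal to T, then K = T ([sub_orthogonal]). It is thus enough
    that a form eta is zero as soon as it satisfies the linearized Frobenius equations and is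
    orthogonal to all L_B Om0 and to V. For an Om0 with integer coefficients this is an integer
    system in the coefficients of eta, settled by exact sparse elimination.

    That Om0 defines a foliation at all requires a singular set of codimension at least 2. This is
    certified by a plane on which two coefficients of Om0 have no common zero but the origin: a
    resultant then projects the singular set into a hypersurface along all nearby directions
    ([transverse_eliminant], [thin_codim_ge2]), and the certificate is an open condition, hence
    persists along curves. For each parameter list, one explicit quadratic vector field passes all
    these tests ([component_checkP], [parameters_check]). *)

Local Notation "{ 'mpoly' T [ n ] }" := (mpoly n T)
  (at level 0, T, n at level 2, format "{ 'mpoly'  T [ n ] }").
Local Notation "''X_' i" := (mpolyX _ (mnm1 i))
  (at level 8, i at level 2, format "''X_' i").
Local Notation "''X_[' m ]" := (mpolyX _ m)
  (at level 8, m at level 2, format "''X_[' m ]").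
Local Notation "p @_ i" := (mcoeff i p)
  (at level 3, i at level 2, left associativity, format "p @_ i").
Local Notation homog d := (ishomog1 d mdeg).

(** * Noetherian rings *)

Definition is_ideal (R : comNzRingType) (J : R -> Prop) :=
  [/\ J 0, forall x y, J x -> J y -> J (x + y) & forall a x, J x -> J (a * x)].

(** The generated ideal as the intersection of all ideals containing [S]: an inclusion into an ideal
    [J] is then proved by applying membership to [J]. *)
Definition gen (R : comNzRingType) (S : R -> Prop) (x : R) :=
  forall J, is_ideal J -> (forall y, S y -> J y) -> J x.

Definition noeth (R : comNzRingType) := forall J : R -> Prop, is_ideal J ->
  exists2 s : seq R, forall x, x \in s -> J x &
    forall x, J x -> gen (fun y => y \in s) x.

Section Ideals.
Variable R : comNzRingType.
Implicit Types (J S : R -> Prop).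

Lemma ideal_sum J (I : Type) (r : seq I) (P : pred I) (F : I -> R) :
  is_ideal J -> (forall i, P i -> J (F i)) -> J (\sum_(i <- r | P i) F i).
Proof. by case=> J0 JD _ JF; elim/big_ind: _. Qed.

Lemma idealN J x : is_ideal J -> J x -> J (- x).
Proof. by case=> _ _ JM Jx; rewrite -mulN1r; apply: JM. Qed.

Lemma idealB J x y : is_ideal J -> J x -> J y -> J (x - y).
Proof. by move=> idJ Jx Jy; case: (idJ) => _ JD _; apply: JD => //; apply: idealN. Qed.

Lemma gen_ideal S : is_ideal (gen S).
Proof.
split=> [J [] //|x y Sx Sy J idJ SJ|a x Sx J idJ SJ]; case: (idJ) => J0 JD JM.
  by apply: JD; [apply: Sx|apply: Sy].
by apply: JM; apply: Sx.
Qed.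

Lemma sub_gen S x : S x -> gen S x.
Proof. by move=> Sx J _; apply. Qed.

Lemma gen_sub S S' x : (forall y, S y -> gen S' y) -> gen S x -> gen S' x.
Proof. by move=> SS'; apply; [apply: gen_ideal|]. Qed.

End Ideals.

Lemma noeth_field (F : fieldType) : noeth F.
Proof.
move=> J [J0 JD JM]; have [[x Jx x0]|nJ] := pselect (exists2 x, J x & x != 0).
  exists [:: x] => [y|y Jy]; first by rewrite inE => /eqP ->.
  rewrite -[y](mulfVK x0); have [_ _ gM] := gen_ideal (fun y => y \in [:: x]).
  by apply: gM; apply: sub_gen; rewrite inE.
exists [::] => // x Jx; have [->|x0] := eqVneq x 0; first by move=> I [].
by case: nJ; exists x.
Qed.

Lemma noeth_surj (R S : comNzRingType) (f : {rmorphism R -> S}) :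
  (forall y, exists x, f x = y) -> noeth R -> noeth S.
Proof.
move=> fsurj nR J [J0 JD JM].
have idP : is_ideal (fun x => J (f x)).
  split=> [|x y Jx Jy|a x Jx]; first by rewrite rmorph0.
    by rewrite rmorphD; apply: JD.
  by rewrite rmorphM; apply: JM.
have [s sJ Js] := nR _ idP; exists (map f s).
  by move=> _ /mapP[x xs ->]; apply: sJ.
move=> y Jy; have [x fx] := fsurj y; rewrite -fx in Jy *.
apply: (Js x Jy (fun z => gen (fun t => t \in map f s) (f z))) => [|z zs]; last first.
  by apply: sub_gen; apply: map_f.
have [g0 gD gM] := gen_ideal (fun t => t \in map f s).
split=> [|u v gu gv|a u gu]; first by rewrite rmorph0.
  by rewrite rmorphD; apply: gD.
by rewrite rmorphM; apply: gM.
Qed.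

Lemma seq_choice (T : eqType) (U : eqType) (s : seq T) (P : T -> U -> Prop) :
  (forall x, x \in s -> exists y, P x y) ->
  exists2 r : seq U, (forall x, x \in s -> exists2 y, y \in r & P x y) &
    forall y, y \in r -> exists2 x, x \in s & P x y.
Proof.
elim: s => [|x s IH] sP; first by exists [::].
have [y|r rP rs] := IH; first by move=> ys; apply: sP; rewrite inE ys orbT.
have [|y xy] := sP x; first by rewrite inE eqxx.
exists (y :: r) => [z|z]; rewrite inE => /predU1P[->|].
- by exists y; rewrite ?inE ?eqxx.
- by move=> /rP[t tr zt]; exists t; rewrite ?inE ?tr ?orbT.
- by exists x; rewrite ?inE ?eqxx.
- by move=> /rs[t tr zt]; exists t; rewrite ?inE ?tr ?orbT.
Qed.

Section HilbertBasis.
Variables (R : comNzRingType) (J : {poly R} -> Prop).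
Hypotheses (nR : noeth R) (idJ : is_ideal J).

(** The size is only bounded, so the coefficient [c] may be zero; this makes [lead d] an ideal,
    increasing with [d]. *)
Let lead d c := exists p, [/\ J p, (size p <= d.+1)%N & p`_d = c].

Let lead_ideal d : is_ideal (lead d).
Proof.
case: idJ => J0 JD JM; split=> [|_ _ [p [Jp sp <-]] [q [Jq sq <-]]|a _ [p [Jp sp <-]]].
- by exists 0; rewrite size_poly0 coef0.
- exists (p + q); rewrite coefD; split=> //; first exact: JD.
  by rewrite (leq_trans (size_polyD _ _)) // geq_max sp.
- exists (a%:P * p); rewrite coefCM; split=> //; first exact: JM.
  by rewrite mul_polyC (leq_trans (size_scale_leq _ _)).
Qed.

Let leadS d k c : lead d c -> lead (d + k) c.
Proof.
case: idJ => J0 JD JM [p [Jp sp <-]]; exists ('X^k * p); split; first exact: JM.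
  by rewrite mulrC (leq_trans (size_polyMleq _ _)) // size_polyXn -addSn; lia.
by rewrite coefXnM addnK ltnNge leq_addl.
Qed.

Let lifts (G : seq {poly R}) d := forall c, lead d c ->
  exists q, [/\ gen (fun p => p \in G) q, (size q <= d.+1)%N & q`_d = c].

Let lifts_sub G G' d : {subset G <= G'} -> lifts G d -> lifts G' d.
Proof.
move=> GG' l c /l[q [gq sq qc]]; exists q; split=> //.
by apply: gen_sub gq => y yG; apply: sub_gen; apply: GG'.
Qed.

Let liftable_ideal (G : seq {poly R}) d : is_ideal (fun c =>
  exists q, [/\ gen (fun p => p \in G) q, (size q <= d.+1)%N & q`_d = c]).
Proof.
have [g0 gD gM] := gen_ideal (fun p => p \in G).
split=> [|_ _ [p [Jp sp <-]] [q [Jq sq <-]]|a _ [p [Jp sp <-]]].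
- by exists 0; rewrite size_poly0 coef0.
- exists (p + q); rewrite coefD; split=> //; first exact: gD.
  by rewrite (leq_trans (size_polyD _ _)) // geq_max sp.
- exists (a%:P * p); rewrite coefCM; split=> //; first exact: gM.
  by rewrite mul_polyC (leq_trans (size_scale_leq _ _)).
Qed.

Let lifts_one d : exists2 G, (forall p, p \in G -> J p) & lifts G d.
Proof.
have [s sl ls] := nR (lead_ideal d).
have [G sG Gs] := seq_choice sl; exists G => [p /Gs[x _ []] //|c /ls gc].
apply: (gc _ (liftable_ideal G d)).
by move=> x /sG[p pG [Jp sp px]]; exists p; split=> //; apply: sub_gen.
Qed.

Let lifts_large : exists N, exists2 G, (forall p, p \in G -> J p) &
  forall d, (N <= d)%N -> lifts G d.
Proof.
have idL : is_ideal (fun c => exists d, lead d c).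
  split=> [|x y [d xd] [e ye]|a x [d xd]].
  - by exists 0%N; have [] := lead_ideal 0.
  - exists (d + e)%N; have [_ lD _] := lead_ideal (d + e); apply: lD.
      exact: leadS.
    by rewrite addnC; apply: leadS.
  - by exists d; have [_ _ lM] := lead_ideal d; apply: lM.
have [s sl ls] := nR idL.
have [ds sds dss] := seq_choice sl.
have sl' x : x \in s -> exists p, [/\ J p,
    (size p <= (\max_(d <- ds) d).+1)%N & p`_(\max_(d <- ds) d) = x].
  move=> /sds[d dds xd]; have -> : (\max_(d <- ds) d = d + (\max_(d <- ds) d - d))%N.
    by rewrite subnKC //; apply: (@leq_bigmax_seq nat ds xpredT id d).
  exact: leadS.
have [G sG Gs] := seq_choice sl'.
exists (\max_(d <- ds) d)%N, G => [p /Gs[x _ []] //|d Nd c [p Jpc]].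
have gc : gen (fun y => y \in s) c by apply: ls; exists d, p.
apply: (gc _ (liftable_ideal G d)) => x /sG[q qG [Jq sq <-]]; exists ('X^(d - \max_(d <- ds) d) * q); split.
- by have [_ _ gM] := gen_ideal (fun p => p \in G); apply: gM; apply: sub_gen.
- by rewrite mulrC (leq_trans (size_polyMleq _ _)) // size_polyXn; lia.
- by rewrite coefXnM ltnNge leq_subr /= subKn.
Qed.

(** Hilbert's argument. The union of the ideals [lead d] is finitely generated, so one finite set
    lifts leading coefficients in all large degrees, and finitely many more elements serve the small
    degrees. Subtracting a lift lowers the size of a polynomial of [J], whence induction. *)
Lemma hilbert_basis_ideal : exists2 s : seq {poly R}, forall x, x \in s -> J x &
    forall x, J x -> gen (fun y => y \in s) x.
Proof.
have [N [G0 G0J G0l]] := lifts_large.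
have [G GJ Gl] : exists2 G, (forall p, p \in G -> J p) & forall d, lifts G d.
  suff [G GJ Gl] : exists2 G, (forall p, p \in G -> J p) &
      forall d, (d < N)%N -> lifts G d.
    exists (G ++ G0) => [p|d]; first by rewrite mem_cat => /orP[/GJ|/G0J].
    by case: (ltnP d N) => [/Gl|/G0l]; apply: lifts_sub => p pG;
      rewrite mem_cat pG ?orbT.
  elim: N {G0l} => [|N [G GJ Gl]]; first by exists [::].
  have [H HJ Hl] := lifts_one N.
  exists (G ++ H) => [p|d]; first by rewrite mem_cat => /orP[/GJ|/HJ].
  rewrite ltnS leq_eqVlt => /predU1P[->|/Gl]; last first.
    by apply: lifts_sub => p pG; rewrite mem_cat pG.
  by apply: lifts_sub Hl => p pG; rewrite mem_cat pG orbT.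
exists G => // p; have [n] := ubnP (size p); elim: n p => // n IHn p sp Jp.
have [g0 gD gM] := gen_ideal (fun p => p \in G).
have [->|p0] := eqVneq p 0; first exact: g0.
have sp0 : (0 < size p)%N by rewrite size_poly_gt0.
have [|q [gq sq qp]] := Gl (size p).-1 p`_(size p).-1.
  by exists p; split=> //; rewrite prednK.
rewrite prednK // in sq.
have Jq : J q by apply: gq => //.
rewrite -[p](subrK q); apply: gD => //; apply: IHn; last exact: idealB.
rewrite -ltnS (leq_trans _ sp) // !ltnS.
rewrite -[X in (_ < X)%N](prednK sp0) ltnS; apply/leq_sizeP => j.
rewrite leq_eqVlt coefB => /predU1P[<-|lt]; first by rewrite qp subrr.
have jp : (size p <= j)%N by rewrite -(prednK sp0).
by rewrite !nth_default ?subrr // (leq_trans sq).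
Qed.

End HilbertBasis.

Lemma noeth_poly (R : comNzRingType) : noeth R -> noeth {poly R}.
Proof. by move=> nR J; apply: hilbert_basis_ideal. Qed.

Lemma noeth_mpoly (R : comNzRingType) n : noeth R -> noeth {mpoly R[n]}.
Proof.
move=> nR; elim: n => [|n IHn].
  apply: (noeth_surj (f := mpolyC 0 (R:=R))) nR => p.
  by exists (p@_(@mnm0 0)); exact: (esym (nvar0_mpolyC p)).
(* [f] substitutes the last variable for the indeterminate; a surjection carries the Noetherian
   property over from the iterated polynomial ring. *)
pose f : {rmorphism {poly {mpoly R[n]}} -> {mpoly R[n.+1]}} :=
  horner_eval ('X_(@ord_max n) : {mpoly R[n.+1]}) \o map_poly (@mwiden n R).
apply: (noeth_surj (f := f)) (noeth_poly IHn) => p.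
have imX (i : 'I_n.+1) : exists x, f x = 'X_i.
  have [j ->|->] := unliftP ord_max i.
    exists ('X_j)%:P; rewrite /f /= map_polyC /= /horner_eval hornerC.
    rewrite mwidenX mnmwiden1; congr mpolyX; congr mnm1.
    by apply/val_inj; rewrite /= /bump leqNgt ltn_ord.
  by exists 'X; rewrite /f /= map_polyX /horner_eval hornerX.
elim/mpolyind: p => [|c m p _ _ [y fy]]; first by exists 0; rewrite rmorph0.
have [x fx] : exists x, f x = 'X_[m].
  rewrite mpolyXE_id; elim/big_ind: _ => [|_ _ [x <-] [z <-]|i _].
  - by exists 1; apply: (rmorph1 f).
  - by exists (x * z); apply: (rmorphM f).
  - by have [x fx] := imX i; exists (x ^+ m i); rewrite (rmorphXn f) fx.
exists ((mpolyC n c)%:P * x + y); rewrite (rmorphD f) (rmorphM f) fx fy.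
by rewrite /f /= map_polyC /= /horner_eval hornerC mwidenC mul_mpolyC.
Qed.

(** * Krull's intersection theorem at a rational point *)

Section Order.
Variables (n : nat) (R : comNzRingType).
Implicit Types f g : {mpoly R[n]}.

(** Membership in the k-th power of the maximal ideal of the origin. *)
Definition ord_ge k f := forall m, (mdeg m < k)%N -> f@_m = 0.

Lemma ord_geD k f g : ord_ge k f -> ord_ge k g -> ord_ge k (f + g).
Proof. by move=> kf kg m mk; rewrite mcoeffD kf // kg // addr0. Qed.

Lemma ord_ge_sum k (I : Type) (r : seq I) (P : pred I) (F : I -> {mpoly R[n]}) :
  (forall i, P i -> ord_ge k (F i)) -> ord_ge k (\sum_(i <- r | P i) F i).
Proof.
move=> kF; elim/big_ind: _ => //; last exact: ord_geD.
by move=> m _; rewrite mcoeff0.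
Qed.

Lemma ord_geZ k c f : ord_ge k f -> ord_ge k (c *: f).
Proof. by move=> kf m mk; rewrite mcoeffZ kf // mulr0. Qed.

Lemma ord_geM k l f g : ord_ge k f -> ord_ge l g -> ord_ge (k + l) (f * g).
Proof.
move=> kf lg m mkl; rewrite mcoeffM big1 // => -[i j] /= /eqP mE.
have [ik|ki] := ltnP (mdeg i) k; first by rewrite kf ?mul0r.
rewrite lg ?mulr0 //; have := congr1 mdeg mE; rewrite mdegD /= => mD; lia.
Qed.

Lemma ord_ge_zero k : ord_ge k 0.
Proof. by move=> m _; rewrite mcoeff0. Qed.

Lemma ord_ge0 f : ord_ge 0 f. Proof. by []. Qed.

Lemma ord_ge_leq k l f : (l <= k)%N -> ord_ge k f -> ord_ge l f.
Proof. by move=> lk kf m ml; apply: kf; apply: leq_trans lk. Qed.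

Lemma ord_geX (m : multinom n) : ord_ge (mdeg m) ('X_[m] : {mpoly R[n]}).
Proof.
by move=> m' mm'; rewrite mcoeffX; case: eqP => // mE; move: mm'; rewrite mE ltnn.
Qed.

End Order.

Lemma submonomial n (m : multinom n) k : (k <= mdeg m)%N ->
  exists2 m' : multinom n, lem m' m & mdeg m' = k.
Proof.
elim: k => [_|k IHk km]; first by exists (@mnm0 n); [apply/mnm_lepP => i; rewrite mnm0E|exact: mdeg0].
have [m' m'm m'k] := IHk (ltnW km).
have /existsP[i im] : [exists i, (m' i < m i)%N].
  apply: contraTT km; rewrite negb_exists => /forallP im; rewrite -leqNgt.
  by rewrite -m'k !mdegE leq_sum // => i _; rewrite leqNgt.
exists (mnm_add m' (mnm1 i)); last by rewrite mdegD mdeg1 m'k addn1.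
apply/mnm_lepP => j; rewrite mnmDE mnm1E; case: eqP => [<-|_].
  by rewrite addn1.
by rewrite addn0; move/mnm_lepP: m'm.
Qed.

Section Krull.
Variables (n : nat) (F : fieldType).
Local Notation A := {mpoly F[n]}.
Local Notation B := {mpoly A[n]}.
Local Notation ev := (meval (fun i : 'I_n => 'X_i : A)).

(** An element of m^k is a form of degree exactly k in the variables whose coefficients are
    themselves polynomials: each of its monomials is divisible by one of degree k. *)
Lemma ord_ge_homog k (r : A) : ord_ge k r ->
  exists2 P : B, P \is homog k & ev P = r.
Proof.
move=> kr; rewrite [r]mpolyE.
have: forall m, m \in msupp r -> (k <= mdeg m)%N.
  by move=> m; rewrite mcoeff_msupp leqNgt; apply: contra => /kr ->.
elim: (msupp r) => [_|m s IHs ks].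
  by exists 0; rewrite ?big_nil ?rpred0 ?meval0.
have [|P Pk PE] := IHs; first by move=> m' m's; apply: ks; rewrite inE m's orbT.
have [|m' m'm m'k] := @submonomial n m k; first by apply: ks; rewrite inE eqxx.
exists ((r@_m *: 'X_[mnm_sub m m']) *: 'X_[m'] + P).
  by apply: rpredD => //; apply: dhomogZ; rewrite dhomogX; apply/eqP.
rewrite mevalD PE big_cons mevalZ mevalX -mpolyXE_id -scalerAl -mpolyXD.
by rewrite submK.
Qed.

Lemma meval_homog_coef0 k (P : B) : P \is homog k.+1 -> (ev P)@_(@mnm0 n) = 0.
Proof.
move=> /dhomogP Pk; rewrite mevalE raddf_sum big_seq big1 // => m /Pk mk /=.
rewrite -mpolyXE_id mcoeffM big1 // => -[i j] /= /eqP.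
move=> /esym/eqP; rewrite mnmD_eq0 => /andP[_ /eqP ->].
by rewrite mcoeffX -mdeg_eq0 mk mulr0.
Qed.

Lemma pihomogMr d e (P Q : B) : P \is homog e -> (e <= d)%N ->
  pihomog mdeg d (Q * P) = pihomog mdeg (d - e) Q * P.
Proof.
move=> Pe ed; rewrite [in LHS](pihomog_partitionE (leqnn (mmeasure mdeg Q))).
rewrite mulr_suml raddf_sum /=.
have hE (i : nat) : pihomog mdeg d (pihomog mdeg i Q * P) =
    if (i == d - e)%N then pihomog mdeg i Q * P else 0.
  have iQP : pihomog mdeg i Q * P \is homog (i + e) by rewrite dhomogM ?pihomogP.
  case: eqP => [ie|ie]; first by rewrite pihomog_dE // -{1}[d](subnK ed) -ie.
  by apply: pihomog_ne0 iQP; apply/eqP; lia.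
under eq_bigr => i _ do rewrite hE.
have [lt|ge] := ltnP (d - e) (mmeasure mdeg Q).
  by rewrite (bigD1 (Ordinal lt)) //= eqxx big1 ?addr0 // => i; rewrite -val_eqE => /negPf ->.
rewrite big1 => [|i _]; last by case: eqP => // ie; have := ltn_ord i; rewrite ie ltnNge ge.
rewrite pihomogE big_seq_cond big1 ?mul0r // => m /andP[/mmeasure_mnm_lt lt /eqP me].
have lt' : (d - e < mmeasure mdeg Q)%N by rewrite -me; exact: lt.
by move: lt'; rewrite ltnNge ge.
Qed.

(** A Rees algebra argument. Write h modulo I as the value of a form [P k] of degree k with
    coefficients in the ring. By Noetherianity some [P N] is a combination of the earlier [P k]; its
    part of degree N has multipliers of positive degree N - k, whose values q_k vanish at the
    origin. Modulo I this reads h = sum q_k h, and u = 1 - sum q_k. *)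
Lemma krull_intersection (I : A -> Prop) (h : A) : is_ideal I ->
  (forall k, exists2 r, ord_ge k r & I (h - r)) ->
  exists2 u, u@_(@mnm0 n) = 1 & I (u * h).
Proof.
move=> idI hI.
have /choice[P hP] k : exists P : B, P \is homog k /\ I (h - ev P).
  have [r /ord_ge_homog[P Pk Pr] Ir] := hI k.
  by exists P; rewrite Pr.
have [Phom PI] : (forall k, P k \is homog k) /\ forall k, I (h - ev (P k)).
  by split=> k; case: (hP k).
pose lo N x := exists Q : nat -> B, x = \sum_(k < N) Q k * P k.
have lo_ideal N : is_ideal (lo N).
  split=> [|_ _ [Q ->] [Q' ->]|a _ [Q ->]].
  - by exists (fun=> 0); rewrite big1 // => i; rewrite mul0r.
  - exists (fun k => Q k + Q' k); rewrite -big_split.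
    by apply: eq_bigr => i _; rewrite mulrDl.
  - by exists (fun k => a * Q k); rewrite mulr_sumr; apply: eq_bigr => i _; rewrite mulrA.
have lo_leq M N x : (M <= N)%N -> lo M x -> lo N x.
  move=> MN [Q ->]; exists (fun k => if (k < M)%N then Q k else 0).
  rewrite (big_ord_widen N (fun k => Q k * P k)) // big_mkcond.
  by apply: eq_bigr => i _; case: ifP; rewrite ?mul0r.
have [s sJ Js] := @noeth_mpoly _ n (@noeth_mpoly _ n (@noeth_field F))
  _ (gen_ideal (fun x => exists k, x = P k)).
have slo x : x \in s -> exists N, lo N x.
  move=> /sJ gx; apply: (gx (fun x => exists N, lo N x)); last first.
    move=> _ [k ->]; exists k.+1, (fun j => (j == k)%:R).
    rewrite (bigD1 ord_max) //= eqxx mul1r big1 ?addr0 // => j.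
    by rewrite -val_eqE /= => /negPf ->; rewrite mul0r.
  split=> [|x1 x2 [N1 l1] [N2 l2]|a x1 [N1 l1]].
  - by exists 0%N; have [] := lo_ideal 0%N.
  - exists (N1 + N2)%N; have [_ D _] := lo_ideal (N1 + N2)%N.
    by apply: D; [apply: lo_leq l1|apply: lo_leq l2]; rewrite ?leq_addr ?leq_addl.
  - by exists N1; have [_ _ M] := lo_ideal N1; apply: M.
have [Ns sN Ns'] := seq_choice slo.
pose N := (\max_(j <- Ns) j)%N.
(* Each of the finitely many generators is a combination of finitely many [P k]; [N] bounds all the
   indices involved. *)
have [Q PQ] : lo N (P N).
  apply: (Js (P N) _ _ (lo_ideal N)); first by apply: sub_gen; exists N.
  move=> x /sN[j jNs]; apply: lo_leq.
  exact: (@leq_bigmax_seq nat Ns xpredT id j).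
(* Keeping only the part of degree N - k of each multiplier does not change the identity, since
   [P N] and [P k] are homogeneous. *)
pose q k := ev (pihomog mdeg (N - k) (Q k)).
have PN : ev (P N) = \sum_(k < N) q k * ev (P k).
  have -> : P N = \sum_(k < N) pihomog mdeg (N - k) (Q k) * P k.
    rewrite -[LHS](pihomog_dE (Phom N)) PQ linear_sum.
    by apply: eq_bigr => k _; exact: (pihomogMr (Q k) (Phom k) (ltnW (ltn_ord k))).
  by rewrite raddf_sum; apply: eq_bigr => k _; exact: mevalM.
exists (1 - \sum_(k < N) q k).
  rewrite mcoeffB mcoeff1 eqxx raddf_sum big1 ?subr0 // => k _ /=.
  have kN := ltn_ord k; apply: (@meval_homog_coef0 (N - k).-1).
  by rewrite prednK ?subn_gt0 //; apply: pihomogP.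
have -> : (1 - \sum_(k < N) q k) * h =
    (h - ev (P N)) - \sum_(k < N) q k * (h - ev (P k)).
  rewrite PN mulrBl mul1r mulr_suml -addrA -opprD; congr (_ - _).
  by rewrite -big_split /=; apply: eq_bigr => k _; rewrite -mulrDr addrC subrK.
apply: idealB => //; apply: ideal_sum => // k _.
by have [_ _ IM] := idI; apply: IM.
Qed.

End Krull.

Section Curves.
Variables (n : nat) (R : comNzRingType).
Implicit Types (p q : {mpoly R[n]}) (gam : 'I_n -> {poly R}).

Definition along gam p : {poly R} := mmap polyC gam p.

Lemma alongM gam : {morph along gam : p q / p * q}.
Proof. by move=> p q; apply: rmorphM. Qed.

Lemma alongD gam : {morph along gam : p q / p + q}.
Proof. by move=> p q; apply: rmorphD. Qed.

Lemma alongB gam : {morph along gam : p q / p - q}.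
Proof. by move=> p q; apply: rmorphB. Qed.

Lemma along_sum gam (I : Type) (r : seq I) (P : pred I) (F : I -> {mpoly R[n]}) :
  along gam (\sum_(i <- r | P i) F i) = \sum_(i <- r | P i) along gam (F i).
Proof. exact: raddf_sum. Qed.

Lemma along0 gam : along gam 0 = 0.
Proof. exact: rmorph0. Qed.

Lemma alongZ gam c p : along gam (c *: p) = c%:P * along gam p.
Proof. exact: mmapZ. Qed.

Lemma alongXU gam i : along gam 'X_i = gam i.
Proof. by rewrite /along mmapX mmap1U. Qed.

Lemma alongC gam c : along gam (mpolyC n c) = c%:P.
Proof. exact: mmapC. Qed.

Lemma along_X gam m : along gam 'X_[m] = \prod_i gam i ^+ m i.
Proof. by rewrite /along mmapX. Qed.

Lemma horner_along gam p t : (along gam p).[t] = meval (fun i => (gam i).[t]) p.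
Proof.
elim/mpolyind: p => [|c m p _ _ IH]; first by rewrite along0 meval0 horner0.
rewrite alongD alongZ hornerD hornerCM IH mevalD mevalZ mevalX along_X.
by rewrite horner_prod; congr (_ * _ + _); apply: eq_bigr => i _; rewrite horner_exp.
Qed.

Lemma mpoly_ring_ind (P : {mpoly R[n]} -> Prop) :
  (forall c, P (mpolyC n c)) -> (forall i, P 'X_i) ->
  (forall p q, P p -> P q -> P (p + q)) -> (forall p q, P p -> P q -> P (p * q)) ->
  forall p, P p.
Proof.
move=> PC PX PD PM p; elim/mpolyind: p => [|c m p _ _ Pp].
  by rewrite -(mpolyC0 n R).
apply: PD => //; rewrite -mul_mpolyC; apply: (PM) => //.
rewrite mpolyXE_id; elim/big_ind: _ => [|p1 p2|i _]; [by rewrite -(mpolyC1 n R)|exact: PM|].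
elim: (m i) => [|k Pk]; first by rewrite expr0 -(mpolyC1 n R).
by rewrite exprS; apply: PM.
Qed.

Lemma deriv_along gam p :
  (along gam p)^`() = \sum_i along gam (mderiv i p) * (gam i)^`().
Proof.
elim/mpoly_ring_ind: p => [c|i|p q Pp Pq|p q Pp Pq].
- by rewrite alongC derivC big1 // => i _; rewrite mderivC along0 mul0r.
- rewrite alongXU (bigD1 i) //= mderivX mnm1E eqxx scale1r.
  rewrite big1 => [|j ji]; last first.
    by rewrite mderivX mnm1E eq_sym (negPf ji) scale0r along0 mul0r.
  have -> : mnm_sub (mnm1 i) (mnm1 i) = @mnm0 n.
    by apply/mnmP => k; rewrite mnmBE subnn mnm0E.
  by rewrite mpolyX0 -(mpolyC1 n R) alongC mul1r addr0.
- rewrite alongD derivD Pp Pq -big_split; apply: eq_bigr => i _ /=.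
  by rewrite mderivD alongD mulrDl.
- rewrite alongM derivM Pp Pq mulr_suml mulr_sumr -big_split; apply: eq_bigr => i _ /=.
  by rewrite mderivM alongD !alongM; ring.
Qed.

End Curves.

Section Infinite.
Variables (n : nat) (R : numDomainType).

Lemma poly_eq0_horner (p : {poly R}) : (forall t, p.[t] = 0) -> p = 0.
Proof.
move=> p0; apply: (@roots_geq_poly_eq0 _ _ [seq k%:R | k <- iota 0 (size p)]).
- by apply/allP => _ /mapP[k _ ->]; apply/rootP.
- by rewrite map_inj_uniq ?iota_uniq //; apply: (mulrIn (oner_neq0 R)).
- by rewrite size_map size_iota.
Qed.

(** Induction on the degree: the partial derivatives also vanish at all points, hence are zero, and
    in characteristic 0 only the constant term is left. *)
Lemma meval_eq0 (p : {mpoly R[n]}) : (forall x, meval x p = 0) -> p = 0.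
Proof.
have [k] : exists k, forall m, (k <= mdeg m)%N -> p@_m = 0.
  by exists (mmeasure mdeg p) => m /mmeasure_mnm_ge /memN_msupp_eq0.
elim: k p => [|k IHk] p pk p0.
  by apply/mpolyP => m; rewrite mcoeff0 pk.
have dp i : mderiv i p = 0.
  apply: IHk => [m km|x].
    by rewrite mcoeff_mderiv pk ?mul0rn // mdegD mdeg1 addn1 ltnS.
  have /(congr1 (fun q => (deriv q).[0])) :
      along (fun j => (x j)%:P + (j == i)%:R *: 'X) p = 0.
    by apply: poly_eq0_horner => t; rewrite horner_along p0.
  rewrite deriv_along deriv0 horner0 horner_sum (bigD1 i) //= big1 => [|j ji].
    rewrite eqxx scale1r derivD derivC derivX add0r mulr1 addr0 horner_along.
    by move=> <-; apply: meval_eq => j; rewrite !hornerE /= ?mulr0 ?addr0.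
  by rewrite (negPf ji) scale0r addr0 derivC mulr0 horner0.
have pC m : m != @mnm0 n -> p@_m = 0.
  move=> /eqP m0; have [i mi] : exists i, m i != 0%N.
    apply: contrapT => nm; apply: m0; apply/mnmP => i; rewrite mnm0E.
    by apply/eqP; apply: contrapT => mi; apply: nm; exists i; apply/negP.
  have /eqP := congr1 (mcoeff (mnm_sub m (mnm1 i))) (dp i).
  rewrite mcoeff_mderiv mcoeff0 submK; last by rewrite lep1mP.
  by rewrite mulrn_eq0 => /eqP.
have pE : p = mpolyC n p@_(@mnm0 n).
  apply/mpolyP => m; rewrite mcoeffC; have [->|/pC ->] := eqVneq m (@mnm0 n).
    by rewrite mulr1.
  by rewrite mulr0.
by have := p0 (fun=> 0); rewrite pE mevalC => ->; rewrite mpolyC0.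
Qed.

Lemma meval_inj (p q : {mpoly R[n]}) : (forall x, meval x p = meval x q) -> p = q.
Proof. by move=> pq; apply/subr0_eq/meval_eq0 => x; rewrite mevalB pq subrr. Qed.

End Infinite.

(** * Rigidity from the tangent space *)

Section Rows.
Variables (F : fieldType) (n : nat) (D : 'rV[F]_n -> Prop).
Hypotheses (D0 : D 0) (DD : forall a u v, D u -> D v -> D (a *: u + v)).

(** Among the matrices with rows in [D], one of maximal rank spans [D]: a further vector would
    increase the rank. *)
Lemma subspace_mx : exists K : 'M[F]_n, forall v, D v <-> (v <= K)%MS.
Proof.
have D_sub (K : 'M[F]_n) v : (forall i, D (row i K)) -> (v <= K)%MS -> D v.
  move=> DK /submxP[w ->]; rewrite mulmx_sum_row; elim/big_ind: _ => // [x y Dx Dy|i _].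
    by rewrite -[x]scale1r; apply: DD.
  by rewrite -[_ *: _]addr0; apply: DD.
pose P r := `[< exists2 K : 'M[F]_n, forall i, D (row i K) & \rank K = r >].
have exP : exists r, P r.
  by exists 0%N; apply/asboolP; exists 0; rewrite ?mxrank0 // => i; rewrite row0.
have bP r : P r -> (r <= n)%N.
  by move=> /asboolP[K _ <-]; apply: rank_leq_col.
case: (ex_maxnP exP bP) => r /asboolP[K DK rK] rmax; exists K => v; split; last exact: D_sub.
move=> Dv; apply: contrapT => /negP nvK.
have DKv w : (w <= K + v)%MS -> D w.
  move=> /sub_addsmxP[[a b] /= ->]; have /sub_rVP[c ->] := submxMl b v.
  by rewrite addrC; apply: DD => //; apply: D_sub DK (submxMl _ _).
have /rmax : P (\rank (K + v)%MS).
  by apply/asboolP; exists (K + v)%MS => // i; apply: DKv; apply: row_sub.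
rewrite -rK leqNgt => /negP; apply.
rewrite ltn_neqAle mxrankS ?addsmxSl // andbT; apply/eqP => rKv.
move/negP: nvK; apply; apply: (submx_trans (addsmxSr K v)).
by rewrite -(geq_leqif (mxrank_leqif_sup (addsmxSl K v))) rKv.
Qed.
End Rows.

Section Tangent.
Variables (n : nat) (F : numFieldType).
Local Notation A := {mpoly F[n]}.
Implicit Types (r h : A) (v : 'I_n -> F).

Definition tangent (I : A -> Prop) v :=
  forall g, I g -> \sum_i v i * g@_(mnm1 i) = 0.

(** The arc is t times an arc starting at v, so a monomial of degree d contributes from t^d on; at
    t^k only the form of degree k counts, at the point v. *)
Lemma coef_along k r (gam : 'I_n -> {poly F}) v : ord_ge k r ->
  (forall i, (gam i)`_0 = 0 /\ (gam i)`_1 = v i) ->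
  (along gam r)`_k = meval v (pihomog mdeg k r).
Proof.
move=> kr gv; have /choice[del gE] i : exists q, gam i = 'X * q.
  have [g0 _] := gv i; have /factor_theorem[q qE] : root (gam i) 0.
    by rewrite /root horner_coef0 g0.
  by exists q; rewrite qE subr0 mulrC.
have del0 i : (del i)`_0 = v i.
  by have [_ <-] := gv i; rewrite gE coefXM.
rewrite [r in LHS]mpolyE along_sum coef_sum pihomogE raddf_sum /=.
rewrite [RHS]big_mkcond big_seq [RHS]big_seq; apply: eq_bigr => m mr.
have km : (k <= mdeg m)%N.
  by move: mr; rewrite mcoeff_msupp leqNgt; apply: contra => /kr ->.
rewrite alongZ coefCM along_X.
have -> : \prod_i gam i ^+ m i = 'X^(mdeg m) * \prod_i del i ^+ m i.
  rewrite mdegE -prodrXr -big_split; apply: eq_bigr => i _.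
  by rewrite gE exprMn.
rewrite coefXnM ltn_neqAle eq_sym; case: (eqVneq (mdeg m) k) => [<-|mk] /=.
  rewrite subnn -horner_coef0 horner_prod mevalZ mevalX; congr (_ * _).
  by apply: eq_bigr => i _; rewrite horner_exp horner_coef0 del0.
by rewrite km mulr0.
Qed.

Lemma ord_ge_comp k r (lq : n.-tuple A) :
  (forall i, ord_ge 1 (tnth lq i)) -> ord_ge k r -> ord_ge k (comp_mpoly lq r).
Proof.
move=> lq1 kr; rewrite [r]mpolyE raddf_sum big_seq; apply: ord_ge_sum => m mr /=.
have km : (k <= mdeg m)%N.
  by move: mr; rewrite mcoeff_msupp leqNgt; apply: contra => /kr ->.
rewrite comp_mpolyZ comp_mpolyX; apply: ord_geZ; apply: ord_ge_leq km _.
rewrite mdegE; elim/big_rec2: _ => [|i d p _ pd]; first exact: ord_ge0.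
apply: ord_geM => //; elim: (m i) => [|e IHe]; first exact: ord_ge0.
by rewrite exprS -add1n; apply: ord_geM.
Qed.

(** For a monomial, one variable X_i is replaced by its image and the rest handled by induction on
    the degree. Each cofactor loses one degree, whence the shift from k + 1 to k. *)
Lemma sub_comp_mpoly k r (lq : n.-tuple A) : (forall i, ord_ge 1 (tnth lq i)) ->
  ord_ge k.+1 r -> exists2 s : 'I_n -> A, forall i, ord_ge k (s i) &
    r - comp_mpoly lq r = \sum_i ('X_i - tnth lq i) * s i.
Proof.
move=> lq1.
pose P l r1 := exists2 s : 'I_n -> A, forall i, ord_ge l (s i) &
    r1 - comp_mpoly lq r1 = \sum_i ('X_i - tnth lq i) * s i.
have PD l r1 r2 : P l r1 -> P l r2 -> P l (r1 + r2).
  move=> [s1 s1k E1] [s2 s2k E2]; exists (fun i => s1 i + s2 i) => [i|].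
    exact: ord_geD.
  rewrite comp_mpolyD opprD addrACA E1 E2 -big_split.
  by apply: eq_bigr => i _; rewrite mulrDr.
have PZ l c r1 : P l r1 -> P l (c *: r1).
  move=> [s1 s1k E1]; exists (fun i => c *: s1 i) => [i|]; first exact: ord_geZ.
  by rewrite comp_mpolyZ -scalerBr E1 scaler_sumr; apply: eq_bigr => i _; rewrite scalerAr.
have PX m : P (mdeg m).-1 'X_[m].
  have [d] := ubnP (mdeg m); elim: d m => // d IHd m mk.
  have [->|m0] := eqVneq m (@mnm0 n).
    exists (fun=> 0) => [i|]; first exact: ord_ge_zero.
    by rewrite mpolyX0 comp_mpoly1 subrr big1 // => i _; rewrite mulr0.
  have /existsP[i mi] : [exists i, m i != 0%N].
    apply: contraNT m0; rewrite negb_exists => /forallP m0; apply/eqP/mnmP => i.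
    by rewrite mnm0E; apply/eqP; rewrite -[_ == _]negbK.
  have mE : m = mnm_add (mnm_sub m (mnm1 i)) (mnm1 i) by rewrite submK ?lep1mP.
  set m' := mnm_sub m (mnm1 i) in mE; have md : mdeg m = (mdeg m').+1.
    by rewrite mE mdegD mdeg1 addn1.
  have [|s sk sE] := IHd m'; first by rewrite md ltnS in mk.
  exists (fun j => (j == i)%:R * 'X_[m'] + tnth lq i * s j) => [j|].
    rewrite md /=; apply: ord_geD.
      case: eqP => _; first by rewrite mul1r; apply: ord_geX.
      by rewrite mul0r; apply: ord_ge_zero.
    apply: (@ord_ge_leq _ _ (1 + (mdeg m').-1)); first by case: (mdeg m').
    exact: ord_geM.
  rewrite mE mpolyXD rmorphM /= comp_mpolyXU -tnth_nth.
  transitivity (('X_i - tnth lq i) * 'X_[m'] +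
      tnth lq i * ('X_[m'] - comp_mpoly lq 'X_[m'])); first by ring.
  rewrite sE mulr_sumr; under [RHS]eq_bigr => j _ do rewrite mulrDr.
  rewrite big_split /=; congr (_ + _); last by apply: eq_bigr => j _; rewrite mulrCA.
  rewrite (bigD1 i) //= eqxx mul1r big1 ?addr0 // => j /negPf ->.
  by rewrite mul0r mulr0.
move=> kr; rewrite [r]mpolyE; apply: (big_ind (P k)).
- exists (fun=> 0) => [i|]; first exact: ord_ge_zero.
  by rewrite comp_mpoly0 subrr big1 // => i _; rewrite mulr0.
- exact: PD.
- move=> m _; have [lt|km] := ltnP (mdeg m) k.+1.
    rewrite kr // scale0r; exists (fun=> 0) => [i|]; first exact: ord_ge_zero.
    by rewrite comp_mpoly0 subrr big1 // => i _; rewrite mulr0.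
  apply: PZ; have [s sk sE] := PX m; exists s => // i.
  by apply: ord_ge_leq (sk i); case: (mdeg m) km.
Qed.

End Tangent.

Section Rigid.
Variables (n : nat) (F : numFieldType).
Local Notation A := {mpoly F[n]}.
Implicit Types (r h : A) (v : 'I_n -> F) (I : A -> Prop).

Lemma mcoeff_pihomog d (p : A) m :
  (pihomog mdeg d p)@_m = if mdeg m == d then p@_m else 0.
Proof.
rewrite pihomogE raddf_sum /=; have [mp|mp] := boolP (m \in msupp p); last first.
  rewrite (memN_msupp_eq0 mp) if_same big_seq_cond big1 // => j /andP[jp _].
  rewrite mcoeffZ mcoeffX; case: eqP => [jm|_]; last by rewrite mulr0.
  by rewrite jm (negPf mp) in jp.
case: ifP => md.
  rewrite big_mkcond (bigD1_seq m) //= ?msupp_uniq // md mcoeffZ mcoeffX eqxx mulr1.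
  rewrite big1 ?addr0 // => j jm; case: ifP => // _.
  by rewrite mcoeffZ mcoeffX (negPf jm) mulr0.
rewrite big1 // => j jd; rewrite mcoeffZ mcoeffX; case: eqP => [jm|_]; last by rewrite mulr0.
by rewrite -jm jd in md.
Qed.

Lemma mcoeff0_meval (p : A) : p@_(@mnm0 n) = meval (fun=> 0) p.
Proof.
elim/mpoly_ring_ind: p => [c|i|p q Pp Pq|p q Pp Pq].
- by rewrite mcoeffC eqxx mulr1 mevalC.
- by rewrite mcoeffX mnm1_eq0 mevalXU.
- by rewrite mcoeffD mevalD Pp Pq.
- by rewrite mevalM -Pp -Pq; apply: (rmorphM (mcoeff (@mnm0 n))).

Qed.

Lemma along_coef0 gam (p : A) : (along gam p)`_0 = meval (fun i => (gam i)`_0) p.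
Proof.
by rewrite -horner_coef0 horner_along; apply: meval_eq => i; rewrite horner_coef0.
Qed.

(** Induction on k. Suppose h = r modulo I with r of order at least k. Composing r with a projection
    onto the tangent space changes it by an element of I plus terms of order k + 1. The leading form
    of r vanishes at every tangent vector v: on an arc with velocity v both h and h - r vanish,
    hence r does, and its coefficient of t^k is that form at v. So the composed polynomial has order
    at least k + 1. *)
Lemma ord_all I h : is_ideal I ->
  (forall v, tangent I v -> exists gam : 'I_n -> {poly F},
     [/\ forall i, (gam i)`_0 = 0 /\ (gam i)`_1 = v i, along gam h = 0 &
         forall g, I g -> along gam g = 0]) ->
  forall k, exists2 r, ord_ge k r & I (h - r).
Proof.
move=> idI arcs; have [I0 ID IM] := idI.
have tan0 : tangent I (fun=> 0).
  by move=> g Ig; rewrite big1 // => i _; rewrite mul0r.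
have I00 g : I g \/ g = h -> g@_(@mnm0 n) = 0.
  have [gam [g0 gh gI]] := arcs _ tan0.
  move=> Ig; have : (along gam g)`_0 = 0 by case: Ig => [/gI ->|->]; rewrite ?gh coef0.
  rewrite along_coef0 mcoeff0_meval => gz; rewrite -[RHS]gz.
  by apply: meval_eq => i; case: (g0 i).
pose D (w : 'rV[F]_n) := exists2 g, I g & forall i, w 0 i = g@_(mnm1 i).
(* The rows of [K] span the linear parts of the elements of [I], that is the conormal space. *)
have [K KD] : exists K : 'M[F]_n, forall w, D w <-> (w <= K)%MS.
  apply: subspace_mx => [|a u w [g Ig gu] [f If fw]].
    by exists 0 => // i; rewrite mxE mcoeff0.
  exists (mpolyC n a * g + f) => [|i]; first by apply: ID => //; apply: IM.
  by rewrite !mxE gu fw mcoeffD mcoeffCM.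
(* [E] is a projector onto the row space of [K]; its rows are linear parts of elements [g i] of [I],
   and [1 - E] maps every vector to a tangent vector. *)
pose E := pinvmx K *m K.
have KE : K *m E = K by rewrite mulmxA mulmxKpV.
have /choice[g gE] i : exists g, I g /\ forall j, g@_(mnm1 j) = E i j.
  have /KD[g Ig gE] : (row i E <= K)%MS.
    by apply: (submx_trans (row_sub i E)); apply: submxMl.
  by exists g; split=> // j; rewrite -gE mxE.
pose P := 1%:M - E.
have tanP (v : 'I_n -> F) : tangent I (fun i => \sum_j P i j * v j).
  move=> f If; pose d : 'rV[F]_n := \row_i f@_(mnm1 i).
  have /submxP[w dw] : (d <= K)%MS by apply/KD; exists f => // i; rewrite mxE.
  have : d *m P *m (\col_i v i) = 0.
    by rewrite dw /P mulmxBr mulmx1 -mulmxA KE subrr mul0mx.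
  move/(congr1 (fun M : 'M_1 => M 0 0)); rewrite -mulmxA mxE [RHS]mxE => dP; rewrite -[RHS]dP.
  apply: eq_bigr => i _; rewrite !mxE mulrC; congr (_ * _).
  by apply: eq_bigr => j _; rewrite !mxE.
pose lq := [tuple \sum_j P i j *: ('X_j : A) | i < n].
have lqE i : tnth lq i = \sum_j P i j *: 'X_j by rewrite tnth_mktuple.
have lqI i : ord_ge 2 ('X_i - tnth lq i - g i).
  have [Ig gEi] := gE i; move=> m; rewrite ltnS leq_eqVlt ltnS leqn0 mdeg_eq0.
  case/orP=> [/mdeg1P[j /eqP ->]|/eqP ->]; rewrite !mcoeffB lqE raddf_sum /=.
    rewrite gEi (bigD1 j) //= mcoeffZ !mcoeffX eqxx mulr1 big1 => [|l lj].
      rewrite !mxE !eq_mnm1 addr0; ring.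
    by rewrite mcoeffZ mcoeffX eq_mnm1 (negPf lj) mulr0.
  rewrite mcoeffX mnm1_eq0 I00; last by left.
  by rewrite big1 ?subr0 // => j _; rewrite mcoeffZ mcoeffX mnm1_eq0 mulr0.
have lq1 i : ord_ge 1 (tnth lq i).
  rewrite lqE; apply: ord_ge_sum => j _; apply: ord_geZ.
  by rewrite -(mdeg1 j); apply: ord_geX.
elim=> [|[_|k [r rk Ir]]].
- by exists h; [exact: ord_ge0|rewrite subrr].
- exists h; last by rewrite subrr.
  by move=> m; rewrite ltnS leqn0 mdeg_eq0 => /eqP ->; apply: I00; right.
have [s sk sE] := sub_comp_mpoly lq1 rk.
(* By [sub_comp_mpoly], r minus its composition is a combination of the X_i - lq_i, and X_i - lq_i
   agrees with [g i] in [I] up to order 2. *)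
exists (comp_mpoly lq r + \sum_i ('X_i - tnth lq i - g i) * s i); last first.
  have -> : h - (comp_mpoly lq r + \sum_i ('X_i - tnth lq i - g i) * s i) =
      (h - r) + \sum_i s i * g i.
    have -> : \sum_i ('X_i - tnth lq i - g i) * s i =
        (r - comp_mpoly lq r) - \sum_i s i * g i.
      by rewrite sE -sumrB; apply: eq_bigr => i _; ring.
    by ring.
  apply: ID => //; apply: ideal_sum => // i _.
  by apply: IM; case: (gE i).
apply: ord_geD; last first.
  by apply: ord_ge_sum => i _; rewrite -(add2n k); apply: ord_geM.
(* The leading form of r is zero on the image of the projection, which consists of tangent
   vectors. *)
have rh (v : 'I_n -> F) : meval v (comp_mpoly lq (pihomog mdeg k.+1 r)) = 0.
  have [gam [gv gh gI]] := arcs _ (tanP v).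
  rewrite comp_mpoly_meval; transitivity ((along gam r)`_k.+1).
    rewrite (coef_along rk gv); apply: meval_eq => i; rewrite lqE raddf_sum /=.
    by apply: eq_bigr => j _; rewrite mevalZ mevalXU.
  by rewrite -[r](subKr h) alongB gh gI // subrr coef0.
rewrite -[r](subrK (pihomog mdeg k.+1 r)) comp_mpolyD (meval_eq0 rh) addr0.
apply: ord_ge_comp => // m; rewrite ltnS leq_eqVlt mcoeffB mcoeff_pihomog.
by case: eqP => [_ _|_ /=]; rewrite ?subrr // subr0 => /rk.
Qed.

Lemma mderiv_translate i (c : 'I_n -> F) (p : A) :
  mderiv i (comp_mpoly [tuple 'X_j + mpolyC n (c j) | j < n] p) =
  comp_mpoly [tuple 'X_j + mpolyC n (c j) | j < n] (mderiv i p).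
Proof.
elim/mpoly_ring_ind: p => [d|j|p q Pp Pq|p q Pp Pq].
- by rewrite comp_mpolyC !mderivC comp_mpoly0.
- rewrite comp_mpolyXU -tnth_nth tnth_mktuple mderivD mderivC addr0 mderivX.
  rewrite comp_mpolyZ mnm1E; case: eqP => [<-|_]; last by rewrite !scale0r.
  have -> : mnm_sub (mnm1 j) (mnm1 j) = @mnm0 n.
    by apply/mnmP => k; rewrite mnmBE subnn mnm0E.
  by rewrite !mpolyX0 comp_mpoly1.
- by rewrite !(comp_mpolyD, mderivD) Pp Pq.
- by rewrite !(rmorphM, mderivM, comp_mpolyD) /= Pp Pq.
Qed.

Lemma mcoeff1_meval (p : A) i : p@_(mnm1 i) = meval (fun=> 0) (mderiv i p).
Proof.
by rewrite -mcoeff0_meval mcoeff_mderiv add0m mnm0E.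
Qed.

(** Translating [a] to the origin reduces this to [ord_all] followed by [krull_intersection]. *)
Theorem rigid_at I h (a : 'I_n -> F) : is_ideal I ->
  (forall v, (forall g, I g -> \sum_i v i * meval a (mderiv i g) = 0) ->
    exists gam : 'I_n -> {poly F},
     [/\ forall i, (gam i)`_0 = a i /\ (gam i)`_1 = v i, along gam h = 0 &
         forall g, I g -> along gam g = 0]) ->
  exists2 u, meval a u != 0 & I (u * h).
Proof.
move=> idI arcs.
pose tr (c : 'I_n -> F) := [tuple 'X_j + mpolyC n (c j) | j < n].
have tr_ev c x p : meval x (comp_mpoly (tr c) p) = meval (fun i => x i + c i) p.
  rewrite comp_mpoly_meval; apply: meval_eq => i.
  by rewrite tnth_mktuple mevalD mevalXU mevalC.
have trK p : comp_mpoly (tr (fun i => - a i)) (comp_mpoly (tr a) p) = p.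
  by apply: meval_inj => x; rewrite !tr_ev; apply: meval_eq => i; rewrite subrK.
have trK' p : comp_mpoly (tr a) (comp_mpoly (tr (fun i => - a i)) p) = p.
  by apply: meval_inj => x; rewrite !tr_ev; apply: meval_eq => i; rewrite addrK.
pose I' g := I (comp_mpoly (tr (fun i => - a i)) g).
have idI' : is_ideal I'.
  have [I0 ID IM] := idI; rewrite /I'; split=> [|x y|c x].
  - by rewrite comp_mpoly0.
  - by rewrite comp_mpolyD; apply: ID.
  - by rewrite rmorphM; apply: IM.
have along_tr gam p : along gam (comp_mpoly (tr a) p) = along (fun i => gam i + (a i)%:P) p.
  apply/subr0_eq/poly_eq0_horner => t; rewrite hornerD hornerN !horner_along tr_ev.
  by apply/eqP; rewrite subr_eq0; apply/eqP; apply: meval_eq => i; rewrite hornerD hornerC.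
have [|u u1 Iu] := @krull_intersection n F I' (comp_mpoly (tr a) h) idI'.
  apply: ord_all => // v tv; have [g Ig|gam [ga gh gI]] := arcs v.
    have := tv (comp_mpoly (tr a) g); rewrite /I' trK => /(_ Ig) tg; rewrite -[RHS]tg.
    apply: eq_bigr => i _; rewrite mcoeff1_meval mderiv_translate tr_ev.
    by congr (_ * _); apply: meval_eq => j; rewrite add0r.
  exists (fun i => gam i - (a i)%:P); split.
  - by move=> i; have [<- <-] := ga i; rewrite !coefB !coefC subrr subr0.
  - by rewrite along_tr -gh; congr along; apply/funext => i; rewrite subrK.
  - move=> g /gI; rewrite -{2}[g]trK' along_tr => <-.
    by congr along; apply/funext => i; rewrite subrK.
exists (comp_mpoly (tr (fun i => - a i)) u); last first.
  by move: Iu; rewrite /I' rmorphM /= trK.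
suff -> : meval a (comp_mpoly (tr (fun i => - a i)) u) = 1 by exact: oner_neq0.
rewrite tr_ev -u1 mcoeff0_meval.
by apply: meval_eq => i; rewrite subrr.
Qed.

End Rigid.

(** * Two-forms as skew-symmetric arrays *)

Section Entries.
Variables (n : nat) (A : comNzRingType).
Implicit Types (al be : form n A) (i j k l : 'I_n) (I J K : {set 'I_n}).

(** The value on a pair of basis vectors, skew in [i] and [j]; a form itself is indexed by sets and
    stores the increasing pairs only. *)
Definition ent al i j : A :=
  if (i < j)%N then al [set i; j] else if (j < i)%N then - al [set i; j] else 0.

Lemma ent_lt al i j : (i < j)%N -> ent al i j = al [set i; j].
Proof. by rewrite /ent => ->. Qed.

Lemma entN al i j : ent al j i = - ent al i j.
Proof.
by rewrite /ent; case: ltngtP => _; rewrite ?oppr0 ?opprK // setUC.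
Qed.

Lemma entii al i : ent al i i = 0.
Proof. by rewrite /ent ltnn. Qed.

Lemma inversions_sum I J :
  inversions I J = (\sum_(i in I) \sum_(j in J) (j < i)%N)%N.
Proof.
rewrite /inversions cardsE -sum1_card.
rewrite (eq_bigr (fun i => \sum_(j | (j \in J) && (j < i)%N) 1)%N); last first.
  by move=> i _; rewrite [RHS]big_mkcondr; apply: eq_bigr => j _; case: ltnP.
rewrite pair_big_dep /=; apply: eq_bigl => u /=.
by rewrite unfold_in /= andbA.
Qed.

Lemma inversions0s J : inversions set0 J = 0%N.
Proof. by rewrite inversions_sum big_set0. Qed.

Lemma inversions_U1l i I J : i \notin I ->
  inversions (i |: I) J = (\sum_(j in J) (j < i)%N + inversions I J)%N.
Proof. by move=> iI; rewrite !inversions_sum big_setU1. Qed.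

Lemma inversions_U1r i I J : i \notin J ->
  inversions I (i |: J) = (\sum_(j in I) (i < j)%N + inversions I J)%N.
Proof.
move=> iJ; rewrite !inversions_sum -big_split; apply: eq_bigr => j _.
by rewrite big_setU1.
Qed.

Definition below i K := [forall k, (k \in K) ==> (i < k)%N].

Lemma belowP i K : reflect (forall k, k \in K -> (i < k)%N) (below i K).
Proof. exact: 'forall_implyP. Qed.

Lemma below_notin i K : below i K -> i \notin K.
Proof. by move/belowP=> iK; apply: contraTN isT => /iK; rewrite ltnn. Qed.

Lemma below_U1l i I J : below i I -> below i J ->
  inversions (i |: I) J = inversions I J.
Proof.
move=> iI /belowP iJ; rewrite inversions_U1l ?below_notin // big1 // => j /iJ.
by case: ltngtP.
Qed.

Lemma below_U1r i I J : below i I -> below i J ->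
  inversions I (i |: J) = (#|I| + inversions I J)%N.
Proof.
move=> /belowP iI iJ; rewrite inversions_U1r ?below_notin // -sum1_card.
by congr (_ + _)%N; apply: eq_bigr => j /iI ->.
Qed.

Lemma big_subset_setU1 i K (f : {set 'I_n} -> A) : i \notin K ->
  \sum_(I : {set 'I_n} | I \subset i |: K) f I =
  \sum_(I : {set 'I_n} | I \subset K) f I +
  \sum_(I : {set 'I_n} | I \subset K) f (i |: I).
Proof.
move=> iK; rewrite (bigID (fun I : {set 'I_n} => i \in I)) /= addrC; congr (_ + _).
  apply: eq_bigl => I; apply/andP/idP => [[/subsetP IK iI]|/subsetP IK].
    apply/subsetP => x xI; have := IK _ xI; rewrite !inE => /predU1P[xi|//].
    by rewrite -xi xI in iI.
  split; last by apply: contra iK; apply: IK.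
  by apply/subsetP => x /IK; rewrite inE orbC => ->.
rewrite (reindex_onto (fun I => i |: I) (fun I => I :\ i)) /=; last first.
  by move=> I /andP[_ iI]; rewrite setD1K.
apply: eq_bigl => I; rewrite !inE eqxx andbT.
apply/andP/idP => [[/subsetP IK /eqP <-]|/subsetP IK].
  apply/subsetP => x; rewrite !inE => /andP[xi]; rewrite (negPf xi) /= => xI.
  have := IK x; rewrite !inE (negPf xi) xI; exact.
have iI : i \notin I by apply: contra iK; apply: IK.
rewrite setU1K // eqxx; split=> //; apply/subsetP => x; rewrite !inE.
by case: eqP => //= _; apply: IK.
Qed.

(* Expansion of [dx_i /\ K] when [i] precedes all of [K]: the factor [dx_i]
   comes either from [al] or from [be]. *)
Definition slot i al : form n A := [ffun I => al (i |: I)].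
Definition twist al : form n A := [ffun I : {set 'I_n} => (-1) ^+ #|I| * al I].

Lemma wedge_setU1 al be i K : below i K ->
  wedge al be (i |: K) = wedge (slot i al) be K + wedge (twist al) (slot i be) K.
Proof.
move=> iK; rewrite !ffunE big_subset_setU1 ?below_notin // addrC; congr (_ + _).
  apply: eq_bigr => I IK; rewrite !ffunE.
  have iI : below i I by apply/belowP => k kI; apply: (belowP _ _ iK); apply: (subsetP IK).
  have iKI : below i (K :\: I).
    by apply/belowP => k; rewrite inE => /andP[_]; apply: (belowP _ _ iK).
  have -> : (i |: K) :\: (i |: I) = K :\: I.
    apply/finset.setP => x; rewrite !inE; case: eqP => //= ->.
    by rewrite (negPf (below_notin iK)) andbF.
  by rewrite below_U1l.
apply: eq_bigr => I IK; rewrite !ffunE.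
have iI : below i I by apply/belowP => k kI; apply: (belowP _ _ iK); apply: (subsetP IK).
have iKI : below i (K :\: I).
  by apply/belowP => k; rewrite inE => /andP[_]; apply: (belowP _ _ iK).
have -> : (i |: K) :\: I = i |: (K :\: I).
  apply/finset.setP => x; rewrite !inE; case: eqP => //= ->.
  by rewrite (negPf (below_notin iI)).
by rewrite below_U1r // exprD !mulrA; congr (_ * _ * _); rewrite mulrC.
Qed.

Lemma wedge_set0 al be : wedge al be set0 = al set0 * be set0.
Proof.
rewrite ffunE (big_pred1 set0) => [|I]; last by rewrite subset0.
by rewrite inversions0s expr0 mul1r setD0.
Qed.

Lemma below0 i : below i set0.
Proof. by apply/belowP => k; rewrite inE. Qed.

Lemma below_setU1 i j K : (i < j)%N -> below i K -> below i (j |: K).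
Proof.
move=> ij /belowP iK; apply/belowP => k; rewrite !inE => /predU1P[->|/iK] //.
Qed.

Lemma set2E i j : [set i; j] = i |: (j |: set0).
Proof. by rewrite setU0. Qed.

Lemma wedge11 al be i j : is_kform 1 al -> is_kform 1 be -> (i < j)%N ->
  wedge al be [set i; j] = al [set i] * be [set j] - al [set j] * be [set i].
Proof.
move=> al1 be1 ij; have nij : i != j by rewrite neq_ltn ij.
rewrite set2E wedge_setU1 ?below_setU1 ?below0 // !wedge_setU1 ?below0 // !wedge_set0.
rewrite !ffunE !setU0 cards0 cards1 expr0 expr1 !mul1r.
rewrite [al set0]al1 ?cards0 // [be set0]be1 ?cards0 //.
by rewrite !(mulr0, mul0r, add0r, addr0) mulN1r mulNr.
Qed.

Lemma wedge22 al be i j k l : is_kform 2 al -> is_kform 2 be ->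
  (i < j)%N -> (j < k)%N -> (k < l)%N ->
  wedge al be (i |: (j |: [set k; l])) =
    ent al i j * ent be k l - ent al i k * ent be j l + ent al i l * ent be j k
    + ent al j k * ent be i l - ent al j l * ent be i k + ent al k l * ent be i j.
Proof.
move=> al2 be2 ij jk kl.
have ik := ltn_trans ij jk; have jl := ltn_trans jk kl; have il := ltn_trans ik kl.
have bl := below0 l; have bk := below_setU1 kl (below0 k).
have bj := below_setU1 jk (below_setU1 jl (below0 j)).
have bi := below_setU1 ij (below_setU1 ik (below_setU1 il (below0 i))).
rewrite set2E wedge_setU1 // !wedge_setU1 // !wedge_set0 !ffunE !setU0.
have a0 : al set0 = 0 by rewrite al2 ?cards0.
have a1 x : al [set x] = 0 by rewrite al2 ?cards1.
have b0 : be set0 = 0 by rewrite be2 ?cards0.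
have b1 x : be [set x] = 0 by rewrite be2 ?cards1.
rewrite !cards0 !cards1 !expr0 !expr1 !mul1r.
rewrite !(a0, a1, b0, b1) !(mulr0, mul0r, addr0, add0r, oppr0).
have c2 (x y : 'I_n) : (x < y)%N -> #|[set x; y]| = 2%N.
  by move=> xy; rewrite cards2 neq_ltn xy.
rewrite !ent_lt // !c2 //; ring.
Qed.

Lemma card2P (I : {set 'I_n}) : #|I| = 2%N ->
  exists i j, (i < j)%N /\ I = [set i; j].
Proof.
move=> /eqP/cards2P[i [j [ij ->]]]; case: (ltngtP i j) => [lt|gt|/val_inj eq].
- by exists i, j.
- by exists j, i; rewrite setUC.
- by rewrite eq eqxx in ij.
Qed.

Lemma card4P (I : {set 'I_n}) : #|I| = 4%N -> exists i j k l,
  [/\ (i < j)%N, (j < k)%N, (k < l)%N & I = i |: (j |: [set k; l])].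
Proof.
have ex (J : {set 'I_n}) c : #|J| = c.+1 -> exists2 i, below i (J :\ i) &
    J = i |: (J :\ i) /\ #|J :\ i| = c.
  move=> Jc; have /card_gt0P[i0 i0J] : (0 < #|J|)%N by rewrite Jc.
  case: (arg_minnP (fun i : 'I_n => val i) i0J) => i iJ' imin.
  have iJ : i \in J by [].
  exists i.
    apply/belowP => k; rewrite !inE => /andP[ki kJ].
    by rewrite ltn_neqAle eq_sym imin // andbT; apply: contra ki.
  rewrite setD1K //; split=> //; apply/eqP.
  by move: Jc; rewrite (cardsD1 i) iJ add1n => -[->].
move=> /ex[i bi [EI /ex[j bj [Ej]]]] /card2P[k [l [kl El]]].
exists i, j, k, l; split=> //.
- by apply: (belowP _ _ bi); rewrite Ej !inE eqxx.
- by apply: (belowP _ _ bj); rewrite El !inE eqxx.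
- by rewrite -El -Ej -EI.
Qed.

Lemma eq_kform2 al be : is_kform 2 al -> is_kform 2 be ->
  (forall i j : 'I_n, (i < j)%N -> ent al i j = ent be i j) -> al = be.
Proof.
move=> al2 be2 E; apply/ffunP => I; have [/card2P[i [j [ij ->]]]|I2] := eqVneq #|I| 2%N.
  by rewrite -!ent_lt // E.
by rewrite al2 // be2.
Qed.

Definition of_ent (M : 'I_n -> 'I_n -> A) : form n A :=
  [ffun I : {set 'I_n} => (if enum I is [:: i; j] then M i j else 0) : A].

Lemma of_ent_kform M : is_kform 2 (of_ent M).
Proof.
by move=> I; rewrite ffunE cardE; case: (enum I) => [|i [|j []]].
Qed.

Lemma enum_set2 i j : (i < j)%N -> enum [set i; j] = [:: i; j].
Proof.
move=> ij; apply: (irr_sorted_eq (leT := fun i j : 'I_n => (i < j)%N)).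
- by move=> x y z; apply: ltn_trans.
- by move=> x; apply: ltnn.
- rewrite /enum_mem -enumT; apply: sorted_filter; first by move=> x y z; apply: ltn_trans.
  by have := iota_ltn_sorted 0 n; rewrite -val_enum_ord sorted_map.
- by rewrite /= ij.
- by move=> x; rewrite mem_enum !inE.
Qed.

Lemma ent_of_ent M : (forall i j, M j i = - M i j) -> (forall i, M i i = 0) ->
  forall i j, ent (of_ent M) i j = M i j.
Proof.
move=> MN M0 i j; rewrite /ent !ffunE.
have [ij|ji|/val_inj ->] := ltngtP i j; first by rewrite enum_set2.
  by rewrite setUC enum_set2 // MN opprK.
by rewrite M0.
Qed.

Lemma contraction_set1 Z al j : is_kform 2 al ->
  contraction Z al [set j] = \sum_i Z i * ent al i j.
Proof.
move=> al2; rewrite ffunE [RHS](bigD1 j) //= entii mulr0 add0r.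
apply: eq_big => [i|i]; first by rewrite inE.
rewrite inE inversions_sum big_set1 big_set1 => ij.
rewrite /ent; case: (ltngtP i j) => [lt|gt|/val_inj eq]; last by rewrite eq eqxx in ij.
  by rewrite /= expr0 mul1r.
by rewrite /= expr1 mulN1r mulrN.
Qed.

Lemma contraction_kform Z al (k : nat) : is_kform k.+1 al -> is_kform k (contraction Z al).
Proof.
move=> alk I Ik; rewrite ffunE big1 // => i iI.
by rewrite alk ?mulr0 // cardsU1 iI add1n eqSS.
Qed.

Lemma contraction_eq0 Z al : is_kform 2 al ->
  contraction Z al = 0 <-> forall j, \sum_i Z i * ent al i j = 0.
Proof.
move=> al2; split=> [Z0 j|Z0]; first by rewrite -contraction_set1 // Z0 ffunE.
apply/ffunP => I; rewrite [RHS]ffunE.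
have [/eqP/cards1P[j ->]|I1] := eqVneq #|I| 1%N; first by rewrite contraction_set1.
exact: (contraction_kform Z al2).
Qed.

Lemma wedge_kform (k l : nat) al be : is_kform k al -> is_kform l be ->
  is_kform (k + l) (wedge al be).
Proof.
move=> alk bel K Kkl; rewrite ffunE big1 // => I IK.
have [Ik|Ik] := eqVneq #|I| k; last by rewrite alk // mul0r mulr0.
rewrite bel ?mulr0 //; apply: contra Kkl => /eqP Jl.
by rewrite -(cardsID I K) (setIidPr IK) Ik Jl.
Qed.

End Entries.

Section Exterior.
Variables (n : nat) (A : Type) (B : comNzRingType) (d : 'I_n -> A -> B).

Lemma ext_deriv_set2 (al : form n A) (i j : 'I_n) : (i < j)%N ->
  ext_deriv d al [set i; j] = d i (al [set j]) - d j (al [set i]).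
Proof.
move=> ij; have nij : i != j by rewrite neq_ltn ij.
rewrite ffunE big_setU1 ?inE // big_set1.
have -> : [set i; j] :\ i = [set j] by rewrite setU1K // inE.
have -> : [set i; j] :\ j = [set i] by rewrite setUC setU1K // inE eq_sym.
rewrite !inversions_sum !big_set1 ij ltnNge (ltnW ij) /=.
by rewrite expr0 mul1r expr1 mulN1r.
Qed.

End Exterior.

Lemma ext_deriv_kform n (A : zmodType) (B : comNzRingType) (d : 'I_n -> A -> B)
    (al : form n A) k : (forall i, d i 0 = 0) ->
  (forall I : {set 'I_n}, #|I| != k -> al I = 0) -> is_kform k.+1 (ext_deriv d al).
Proof.
move=> d0 alk K Kk; rewrite ffunE big1 // => i iK; rewrite alk ?d0 ?mulr0 //.
by apply: contra Kk => /eqP <-; rewrite (cardsD1 i) iK.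
Qed.

Section Space4.
Variable A : comNzRingType.
Implicit Types (S X : 'I_4 -> A).

Definition o4 (i : nat) : 'I_4 := inord i.

Lemma ord4P (P : 'I_4 -> Prop) : P (o4 0) -> P (o4 1) -> P (o4 2) -> P (o4 3) ->
  forall i, P i.
Proof.
move=> P0 P1 P2 P3 [i i4]; have -> : Ordinal i4 = o4 i by apply/val_inj; rewrite /= inordK.
by move: i i4 => [|[|[|[|i]]]].
Qed.

Lemma sum4 (F : 'I_4 -> A) :
  \sum_i F i = F (o4 0) + F (o4 1) + F (o4 2) + F (o4 3).
Proof.
rewrite !big_ord_recl big_ord0 addr0 !addrA.
by congr (F _ + F _ + F _ + F _); apply/val_inj; rewrite /= inordK.
Qed.

Lemma val_o4 i : (i < 4)%N -> val (o4 i) = i.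
Proof. by move=> i4; rewrite /= inordK. Qed.

(* The entries of [i_S i_X nu_4]. *)
Definition entSX S X (i j : 'I_4) : A :=
  let f a b := S (o4 a) * X (o4 b) - S (o4 b) * X (o4 a) in
  match val i, val j with
  | 0, 1 => - f 2 3 | 0, 2 => f 1 3 | 0, 3 => - f 1 2
  | 1, 2 => - f 0 3 | 1, 3 => f 0 2 | 2, 3 => - f 0 1
  | _, _ => 0%R
  end%N.

Lemma volume_kform n : is_kform n (volume n A).
Proof.
move=> I; rewrite ffunE; case: (I =P [set: 'I_n]) => [->|//].
by rewrite cardsT card_ord eqxx.
Qed.

Lemma contraction_volume X (K : {set 'I_4}) : #|K| = 3%N ->
  contraction X (volume 4 A) K =
  \sum_l if l \in K then 0 else (-1) ^+ (\sum_(k in K) (k < l)%N)%N * X l.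
Proof.
move=> K3; rewrite ffunE big_mkcond; apply: eq_bigr => l _.
case: (boolP (l \in K)) => lK //=; rewrite inversions_sum big_set1 ffunE.
have -> : l |: K = [set: 'I_4].
  by apply/eqP; rewrite eqEcard subsetT cardsT card_ord cardsU1 lK K3.
by rewrite eqxx mulr1.
Qed.

Lemma contraction2_volume S X (i j : 'I_4) : (i < j)%N ->
  contraction S (contraction X (volume 4 A)) [set i; j] = entSX S X i j.
Proof.
move=> ij; have nij : i != j by rewrite neq_ltn ij.
transitivity (\sum_k if (k == i) || (k == j) then 0 else
  (-1) ^+ ((i < k) + (j < k))%N * (S k *
  \sum_l if [|| l == k, l == i | l == j] then 0 else
     (-1) ^+ ((k < l) + ((i < l) + (j < l)))%N * X l)).
  rewrite ffunE big_mkcond; apply: eq_bigr => k _; rewrite !inE.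
  case: (boolP ((k == i) || (k == j))) => kij //=; have /norP[ki kj] := kij.
  have kI : k \notin [set i; j] by rewrite !inE.
  have iJ : i \notin [set j] by rewrite inE.
  rewrite inversions_sum big_set1 big_setU1 // big_set1.
  congr (_ * (_ * _)); rewrite contraction_volume; last by rewrite cardsU1 kI cards2 nij.
  by apply: eq_bigr => l _; rewrite !inE !big_setU1 //= big_set1.
move: ij {nij}; elim/ord4P: i; elim/ord4P: j; rewrite !val_o4 // => _.
all: by rewrite !sum4 -!val_eqE !val_o4 //= /entSX !val_o4 //=; ring.
Qed.
End Space4.

Lemma wedge_form0r n (A : comNzRingType) (al : form n A) c K :
  wedge al (form0 n c) K = al K * c.
Proof.
rewrite ffunE (bigD1 K) //= big1 => [|I /andP[IK nIK]].
  rewrite setDv ffunE eqxx inversions_sum big1 ?expr0 ?mul1r ?addr0 // => i _.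
  by rewrite big_set0.
rewrite ffunE; case: eqP => [/eqP|]; rewrite ?mulr0 //.
rewrite setD_eq0 => KI; case/eqP: nIK; apply/eqP; rewrite eqEsubset IK; exact: KI.
Qed.

Lemma wedge_form0l n (A : comNzRingType) (al : form n A) c K :
  wedge (form0 n c) al K = c * al K.
Proof.
rewrite ffunE (bigD1 finset.set0) ?sub0set //= big1 => [|I /andP[IK nI]].
  by rewrite setD0 ffunE eqxx inversions0s expr0 mul1r addr0.
by rewrite ffunE (negPf nI) mul0r mulr0.
Qed.

Section Pullback.
Variables (C : numClosedFieldType) (m n : nat).
Variable phi : n.-tuple {mpoly C[m]}.
Implicit Type Om : form n {mpoly C[n]}.

Lemma sum_card2 (V : nmodType) (G : {set 'I_n} -> V) :
  (forall I : {set 'I_n}, #|I| != 2%N -> G I = 0) ->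
  \sum_I G I = \sum_(p : 'I_n * 'I_n | (p.1 < p.2)%N) G [set p.1; p.2].
Proof.
move=> G0; transitivity (\sum_(p : 'I_n * 'I_n | (p.1 < p.2)%N)
    \sum_(I : {set 'I_n} | I == [set p.1; p.2]) G I); last first.
  by apply: eq_bigr => p _; rewrite big_pred1_eq.
rewrite (exchange_big_dep xpredT) //=; apply: eq_bigr => I _.
have [/card2P[i [j [ij IE]]]|I2] := eqVneq #|I| 2%N; last first.
  by rewrite G0 // big1.
rewrite (big_pred1 (i, j)) // => -[i' j'] /=; apply/andP/eqP => [[ij' /eqP]|[-> ->]].
  rewrite IE => /(congr1 (fun I : {set 'I_n} => enum I)).
  by rewrite !enum_set2 // => -[-> ->].
by rewrite ij IE.
Qed.

Lemma dform0 (g : {mpoly C[m]}) k :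
  poly_ext_deriv (form0 m g) [set k] = mderiv k g.
Proof.
rewrite ffunE big_set1 setDv ffunE eqxx inversions_sum big_set1 big_set0.
by rewrite expr0 mul1r.
Qed.

Lemma dform0_kform (g : {mpoly C[m]}) : is_kform 1 (poly_ext_deriv (form0 m g)).
Proof.
apply: ext_deriv_kform => [i|I I0]; first exact: mderiv0.
by rewrite ffunE -cards_eq0 (negPf I0).
Qed.

Lemma pullbackE Om K : is_kform 2 Om -> pullback phi Om K =
  \sum_(p : 'I_n * 'I_n | (p.1 < p.2)%N) comp_mpoly phi (Om [set p.1; p.2]) *
    wedge (poly_ext_deriv (form0 m (tnth phi p.1)))
      (poly_ext_deriv (form0 m (tnth phi p.2))) K.
Proof.
move=> Om2; rewrite /pullback sum_ffunE sum_card2 => [|I I2]; last first.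
  by rewrite Om2 // comp_mpoly0 wedge_form0l mul0r.
apply: eq_bigr => -[i j] /= ij; rewrite wedge_form0l enum_set2 //.
have w1 (al : form m {mpoly C[m]}) : wedge al (form0 m 1) = al.
  by apply/ffunP => I; rewrite wedge_form0r mulr1.
by rewrite !big_cons big_nil w1.
Qed.

Lemma pullback_kform Om : is_kform 2 Om -> is_kform 2 (pullback phi Om).
Proof.
move=> Om2 K K2; rewrite pullbackE // big1 // => p _.
by rewrite (wedge_kform (k := 1) (l := 1)) ?mulr0 //; apply: dform0_kform.
Qed.

Lemma ent_pullback Om (k l : 'I_m) : is_kform 2 Om -> (k < l)%N ->
  ent (pullback phi Om) k l =
  \sum_i \sum_j comp_mpoly phi (ent Om i j) *
     (mderiv k (tnth phi i) * mderiv l (tnth phi j)).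
Proof.
move=> Om2 kl; rewrite ent_lt // pullbackE //.
rewrite pair_big /=.
rewrite [RHS](bigID (fun p : 'I_n * 'I_n => (p.1 < p.2)%N)) /=.
rewrite [X in _ = _ + X](bigID (fun p : 'I_n * 'I_n => (p.2 < p.1)%N)) /=.
rewrite [X in _ + (_ + X)]big1 ?addr0 => [|[i j] /= /andP[]]; last first.
  rewrite -!leqNgt => ji ij; have -> : i = j by apply/val_inj/eqP; rewrite eqn_leq ij ji.
  by rewrite entii comp_mpoly0 mul0r.
rewrite [X in _ = _ + X](reindex_inj (h := fun p => (p.2, p.1))) /=; last first.
  by move=> [a b] [c d] [-> ->].
rewrite [X in _ = _ + X](eq_bigl (fun p : 'I_n * 'I_n => (p.1 < p.2)%N)); last first.
  by move=> [i j] /=; case: ltngtP.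
rewrite -big_split; apply: eq_bigr => -[i j] /= ij.
rewrite wedge11 ?dform0 //; try exact: dform0_kform.
rewrite (entN Om i j) (ent_lt Om ij) rmorphN /=; ring.
Qed.

End Pullback.

(** * Integrability as a polynomial condition *)

Section Identities.
Variables (A : comPzRingType) (n : nat).
Implicit Types (a b : 'I_n -> A) (da db : 'I_n -> 'I_n -> A).

(** The coefficients of the wedge product of the 2-forms with entries [d] and [M]. *)
Definition wedge2 (d M : 'I_n -> 'I_n -> A) i j k l :=
  d i j * M k l - d i k * M j l + d i l * M j k
  + d j k * M i l - d j l * M i k + d k l * M i j.

(* [i_v (a /\ b) /\ d (a /\ b)] is a combination of [da /\ a /\ b] and
   [db /\ a /\ b]. *)
Lemma frob_decomposable a b da db v i j k l :
  let M i j := a i * b j - a j * b i in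
  let dM k i j := (da k i * b j + a i * db k j) - (da k j * b i + a j * db k i) in
  let D j k l := dM j k l - dM k j l + dM l j k in
  wedge2 (fun i j => da i j - da j i) M i j k l = 0 ->
  wedge2 (fun i j => db i j - db j i) M i j k l = 0 ->
  M v i * D j k l - M v j * D i k l + M v k * D i j l - M v l * D i j k = 0.
Proof.
move=> M dM D Ea Eb.
transitivity (a v * wedge2 (fun i j => db i j - db j i) M i j k l -
   b v * wedge2 (fun i j => da i j - da j i) M i j k l).
  by rewrite /wedge2 /M /D /dM; ring.
by rewrite Ea Eb !mulr0 subrr.
Qed.

(** The two 4-forms d(i_v M) /\ M and i_v M /\ dM differ by derivatives of the Plücker relation,
    which are the [dpl]. *)
Lemma wedge2_deriv (M : 'I_n -> 'I_n -> A) (dM : 'I_n -> 'I_n -> 'I_n -> A) v i j k l :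
  let D j k l := dM j k l - dM k j l + dM l j k in
  let dpl i j k l := dM i v j * M k l + M v j * dM i k l
    - (dM i v k * M j l + M v k * dM i j l) + (dM i v l * M j k + M v l * dM i j k) in
  wedge2 (fun i j => dM i v j - dM j v i) M i j k l =
  dpl i j k l - dpl j i k l + dpl k i j l - dpl l i j k
  + (M v i * D j k l - M v j * D i k l + M v k * D i j l - M v l * D i j k).
Proof. by rewrite /wedge2; ring. Qed.

(** For theta = m / Q one has d theta = dm / Q - dQ /\ m / Q^2. The second term dies against [M]
    because m /\ M = 0. *)
Lemma wedge2_quotient (M : 'I_n -> 'I_n -> A) (c e : A) (w dm : 'I_n -> 'I_n -> A)
    (q m : 'I_n -> A) i j k l :
  (forall i j, w i j = c * dm i j - e * (q i * m j)) ->
  wedge2 (fun i j => dm i j - dm j i) M i j k l = 0 ->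
  (forall j k l, m j * M k l - m k * M j l + m l * M j k = 0) ->
  wedge2 (fun i j => w i j - w j i) M i j k l = 0.
Proof.
move=> wE dm0 mM; pose pl j k l := m j * M k l - m k * M j l + m l * M j k.
transitivity (c * wedge2 (fun i j => dm i j - dm j i) M i j k l
  - e * (q i * pl j k l - q j * pl i k l + q k * pl i j l - q l * pl i j k)).
  by rewrite /wedge2 !wE /pl; ring.
by rewrite dm0 /pl !mM; ring.
Qed.

End Identities.

Lemma alternating4_eq0 n (V : zmodType) (F : 'I_n -> 'I_n -> 'I_n -> 'I_n -> V) :
  (forall i j k l, F j i k l = - F i j k l) -> (forall i k l, F i i k l = 0) ->
  (forall i j k l, F i k j l = - F i j k l) -> (forall i j l, F i j j l = 0) ->
  (forall i j k l, F i j l k = - F i j k l) -> (forall i j k, F i j k k = 0) ->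
  (forall i j k l : 'I_n, (i < j)%N -> (j < k)%N -> (k < l)%N -> F i j k l = 0) ->
  forall i j k l, F i j k l = 0.
Proof.
move=> S12 Z12 S23 Z23 S34 Z34 F0.
have F1 i (j k l : 'I_n) : (j < k)%N -> (k < l)%N -> F i j k l = 0.
  move=> jk kl; case: (ltngtP i j) => [ij|ji|/val_inj ->]; [exact: F0| |exact: Z12].
  rewrite -[LHS]opprK -S12.
  case: (ltngtP i k) => [ik|ki|/val_inj ->]; [by rewrite F0 ?oppr0| |by rewrite Z23 oppr0].
  rewrite -[F _ _ _ _]opprK -S23.
  case: (ltngtP i l) => [il|li|/val_inj ->]; [by rewrite F0 ?oppr0| |by rewrite Z34 !oppr0].
  by rewrite -[F _ _ _ _]opprK -S34 F0 ?oppr0.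
have F2 i j (k l : 'I_n) : (k < l)%N -> F i j k l = 0.
  move=> kl; case: (ltngtP j k) => [jk|kj|/val_inj ->]; [exact: F1| |exact: Z23].
  rewrite -[LHS]opprK -S23.
  case: (ltngtP j l) => [jl|lj|/val_inj ->]; [by rewrite F1 ?oppr0| |by rewrite Z34 oppr0].
  by rewrite -[F _ _ _ _]opprK -S34 F1 ?oppr0.
move=> i j k l; case: (ltngtP k l) => [kl|lk|/val_inj ->]; [exact: F2| |exact: Z34].
by rewrite -[LHS]opprK -S34 F2 ?oppr0.
Qed.

Section PolynomialCalculus.
Import numFieldNormedType.Exports.
Variables (C : numClosedFieldType) (n : nat).
Implicit Types (P : {mpoly C[n]}) (x : 'rV[C]_n).

Lemma eval_atM x : {morph eval_at x : p q / p * q}. Proof. exact: mevalM. Qed.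
Lemma eval_atD x : {morph eval_at x : p q / p + q}. Proof. exact: mevalD. Qed.
Lemma eval_atB x : {morph eval_at x : p q / p - q}. Proof. exact: mevalB. Qed.
Lemma eval_atN x : {morph eval_at x : p / - p}. Proof. exact: mevalN. Qed.
Lemma eval_at0 x : eval_at x 0 = 0. Proof. exact: meval0. Qed.
Lemma eval_atXU x i : eval_at x 'X_i = x 0 i. Proof. exact: mevalXU. Qed.
Lemma eval_atC x c : eval_at x (mpolyC n c) = c. Proof. exact: mevalC. Qed.
Lemma eval_atZ x c P : eval_at x (c *: P) = c * eval_at x P. Proof. exact: mevalZ. Qed.
Lemma eval_at_sum x (I : Type) (r : seq I) (Q : pred I) (F : I -> {mpoly C[n]}) :
  eval_at x (\sum_(i <- r | Q i) F i) = \sum_(i <- r | Q i) eval_at x (F i).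
Proof. exact: raddf_sum. Qed.

Lemma eval_at_inj P Q : (forall x, eval_at x P = eval_at x Q) -> P = Q.
Proof.
move=> PQ; apply: meval_inj => v; have := PQ (\row_i v i).
by rewrite /eval_at; congr (_ = _); apply: meval_eq => i; rewrite mxE.
Qed.

Definition coord_fun (j : 'I_n) : 'rV[C]_n -> C := fun y => y 0 j.

Lemma coord_fun_linear j : linear (coord_fun j).
Proof. by move=> a u v; rewrite /coord_fun !mxE. Qed.

HB.instance Definition _ j :=
  GRing.isLinear.Build C 'rV[C]_n C *%R (coord_fun j) (coord_fun_linear j).

Lemma derive_coord_fun x v j : 'D_v (coord_fun j) x = v 0 j.
Proof.
rewrite deriveE; last exact: differentiable_coord.
by rewrite (diff_lin x (f := coord_fun j)) //; apply: coord_continuous.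
Qed.

Lemma derivative_eval P x :
  differentiable ((fun y => eval_at y P) : 'rV[C]_n -> C) x /\
  forall i, 'D_(delta_mx 0 i) ((fun y => eval_at y P) : 'rV[C]_n -> C) x =
     eval_at x (mderiv i P).
Proof.
elim/mpoly_ring_ind: P => [c|j|p q [dp Dp] [dq Dq]|p q [dp Dp] [dq Dq]].
- have -> : (fun y : 'rV[C]_n => eval_at y (mpolyC n c)) = cst c.
    by apply/funext => y; rewrite eval_atC.
  split=> [|i]; first exact: differentiable_cst.
  by rewrite derive_cst mderivC eval_at0.
- have -> : (fun y : 'rV[C]_n => eval_at y 'X_j) = coord_fun j.
    by apply/funext => y; rewrite eval_atXU.
  split=> [|i]; first exact: differentiable_coord.
  rewrite derive_coord_fun mxE eqxx /= mderivX mnm1E eval_atZ.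
  case: (eqVneq i j) => [->|ij].
    rewrite mul1r; have -> : mnm_sub (mnm1 j) (mnm1 j) = @mnm0 n.
      by apply/mnmP => k; rewrite mnmBE subnn mnm0E.
    by rewrite mpolyX0 -(mpolyC1 n C) eval_atC.
  by rewrite mul0r.
- have -> : (fun y : 'rV[C]_n => eval_at y (p + q)) =
      (fun y => eval_at y p) + (fun y => eval_at y q).
    by apply/funext => y; rewrite eval_atD.
  split=> [|i]; first exact: differentiableD.
  rewrite deriveD; [|exact: diff_derivable|exact: diff_derivable].
  by rewrite Dp Dq mderivD eval_atD.
- have -> : (fun y : 'rV[C]_n => eval_at y (p * q)) =
      (fun y => eval_at y p) * (fun y => eval_at y q).
    by apply/funext => y; rewrite eval_atM.
  split=> [|i]; first exact: differentiableM.
  rewrite deriveM; [|exact: diff_derivable|exact: diff_derivable].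
  rewrite Dp Dq mderivM eval_atD !eval_atM /GRing.scale /=; ring.
Qed.

Lemma differentiable_eval P x :
  differentiable ((fun y => eval_at y P) : 'rV[C]_n -> C) x.
Proof. by case: (derivative_eval P x). Qed.

Lemma derive_eval P x i :
  'D_(delta_mx 0 i) ((fun y => eval_at y P) : 'rV[C]_n -> C) x =
  eval_at x (mderiv i P).
Proof. by case: (derivative_eval P x). Qed.

End PolynomialCalculus.

Section Integrability.
Import numFieldNormedType.Exports.
Variables (C : numClosedFieldType) (n : nat).
Implicit Types (Om : form n {mpoly C[n]}) (i j k l v : 'I_n).

Definition dent Om j k l :=
  mderiv j (ent Om k l) - mderiv k (ent Om j l) + mderiv l (ent Om j k).

(* The coefficients of [i_v Om /\ d Om]. *)
Definition frobp Om v i j k l :=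
  ent Om v i * dent Om j k l - ent Om v j * dent Om i k l
  + ent Om v k * dent Om i j l - ent Om v l * dent Om i j k.

Definition frob Om := forall v i j k l, frobp Om v i j k l = 0.

Definition plucker Om := forall i j k l,
  ent Om i j * ent Om k l - ent Om i k * ent Om j l + ent Om i l * ent Om j k = 0.

Lemma ent_form_at x Om i j : ent (form_at x Om) i j = eval_at x (ent Om i j).
Proof.
rewrite /ent; case: ltngtP => _; by rewrite ?ffunE ?eval_atN ?eval_at0.
Qed.

Lemma form_at_kform (e : nat) x Om : is_kform e Om -> is_kform e (form_at x Om).
Proof. by move=> Omk I Ik; rewrite ffunE Omk // eval_at0. Qed.

(** Where Om = theta1 /\ theta2 with d theta_k /\ Om = 0, the equations are the pointwise identity
    [frob_decomposable]. They are polynomial and hold off a proper closed set, hence identically. *)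
Lemma integrable_frob Om : is_kform 2 Om -> integrable Om -> frob Om.
Proof.
move=> Om2 [Z [[E ZE] Znt loc]].
have [x0 Zx0] : exists x0, ~ Z x0.
  by apply: contrapT => nx; apply: Znt; apply/seteqP; split=> // x _;
    apply: contrapT => Zx; apply: nx; exists x.
have [h Eh hx0] : exists2 h, E h & eval_at x0 h != 0.
  apply: contrapT => nh; apply: Zx0; rewrite ZE => P EP.
  by apply/eqP/negPn/negP => Px0; apply: nh; exists P.
have frobx x : ~ Z x -> forall v i j k l, eval_at x (frobp Om v i j k l) = 0.
  move=> /loc[U [t1 [t2 [[oU Ux] h1 h2 dec]]]].
  pose a i y := t1 [set i] y; pose b i y := t2 [set i] y.
  have entE y i j : U y -> eval_at y (ent Om i j) = a i y * b j y - a j y * b i y.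
    move=> Uy; have [h1k _] := h1 y Uy; have [h2k _] := h2 y Uy.
    have lt (i' j' : 'I_n) : (i' < j')%N ->
        eval_at y (ent Om i' j') = a i' y * b j' y - a j' y * b i' y.
      move=> ij; have [E1 _ _] := dec y Uy.
      by rewrite -ent_form_at E1 ent_lt // wedge11 // !ffunE.
    case: (ltngtP i j) => [/lt //|ji|/val_inj ->].
      by rewrite entN eval_atN lt // opprB.
    by rewrite entii eval_at0 subrr.
  pose da k i := 'D_(delta_mx 0 k) (a i) x; pose db k i := 'D_(delta_mx 0 k) (b i) x.
  have dba i : differentiable (a i) x by have [_ d] := h1 x Ux; exact: d.
  have dbb i : differentiable (b i) x by have [_ d] := h2 x Ux; exact: d.
  have dentE k i j : eval_at x (mderiv k (ent Om i j)) =
      (da k i * b j x + a i x * db k j) - (da k j * b i x + a j x * db k i).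
    rewrite -derive_eval.
    have -> : 'D_(delta_mx 0 k) (fun y => eval_at y (ent Om i j)) x =
        'D_(delta_mx 0 k) (a i * b j - a j * b i) x.
      apply: near_eq_derive.
      by near do rewrite entE //; exact: open_nbhs_nbhs.
    rewrite deriveB; [|by apply: diff_derivable; apply: differentiableM..].
    rewrite !deriveM; try exact: diff_derivable.
    rewrite /GRing.scale /= -/(da k i) -/(da k j) -/(db k i) -/(db k j); ring.
  have H (w : 'I_n -> 'I_n -> C) (t : form n ('rV[C]_n -> C)) :
      holomorphic_1form_on U t ->
      (forall k i, w k i = 'D_(delta_mx 0 k) (t [set i]) x) ->
      wedge (fun_ext_deriv_at x t) (form_at x Om) = 0 ->
      forall i j k l, wedge2 (fun i j => w i j - w j i)
        (fun i j => eval_at x (ent Om i j)) i j k l = 0.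
    rewrite /wedge2 => tU wE wed; apply: alternating4_eq0 => /=.
    - by move=> i j k l; rewrite (entN Om i j) eval_atN; ring.
    - by move=> i k l; rewrite entii eval_at0; ring.
    - by move=> i j k l; rewrite (entN Om j k) eval_atN; ring.
    - by move=> i k l; rewrite entii eval_at0; ring.
    - by move=> i j k l; rewrite (entN Om k l) eval_atN; ring.
    - by move=> i j k; rewrite entii eval_at0; ring.
    move=> i j k l ij jk kl.
    have dt2 : is_kform 2 (fun_ext_deriv_at x t).
      move=> K K2; rewrite ffunE big1 // => s sK.
      have -> : 'D_(delta_mx 0 s) (t (K :\ s)) x = 'D_(delta_mx 0 s) (cst 0) x.
        apply: near_eq_derive; near=> y.
        have Uy : U y by near: y; exact: open_nbhs_nbhs.
        have [/(_ (K :\ s))] := tU y Uy; rewrite ffunE => -> //.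
        by apply: contra K2 => /eqP K1; rewrite (cardsD1 s) sK K1.
      by rewrite derive_cst mulr0.
    have := congr1 (fun al : form n C => al (i |: (j |: [set k; l]))) wed.
    rewrite wedge22 //; last exact: form_at_kform.
    have dtE (i' j' : 'I_n) : (i' < j')%N ->
        ent (fun_ext_deriv_at x t) i' j' = w i' j' - w j' i'.
      by move=> lt; rewrite ent_lt // ext_deriv_set2 // !wE.
    have ik := ltn_trans ij jk; have jl := ltn_trans jk kl; have il := ltn_trans ij jl.
    by rewrite !dtE // !ent_form_at [RHS]ffunE.
  have Ha := H da t1 h1 (fun _ _ => erefl) (let: And3 _ w _ := dec x Ux in w).
  have Hb := H db t2 h2 (fun _ _ => erefl) (let: And3 _ _ w := dec x Ux in w).
  move=> v i j k l; rewrite /frobp /dent !(eval_atB, eval_atD, eval_atM) !dentE.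
  have E1 := Ha i j k l; have E2 := Hb i j k l; rewrite /wedge2 in E1 E2.
  rewrite !entE // in E1 E2 *.
  exact: (@frob_decomposable _ _ (fun i => a i x) (fun i => b i x) da db v i j k l E1 E2).
(* The factor [h] vanishes on the excluded set and is not the zero polynomial, so it can be
   cancelled once the product vanishes everywhere. *)
have hf v i j k l : h * frobp Om v i j k l = 0.
  apply: eval_at_inj => x; rewrite eval_atM eval_at0.
  have [Zx|/frobx ->] := pselect (Z x); last by rewrite mulr0.
  by move: Zx; rewrite ZE => ->; rewrite ?mul0r.
move=> v i j k l; have /eqP := hf v i j k l.
rewrite mulf_eq0 => /orP[/eqP h0|/eqP //].
by rewrite h0 eval_at0 eqxx in hx0.
Unshelve. all: by end_near. Qed.

Definition one_form (A : zmodType) (f : 'I_n -> A) : form n A :=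
  [ffun I : {set 'I_n} => (if enum I is [:: k] then f k else 0) : A].

Lemma one_form_set1 (A : zmodType) (f : 'I_n -> A) k : one_form f [set k] = f k.
Proof. by rewrite ffunE enum_set1. Qed.

Lemma one_form_neq (A : zmodType) (f : 'I_n -> A) (I : {set 'I_n}) :
  #|I| != 1%N -> one_form f I = 0.
Proof. by rewrite ffunE cardE; case: (enum I) => [|k []]. Qed.

Lemma differentiable_quotient (P Q : {mpoly C[n]}) x : eval_at x Q != 0 ->
  differentiable ((fun y => eval_at y P / eval_at y Q) : 'rV[C]_n -> C) x.
Proof.
move=> Qx; apply: (@differentiableM _ _ (fun y => eval_at y P)
  (fun y => (eval_at y Q)^-1)); first exact: differentiable_eval.
by apply: differentiableV => //; apply: differentiable_eval.
Qed.

Lemma derive_quotient (P Q : {mpoly C[n]}) x i : eval_at x Q != 0 ->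
  'D_(delta_mx 0 i) ((fun y => eval_at y P / eval_at y Q) : 'rV[C]_n -> C) x =
  (eval_at x Q)^-1 * eval_at x (mderiv i P)
  - (eval_at x Q)^-2 * (eval_at x (mderiv i Q) * eval_at x P).
Proof.
move=> Qx; rewrite (@deriveM _ _ (fun y => eval_at y P) (fun y => (eval_at y Q)^-1)).
- rewrite deriveV //; last exact/diff_derivable/differentiable_eval.
  rewrite !derive_eval /GRing.scale /=; ring.
- exact/diff_derivable/differentiable_eval.
- apply/diff_derivable/differentiableV => //; exact: differentiable_eval.
Qed.

(** Near a point where the entry Om_st is nonzero, Om = (i_s Om / Om_st) /\ i_t Om by Plücker.
    Differentiating the Plücker relation gives d(i_v Om) /\ Om = i_v Om /\ d Om, which is zero by
    [frob]; the division by Om_st is harmless by [wedge2_quotient]. *)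
Lemma plucker_frob_integrable Om : is_kform 2 Om -> Om <> 0 ->
  plucker Om -> frob Om -> integrable Om.
Proof.
move=> Om2 Om0 pl fr.
have plx x i j k l : let M i j := eval_at x (ent Om i j) in
    M i j * M k l - M i k * M j l + M i l * M j k = 0.
  by rewrite /= -!eval_atM -eval_atB -eval_atD pl eval_at0.
have dmx x v i j k l : wedge2 (fun i j => eval_at x (mderiv i (ent Om v j)) -
     eval_at x (mderiv j (ent Om v i))) (fun i j => eval_at x (ent Om i j)) i j k l = 0.
  rewrite (@wedge2_deriv _ _ _ (fun k i j => eval_at x (mderiv k (ent Om i j)))).
  have dpl h i' j' k' : eval_at x (mderiv h (ent Om v i' * ent Om j' k'
      - ent Om v j' * ent Om i' k' + ent Om v k' * ent Om i' j')) = 0.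
    by rewrite pl mderiv0 eval_at0.
  have := congr1 (eval_at x) (fr v i j k l); rewrite eval_at0 /frobp /dent.
  rewrite !(eval_atB, eval_atD, eval_atM) => ->.
  have := dpl i j k l; have := dpl j i k l; have := dpl k i j l; have := dpl l i j k.
  rewrite !(mderivB, mderivD, mderivM) !(eval_atB, eval_atD, eval_atM).
  by move=> -> -> -> ->; ring.
exists (Sing Om); split.
- exists [set P | exists I, P = Om I]%classic; apply/seteqP; split=> x /=.
    by move=> Sx _ [I ->]; apply: Sx.
  by move=> Ex I; apply: Ex; exists I.
- move=> ST; apply: Om0; apply/ffunP => I; rewrite [RHS]ffunE.
  apply: eval_at_inj => x; rewrite eval_at0.
  by have : Sing Om x by [rewrite ST].
move=> x nSx; have [I OIx] : exists I, eval_at x (Om I) != 0.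
  apply: contrapT => nI; apply: nSx => I; apply/eqP/negPn/negP => OI.
  by apply: nI; exists I.
have [/card2P[s [t [st IE]]]|I2] := eqVneq #|I| 2%N; last first.
  by rewrite Om2 ?eval_at0 ?eqxx in OIx.
have Qx : eval_at x (ent Om s t) != 0 by rewrite ent_lt // -IE.
pose U := [set y | eval_at y (ent Om s t) != 0]%classic.
pose t1 : form n ('rV[C]_n -> C) :=
  one_form (fun k y => eval_at y (ent Om s k) / eval_at y (ent Om s t)).
pose t2 : form n ('rV[C]_n -> C) := one_form (fun k y => eval_at y (ent Om t k)).
have dt (f : 'I_n -> 'rV[C]_n -> C) y : is_kform 2 (fun_ext_deriv_at y (one_form f)).
  apply: ext_deriv_kform => [i|J J1]; [exact: derive_cst|exact: one_form_neq].
have k1 (f : 'I_n -> 'rV[C]_n -> C) y : is_kform 1 (fun_form_at y (one_form f)).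
  by move=> J J1; rewrite ffunE one_form_neq.
have wed0 y (f : 'I_n -> 'rV[C]_n -> C) (c e : C) (v : 'I_n) (q : 'I_n -> C) : 
    (forall i j, 'D_(delta_mx 0 i) (f j) y = c * eval_at y (mderiv i (ent Om v j)) -
        e * (q i * eval_at y (ent Om v j))) ->
    wedge (fun_ext_deriv_at y (one_form f)) (form_at y Om) = 0.
  move=> fE; apply/ffunP => K; rewrite [RHS]ffunE.
  have kf := wedge_kform (dt f y) (form_at_kform y Om2).
  have [/card4P[i [j [k [l [ij jk kl ->]]]]]|K4] := eqVneq #|K| 4%N; last exact: kf.
  rewrite wedge22 //; last exact: form_at_kform.
  have dE (i' j' : 'I_n) : (i' < j')%N -> ent (fun_ext_deriv_at y (one_form f)) i' j' =
      'D_(delta_mx 0 i') (f j') y - 'D_(delta_mx 0 j') (f i') y.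
    by move=> lt; rewrite ent_lt // ext_deriv_set2 // !one_form_set1.
  have ik := ltn_trans ij jk; have jl := ltn_trans jk kl; have il := ltn_trans ij jl.
  rewrite !dE // !ent_form_at.
  apply: (wedge2_quotient fE (dmx y v i j k l)) => j' k' l'.
  by have := plx y v j' k' l'.
have d0 y : differentiable (0 : 'rV[C]_n -> C) y by exact: (differentiable_cst (0 : C)).
exists U, t1, t2; split.
- split=> //; have -> : U = ((fun y => eval_at y (ent Om s t)) @^-1` [set z | z != 0])%classic.
    by [].
  apply: open_comp => [y _|]; last first.
    have -> : [set z : C | z != 0]%classic = (~` [set 0])%classic.
      by apply/seteqP; split=> z /= /eqP.
    apply: closed_openC; apply: accessible_closed_set1; apply: hausdorff_accessible.
    exact: norm_hausdorff.
  exact/differentiable_continuous/differentiable_eval.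
- move=> y Uy; split=> [|J]; first exact: k1.
  rewrite ffunE; case: (enum J) => [|k [|? ?]]; [exact: d0| |exact: d0].
  exact: differentiable_quotient.
- move=> y Uy; split=> [|J]; first exact: k1.
  rewrite ffunE; case: (enum J) => [|k [|? ?]]; [exact: d0| |exact: d0].
  exact: differentiable_eval.
move=> y Uy; split.
- apply: eq_kform2 => [||i j ij]; first exact: form_at_kform.
    exact: wedge_kform (k1 _ _) (k1 _ _).
  rewrite ent_form_at [RHS](ent_lt _ ij) wedge11 //; [|exact: k1|exact: k1].
  rewrite !ffunE !enum_set1; apply: (mulfI Uy).
  have := plx y s t i j; rewrite /= => pl0.
  set Q := eval_at y (ent Om s t) in Uy pl0 *.
  transitivity (eval_at y (ent Om s i) * eval_at y (ent Om t j) -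
      eval_at y (ent Om s j) * eval_at y (ent Om t i)).
    by apply/eqP; rewrite -subr_eq0 -pl0; apply/eqP; ring.
  by rewrite mulrBr ![_ / Q * _]mulrAC ![Q * _]mulrC !mulfVK.
- by apply: wed0 => i j; rewrite derive_quotient.
- apply: (wed0 _ _ 1 0 t (fun=> 0)) => i j.
  by rewrite derive_eval mul1r mul0r subr0.
Qed.

End Integrability.

(** * Linear changes of coordinates *)

Section Multilinear.
Variables (C : numClosedFieldType) (n : nat).
Implicit Types (t u v w x y z : 'rV[C]_n) (M : 'I_n -> 'I_n -> C).

Definition lin (F : 'rV[C]_n -> C) := forall a u v, F (a *: u + v) = a * F u + F v.

Lemma lin0 F : lin F -> F 0 = 0.
Proof. by move=> lF; have := lF 1 0 0; rewrite scaler0 addr0 mul1r -{1}[F 0]addr0 => /addrI. Qed.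

Lemma lin_sum F u : lin F -> F u = \sum_i u 0 i * F (delta_mx 0 i).
Proof.
move=> lF; rewrite {1}[u]row_sum_delta.
elim/big_rec2: _ => [|i x y _ <-]; first exact: lin0.
exact: lF.
Qed.

Lemma lin_eq0 F : lin F -> (forall i, F (delta_mx 0 i) = 0) -> forall u, F u = 0.
Proof. by move=> lF F0 u; rewrite lin_sum // big1 // => i _; rewrite F0 mulr0. Qed.

Definition bil M u w := \sum_i \sum_j u 0 i * w 0 j * M i j.

Lemma bil_linl M w : lin (fun u => bil M u w).
Proof.
move=> a u v; rewrite /bil mulr_sumr -big_split; apply: eq_bigr => i _ /=.
rewrite mulr_sumr -big_split; apply: eq_bigr => j _ /=; rewrite !mxE; ring.
Qed.

Lemma bil_linr M u : lin (fun w => bil M u w).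
Proof.
move=> a w v; rewrite /bil mulr_sumr -big_split; apply: eq_bigr => i _ /=.
rewrite mulr_sumr -big_split; apply: eq_bigr => j _ /=; rewrite !mxE; ring.
Qed.

Lemma bil_delta M i j : bil M (delta_mx 0 i) (delta_mx 0 j) = M i j.
Proof.
rewrite /bil (bigD1 i) //= (bigD1 j) //= !mxE !eqxx mul1r mul1r.
rewrite big1 => [|l /negPf lj]; last by rewrite !mxE lj /= ?andbF mulr0 mul0r.
rewrite big1 ?addr0 // => l /negPf li; apply: big1 => h _.
by rewrite !mxE li /= !mul0r.
Qed.

Lemma bilN M u w : (forall i j, M j i = - M i j) -> bil M w u = - bil M u w.
Proof.
move=> MN; rewrite /bil exchange_big -sumrN; apply: eq_bigr => i _.
by rewrite -sumrN; apply: eq_bigr => j _; rewrite MN; ring.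
Qed.

(* [dM k] stands for the derivative of the form [M] in the direction [k]. *)
Definition der (dM : 'I_n -> 'I_n -> 'I_n -> C) t u w := \sum_k t 0 k * bil (dM k) u w.

Lemma der_lin1 dM u w : lin (fun t => der dM t u w).
Proof.
move=> a t s; rewrite /der mulr_sumr -big_split; apply: eq_bigr => k _ /=.
by rewrite !mxE; ring.
Qed.

Lemma der_lin2 dM t w : lin (fun u => der dM t u w).
Proof.
move=> a u v; rewrite /der mulr_sumr -big_split; apply: eq_bigr => k _ /=.
by rewrite bil_linl; ring.
Qed.

Lemma der_lin3 dM t u : lin (fun w => der dM t u w).
Proof.
move=> a w v; rewrite /der mulr_sumr -big_split; apply: eq_bigr => k _ /=.
by rewrite bil_linr; ring.
Qed.

Lemma der_delta dM i j k :
  der dM (delta_mx 0 k) (delta_mx 0 i) (delta_mx 0 j) = dM k i j.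
Proof.
rewrite /der (bigD1 k) //= bil_delta mxE !eqxx mul1r big1 ?addr0 // => l /negPf lk.
by rewrite mxE lk ?andbF mul0r.
Qed.

Lemma derN dM t u w : (forall k i j, dM k j i = - dM k i j) ->
  der dM t w u = - der dM t u w.
Proof. by move=> dN; rewrite /der -sumrN; apply: eq_bigr => k _; rewrite (bilN _ _ (dN k)) mulrN. Qed.

(** The exterior derivative evaluated on three constant vectors. *)
Definition ext dM u w z := der dM u w z - der dM w u z + der dM z u w.

(** [plv] and [frv] are the Plücker and Frobenius expressions on arbitrary vectors, so that their
    multilinearity can be used. *)
Definition plv M u1 u2 u3 u4 :=
  bil M u1 u2 * bil M u3 u4 - bil M u1 u3 * bil M u2 u4 + bil M u1 u4 * bil M u2 u3.

Definition frv M dM v u1 u2 u3 u4 :=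
  bil M v u1 * ext dM u2 u3 u4 - bil M v u2 * ext dM u1 u3 u4
  + bil M v u3 * ext dM u1 u2 u4 - bil M v u4 * ext dM u1 u2 u3.

Section VanishOnBasis.
(* [lin_eq0] holds with the basis vectors replaced by any family [good]. *)
Variable good : 'rV[C]_n -> Prop.
Hypothesis good_eq0 : forall F, lin F -> (forall u, good u -> F u = 0) -> forall u, F u = 0.

Lemma plv_eq0 M : (forall u1 u2 u3 u4, good u1 -> good u2 -> good u3 -> good u4 ->
  plv M u1 u2 u3 u4 = 0) -> forall u1 u2 u3 u4, plv M u1 u2 u3 u4 = 0.
Proof.
move=> pl0 u1 u2 u3 u4; move: u1; apply: good_eq0 => [a u v|u1 g1].
  by rewrite /plv !bil_linl; ring.
move: u2; apply: good_eq0 => [a u v|u2 g2]; first by rewrite /plv !(bil_linl, bil_linr); ring.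
move: u3; apply: good_eq0 => [a u v|u3 g3]; first by rewrite /plv !(bil_linl, bil_linr); ring.
move: u4; apply: good_eq0 => [a u v|u4 g4]; first by rewrite /plv !(bil_linl, bil_linr); ring.
exact: pl0.
Qed.

Lemma frv_eq0 M dM : (forall v u1 u2 u3 u4,
    good v -> good u1 -> good u2 -> good u3 -> good u4 -> frv M dM v u1 u2 u3 u4 = 0) ->
  forall v u1 u2 u3 u4, frv M dM v u1 u2 u3 u4 = 0.
Proof.
move=> fr0 v u1 u2 u3 u4; move: v; apply: good_eq0 => [a u v|v gv].
  by rewrite /frv !bil_linl; ring.
move: u1; apply: good_eq0 => [a u w|u1 g1].
  by rewrite /frv /ext !(bil_linl, bil_linr, der_lin1, der_lin2, der_lin3); ring.
move: u2; apply: good_eq0 => [a u w|u2 g2].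
  by rewrite /frv /ext !(bil_linl, bil_linr, der_lin1, der_lin2, der_lin3); ring.
move: u3; apply: good_eq0 => [a u w|u3 g3].
  by rewrite /frv /ext !(bil_linl, bil_linr, der_lin1, der_lin2, der_lin3); ring.
move: u4; apply: good_eq0 => [a u w|u4 g4].
  by rewrite /frv /ext !(bil_linl, bil_linr, der_lin1, der_lin2, der_lin3); ring.
exact: fr0.
Qed.

End VanishOnBasis.

End Multilinear.

Section Substitution.
Variables (C : numClosedFieldType).
Implicit Types (B : 'M[C]_5) (Om : form 5 {mpoly C[5]}).

Definition linsub B : 5.-tuple {mpoly C[5]} :=
  [tuple \sum_j B i j *: ('X_j : {mpoly C[5]}) | i < 5].

Lemma eval_comp m k (lq : m.-tuple {mpoly C[k]}) p x :
  eval_at x (comp_mpoly lq p) = eval_at (\row_i eval_at x (tnth lq i)) p.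
Proof.
rewrite /eval_at comp_mpoly_meval; apply: meval_eq => i; by rewrite mxE.
Qed.

Lemma eval_linsub B p x : eval_at x (comp_mpoly (linsub B) p) = eval_at (x *m B^T) p.
Proof.
rewrite eval_comp; congr eval_at; apply/rowP => i.
rewrite !mxE tnth_mktuple eval_at_sum; apply: eq_bigr => j _.
by rewrite eval_atZ eval_atXU mxE mulrC.
Qed.

Lemma mderiv_comp m k (lq : m.-tuple {mpoly C[k]}) p i :
  mderiv i (comp_mpoly lq p) =
  \sum_j comp_mpoly lq (mderiv j p) * mderiv i (tnth lq j).
Proof.
elim/mpoly_ring_ind: p => [c|j|p q Pp Pq|p q Pp Pq].
- rewrite comp_mpolyC mderivC big1 // => j _.
  by rewrite mderivC comp_mpoly0 mul0r.
- rewrite comp_mpolyXU -tnth_nth (bigD1 j) //= mderivX mnm1E eqxx scale1r.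
  have -> : mnm_sub (mnm1 j) (mnm1 j) = @mnm0 m.
    by apply/mnmP => h; rewrite mnmBE subnn mnm0E.
  rewrite mpolyX0 comp_mpoly1 mul1r big1 ?addr0 // => h hj.
  by rewrite mderivX mnm1E eq_sym (negPf hj) scale0r comp_mpoly0 mul0r.
- rewrite comp_mpolyD mderivD Pp Pq -big_split; apply: eq_bigr => j _ /=.
  by rewrite mderivD comp_mpolyD mulrDl.
- rewrite rmorphM mderivM Pp Pq mulr_suml mulr_sumr -big_split.
  apply: eq_bigr => j _ /=.
  by rewrite mderivM comp_mpolyD !rmorphM /=; ring.
Qed.

Lemma mderiv_linsub B i j : mderiv j (tnth (linsub B) i) = mpolyC 5 (B i j).
Proof.
rewrite tnth_mktuple raddf_sum (bigD1 j) //= mderivZ mderivX mnm1E eqxx scale1r.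
have -> : mnm_sub (mnm1 j) (mnm1 j) = @mnm0 5.
  by apply/mnmP => h; rewrite mnmBE subnn mnm0E.
rewrite mpolyX0 big1 ?addr0 => [|h hj]; first exact: alg_mpolyC.
by rewrite mderivZ mderivX mnm1E (negPf hj) scale0r scaler0.
Qed.

(** The pullback by the linear map x |-> B x; hence the reversed product in [act_act]. *)
Definition act B Om : form 5 {mpoly C[5]} := of_ent (fun k l =>
  \sum_i \sum_j (B i k * B j l) *: comp_mpoly (linsub B) (ent Om i j)).

Lemma act_kform B Om : is_kform 2 (act B Om).
Proof. exact: of_ent_kform. Qed.

Lemma ent_act B Om k l : ent (act B Om) k l =
  \sum_i \sum_j (B i k * B j l) *: comp_mpoly (linsub B) (ent Om i j).
Proof.
have actN i j : \sum_i0 \sum_j0 (B i0 j * B j0 i) *: comp_mpoly (linsub B) (ent Om i0 j0) =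
   - \sum_i0 \sum_j0 (B i0 i * B j0 j) *: comp_mpoly (linsub B) (ent Om i0 j0).
  rewrite exchange_big -sumrN; apply: eq_bigr => a _; rewrite -sumrN; apply: eq_bigr => b _.
  by rewrite (entN Om a b) rmorphN scalerN mulrC.
apply: ent_of_ent => // i; apply: eval_at_inj => x; rewrite eval_at0.
have := congr1 (eval_at x) (actN i i); rewrite eval_atN => /esym/eqP.
by rewrite eqNr => /eqP.
Qed.

Definition colv B k : 'rV[C]_5 := \row_i B i k.
Definition Mat Om x i j := eval_at x (ent Om i j).
Definition dMat Om x k i j := eval_at x (mderiv k (ent Om i j)).

Lemma Mat_act B Om x k l :
  Mat (act B Om) x k l = bil (Mat Om (x *m B^T)) (colv B k) (colv B l).
Proof.
rewrite /Mat ent_act eval_at_sum; apply: eq_bigr => i _; rewrite eval_at_sum.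
by apply: eq_bigr => j _; rewrite eval_atZ eval_linsub !mxE.
Qed.

Lemma dMat_act B Om x h k l :
  dMat (act B Om) x h k l = der (dMat Om (x *m B^T)) (colv B h) (colv B k) (colv B l).
Proof.
rewrite /dMat ent_act raddf_sum eval_at_sum /der.
under [RHS]eq_bigr => a _ do rewrite /bil mulr_sumr.
rewrite exchange_big; apply: eq_bigr => i _ /=.
rewrite raddf_sum eval_at_sum.
under [RHS]eq_bigr => a _ do rewrite mulr_sumr.
rewrite exchange_big; apply: eq_bigr => j _ /=.
rewrite mderivZ eval_atZ mderiv_comp eval_at_sum mulr_sumr; apply: eq_bigr => a _.
by rewrite eval_atM eval_linsub mderiv_linsub eval_atC !mxE; ring.
Qed.

(** The pullback at x is the form at B x evaluated on the columns of B ([Mat_act]), and a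
    multilinear expression vanishing on basis vectors vanishes on all vectors. [frob_act] is the
    same with [dMat_act]. *)
Lemma plucker_act B Om : plucker Om -> plucker (act B Om).
Proof.
move=> pl i j k l; apply: eval_at_inj => x.
rewrite eval_atD eval_atB !eval_atM eval_at0 -!/(Mat _ _ _ _) !Mat_act.
apply: (plv_eq0 (good := fun u => exists i, u = delta_mx 0 i)) => [F lF F0|].
  by apply: lin_eq0 => // h; apply: F0; exists h.
move=> _ _ _ _ [a ->] [b ->] [c ->] [d ->]; rewrite /plv !bil_delta /Mat.
by rewrite -!eval_atM -eval_atB -eval_atD pl eval_at0.
Qed.

Lemma frob_act B Om : frob Om -> frob (act B Om).
Proof.
move=> fr v i j k l; apply: eval_at_inj => x.
rewrite /frobp /dent !(eval_atB, eval_atD, eval_atM) eval_at0.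
rewrite -!/(Mat _ _ _ _) -!/(dMat _ _ _ _ _) !Mat_act !dMat_act.
apply: (frv_eq0 (good := fun u => exists i, u = delta_mx 0 i)) => [F lF F0|].
  by apply: lin_eq0 => // h; apply: F0; exists h.
move=> _ _ _ _ _ [e ->] [a ->] [b ->] [c ->] [d ->].
rewrite /frv /ext !bil_delta !der_delta /Mat /dMat.
have := congr1 (eval_at (x *m B^T)) (fr e a b c d).
by rewrite /frobp /dent !(eval_atB, eval_atD, eval_atM) eval_at0.
Qed.

End Substitution.

Section Euler.
Variables (C : numClosedFieldType) (n : nat).
Implicit Types (P : {mpoly C[n]}) (x : 'rV[C]_n).

Lemma euler d P : P \is homog d -> \sum_k 'X_k * mderiv k P = d%:R *: P.
Proof.
move=> /dhomogP Pd; rewrite {2}[P]mpolyE scaler_sumr.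
under eq_bigr => k _ do rewrite {1}[P]mpolyE raddf_sum mulr_sumr.
rewrite exchange_big !big_seq; apply: eq_bigr => m /Pd /= md.
rewrite -md mdegE natr_sum scaler_suml; apply: eq_bigr => k _.
rewrite mderivZ mderivX -!scalerAr scalerA scalerA mulrC.
have [->|mk] := eqVneq (m k) 0%N; first by rewrite !mul0r !scale0r.
by rewrite -mpolyXD addmC submK ?lep1mP.
Qed.

Lemma mderiv_homog d P k : P \is homog d.+1 -> mderiv k P \is homog d.
Proof.
move=> /dhomogP Pd; apply/dhomogP => m; rewrite mcoeff_msupp mcoeff_mderiv => mP.
have /Pd : mnm_add m (mnm1 k) \in msupp P.
  by rewrite mcoeff_msupp; apply: contraNneq mP => ->; rewrite mul0rn.
by rewrite /= mdegD mdeg1 addn1 => -[].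
Qed.

Lemma eval_homog d P c x : P \is homog d -> eval_at (c *: x) P = c ^+ d * eval_at x P.
Proof.
move=> /dhomogP Pd; rewrite /eval_at !mevalE mulr_sumr !big_seq; apply: eq_bigr => m /Pd /= <-.
rewrite mulrCA; congr (_ * _); rewrite mdegE -prodrXr -big_split.
by apply: eq_bigr => i _; rewrite mxE exprMn.
Qed.

Lemma homog_comp k d P (lq : n.-tuple {mpoly C[k]}) :
  (forall i, tnth lq i \is homog 1) -> P \is homog d -> comp_mpoly lq P \is homog d.
Proof.
move=> lq1 /dhomogP Pd; rewrite [P]mpolyE raddf_sum big_seq; apply: rpred_sum => m /Pd /= <-.
rewrite comp_mpolyZ comp_mpolyX; apply: dhomogZ; rewrite mdegE.
elim/big_rec2: _ => [|i e p _ pe]; first exact: dhomog1.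
by apply: dhomogM => //; have := dhomogMn (m i) (lq1 i); rewrite mul1n.
Qed.

End Euler.

Section Action.
Variable C : numClosedFieldType.
Implicit Types (A B : 'M[C]_5) (Om : form 5 {mpoly C[5]}).

Lemma lin_comb n m (F : 'rV[C]_n -> C) (c : 'I_m -> C) (u : 'I_m -> 'rV[C]_n) : lin F ->
  F (\sum_i c i *: u i) = \sum_i c i * F (u i).
Proof.
move=> lF; elim/big_rec2: _ => [|i x y _ <-]; [exact: lin0|exact: lF].
Qed.

Lemma colvM A B k : colv (B *m A) k = \sum_i A i k *: colv B i.
Proof.
apply/rowP => j; rewrite !mxE summxE; apply: eq_bigr => i _.
by rewrite !mxE mulrC.
Qed.

Lemma eq_act Om1 Om2 : is_kform 2 Om1 -> is_kform 2 Om2 ->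
  (forall x k l, Mat Om1 x k l = Mat Om2 x k l) -> Om1 = Om2.
Proof.
by move=> k1 k2 E; apply: eq_kform2 => // i j _; apply: eval_at_inj => x; apply: E.
Qed.

Lemma act_act A B Om : act A (act B Om) = act (B *m A) Om.
Proof.
apply: eq_act => [||x k l]; try exact: act_kform.
rewrite [LHS]Mat_act [RHS]Mat_act trmx_mul mulmxA /bil.
under eq_bigr => i _ do under eq_bigr => j _ do rewrite Mat_act.
rewrite [RHS](_ : _ = bil (Mat Om (x *m A^T *m B^T)) (colv (B *m A) k) (colv (B *m A) l)) //.
rewrite !colvM (lin_comb _ _ (bil_linl _ _)); apply: eq_bigr => i _.
rewrite (lin_comb _ _ (bil_linr _ _)) mulr_sumr; apply: eq_bigr => j _.
by rewrite !mxE mulrA.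
Qed.

Lemma act1 Om : is_kform 2 Om -> act 1%:M Om = Om.
Proof.
move=> Om2; apply: eq_act => [||x k l]; [exact: act_kform|by []|].
have col1 i : colv (1%:M : 'M[C]_5) i = delta_mx 0 i.
  by apply/rowP => j; rewrite !mxE eqxx.
by rewrite Mat_act !col1 bil_delta trmx1 mulmx1.
Qed.

Lemma actK B Om : B \in unitmx -> is_kform 2 Om -> act (invmx B) (act B Om) = Om.
Proof. by move=> uB Om2; rewrite act_act mulmxV // act1. Qed.

Lemma ent_homog d Om i j : (forall I, Om I \is homog d) -> ent Om i j \is homog d.
Proof. by move=> Omd; rewrite /ent; case: ltngtP; rewrite ?rpredN ?rpred0. Qed.

Lemma act_homog d B Om : (forall I, Om I \is homog d) -> forall I, act B Om I \is homog d.
Proof.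
move=> Omd I; rewrite ffunE; case: (enum I) => [|k [|l []]]; rewrite ?rpred0 //.
apply: rpred_sum => i _; apply: rpred_sum => j _; apply: dhomogZ; apply: homog_comp.
  move=> h; rewrite tnth_mktuple; apply: rpred_sum => m _; apply: dhomogZ.
  by rewrite dhomogX; apply/eqP; apply: mdeg1.
exact: ent_homog.
Qed.

Definition radial0 Om := forall x u, bil (Mat Om x) x u = 0.

Lemma contraction_radial Om : is_kform 2 Om ->
  contraction (@radial C 5) Om = 0 <-> radial0 Om.
Proof.
move=> Om2; rewrite contraction_eq0 //; split=> [R0 x|R0 j].
  apply: lin_eq0 => [|j]; first exact: bil_linr.
  rewrite (lin_sum _ (bil_linl _ _)); have := congr1 (eval_at x) (R0 j).
  rewrite eval_at0 eval_at_sum => R0x; rewrite -[RHS]R0x; apply: eq_bigr => i _.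
  by rewrite bil_delta eval_atM eval_atXU.
apply: eval_at_inj => x; rewrite eval_at0 eval_at_sum -[RHS](R0 x (delta_mx 0 j)).
rewrite (lin_sum _ (bil_linl _ _)); apply: eq_bigr => i _.
by rewrite bil_delta eval_atM eval_atXU.
Qed.

Lemma act_radial B Om : radial0 Om -> radial0 (act B Om).
Proof.
move=> R0 x; apply: lin_eq0 => [|j]; first exact: bil_linr.
rewrite (lin_sum _ (bil_linl _ _)) -[RHS](R0 (x *m B^T) (colv B j)).
rewrite [in X in bil _ X _](_ : x *m B^T = \sum_i x 0 i *: colv B i); last first.
  by apply/rowP => k; rewrite mxE summxE; apply: eq_bigr => i _; rewrite !mxE.
rewrite (lin_comb _ _ (bil_linl _ _)); apply: eq_bigr => i _; by rewrite bil_delta Mat_act.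
Qed.

Lemma MatD a Om1 Om2 x i j : Mat (a *: Om1 + Om2) x i j = a * Mat Om1 x i j + Mat Om2 x i j.
Proof.
rewrite /Mat /ent; case: ltngtP => _; rewrite ?eval_at0 ?mulr0 ?addr0 //.
  by rewrite !ffunE eval_atD eval_atZ.
by rewrite !ffunE !eval_atN eval_atD eval_atZ mulrN -opprD.
Qed.

Lemma MatN Om x i j : Mat Om x j i = - Mat Om x i j.
Proof. by rewrite /Mat entN eval_atN. Qed.

Lemma dMatN Om x k i j : dMat Om x k j i = - dMat Om x k i j.
Proof. by rewrite /dMat entN mderivN eval_atN. Qed.

End Action.

(** * Affine charts and the hyperplane x_5 = 1 *)

Section Chart.
Variable C : numClosedFieldType.
Implicit Types (A B : 'M[C]_5) (Om : form 5 {mpoly C[5]}).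

Definition w4 : 'I_4 -> 'I_5 := widen_ord (leqnSn 4).
Definition emb : 5.-tuple {mpoly C[4]} := chart 1%:M.
Definition pt (z : 'rV[C]_4) : 'rV[C]_5 := \row_i eval_at z (tnth emb i).

Lemma ord5P (i : 'I_5) : i = ord_max \/ exists k, i = w4 k.
Proof.
have [k ->|->] := unliftP ord_max i; last by left.
right; exists k; apply/val_inj; rewrite /= /bump leqNgt ltn_ord //.
Qed.

Lemma w4_neq_max k : w4 k == ord_max = false.
Proof. by apply/eqP => /(congr1 val) /= k4; have := ltn_ord k; rewrite k4. Qed.

Lemma w4_inj : injective w4.
Proof. by move=> k l /(congr1 val) /= /val_inj. Qed.

Lemma ptE z : pt z 0 ord_max = 1 /\ forall k, pt z 0 (w4 k) = z 0 k.
Proof.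
have E h : pt z 0 h = \sum_j (h == w4 j)%:R * z 0 j + (h == ord_max)%:R.
  rewrite mxE tnth_mktuple eval_atD eval_atC eval_at_sum mxE.
  rewrite (eq_bigr (fun j => (h == w4 j)%:R * z 0 j)) // => j _.
  by rewrite eval_atZ eval_atXU mxE.
split=> [|k]; rewrite E ?eqxx ?w4_neq_max.
  by rewrite big1 ?add0r // => j _; rewrite eq_sym w4_neq_max mul0r.
rewrite addr0 (bigD1 k) //= eqxx mul1r big1 ?addr0 // => l /negPf lk.
by rewrite (inj_eq w4_inj) eq_sym lk mul0r.
Qed.

Lemma eval_chart A z i : eval_at z (tnth (chart A) i) = (pt z *m A^T) 0 i.
Proof.
have [pm pk] := ptE z; rewrite tnth_mktuple eval_atD eval_atC eval_at_sum.
rewrite [RHS]mxE [RHS]big_ord_recr /= pm mul1r [_^T ord_max _]mxE.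
rewrite (eq_bigr (fun j => pt z 0 (w4 j) * A^T (w4 j) i)) // => j _.
by rewrite eval_atZ eval_atXU pk [_^T _ _]mxE mulrC.
Qed.

Lemma eval_emb z p : eval_at z (comp_mpoly emb p) = eval_at (pt z) p.
Proof. by rewrite eval_comp. Qed.

Lemma mderiv_chart A i k : mderiv k (tnth (chart A) i) = mpolyC 4 (A i (w4 k)).
Proof.
rewrite tnth_mktuple mderivD mderivC addr0 raddf_sum (bigD1 k) //=.
rewrite mderivZ mderivX mnm1E eqxx scale1r.
have -> : mnm_sub (mnm1 k) (mnm1 k) = @mnm0 4.
  by apply/mnmP => h; rewrite mnmBE subnn mnm0E.
rewrite mpolyX0 big1 ?addr0 => [|h hj]; first exact: alg_mpolyC.
by rewrite mderivZ mderivX mnm1E (negPf hj) scale0r scaler0.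
Qed.

Lemma mderiv_emb p k : mderiv k (comp_mpoly emb p) = comp_mpoly emb (mderiv (w4 k) p).
Proof.
rewrite mderiv_comp (bigD1 (w4 k)) //= mderiv_chart mxE eqxx mpolyC1 mulr1.
rewrite big1 ?addr0 // => j /negPf jk; rewrite mderiv_chart mxE jk.
by rewrite mpolyC0 mulr0.
Qed.

(** The chart of [A] is the inclusion of the hyperplane x_5 = 1 followed by the linear map [A]. *)
Lemma pullback_chart A Om k l : is_kform 2 Om ->
  ent (pullback (chart A) Om) k l = comp_mpoly emb (ent (act A Om) (w4 k) (w4 l)).
Proof.
move=> Om2; have lt (k' l' : 'I_4) : (k' < l')%N -> ent (pullback (chart A) Om) k' l' =
    comp_mpoly emb (ent (act A Om) (w4 k') (w4 l')).
  move=> kl; rewrite ent_pullback //; apply: eval_at_inj => z.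
  rewrite eval_emb -/(Mat _ _ _ _) Mat_act /bil !eval_at_sum; apply: eq_bigr => i _.
  rewrite eval_at_sum; apply: eq_bigr => j _.
  rewrite !eval_atM !mderiv_chart !eval_atC mulrC !mxE; congr (_ * _).
  by rewrite eval_comp; congr eval_at; apply/rowP => h; rewrite mxE eval_chart.
case: (ltngtP k l) => [/lt //|lk|/val_inj ->]; last by rewrite !entii comp_mpoly0.
by rewrite entN lt // [in RHS]entN rmorphN.
Qed.

End Chart.

(** * The parameter space of the family *)

Section Restricted.
Variables (C : numClosedFieldType) (S X : 'I_4 -> {mpoly C[4]}).
Let om := contraction S (contraction X (volume 4 {mpoly C[4]})).
Let f a b := S (o4 a) * X (o4 b) - S (o4 b) * X (o4 a).

Lemma ent_restricted :
  [/\ ent om (o4 0) (o4 1) = - f 2 3, ent om (o4 0) (o4 2) = f 1 3,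
      ent om (o4 0) (o4 3) = - f 1 2, ent om (o4 1) (o4 2) = - f 0 3 &
      ent om (o4 1) (o4 3) = f 0 2 /\ ent om (o4 2) (o4 3) = - f 0 1].
Proof.
have lt (a b : nat) : (a < b)%N -> (b < 4)%N -> ent om (o4 a) (o4 b) = entSX S X (o4 a) (o4 b).
  move=> ab b4; have ab' : (o4 a < o4 b)%N by rewrite /= !inordK // (ltn_trans ab).
  by rewrite ent_lt // /om contraction2_volume.
by rewrite !lt //= /entSX !val_o4.
Qed.

Lemma plucker_restricted : ent om (o4 0) (o4 1) * ent om (o4 2) (o4 3) -
  ent om (o4 0) (o4 2) * ent om (o4 1) (o4 3) +
  ent om (o4 0) (o4 3) * ent om (o4 1) (o4 2) = 0.
Proof. by have [-> -> -> -> [-> ->]] := ent_restricted; rewrite /f; ring. Qed.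

(* [i_v om /\ d om] is, up to sign, [om (v, [S, X] - lam X)] times the volume
   form. *)
Lemma frob_restricted (w : 'I_4 -> C) (lam : C) v :
  (forall i j, mderiv j (S i) = if j == i then mpolyC 4 (w i) else 0) ->
  (forall i, bracket S X i = lam *: X i) ->
  frobp om v (o4 0) (o4 1) (o4 2) (o4 3) = 0.
Proof.
move=> dS br; pose E i := bracket S X i - mpolyC 4 lam * X i.
have E0 i : E i = 0 by rewrite /E br mul_mpolyC subrr.
transitivity (ent om v (o4 0) * E (o4 0) + ent om v (o4 1) * E (o4 1) +
  ent om v (o4 2) * E (o4 2) + ent om v (o4 3) * E (o4 3)); last first.
  by rewrite !E0 !mulr0 !addr0.
have [e01 e02 e03 e12 [e13 e23]] := ent_restricted.
rewrite /frobp /dent e01 e02 e03 e12 e13 e23 /E /bracket !sum4 /f.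
rewrite !(mderivN, mderivB, mderivM) !dS -!val_eqE !val_o4 //=.
elim/ord4P: v; rewrite ?entii ?e01 ?e02 ?e03 ?e12 ?e13 ?e23
  ?(entN om (o4 0) (o4 1)) ?(entN om (o4 0) (o4 2)) ?(entN om (o4 0) (o4 3))
  ?(entN om (o4 1) (o4 2)) ?(entN om (o4 1) (o4 3)) ?(entN om (o4 2) (o4 3))
  ?e01 ?e02 ?e03 ?e12 ?e13 ?e23 /f.
all: move: (w (o4 0)) (w (o4 1)) (w (o4 2)) (w (o4 3)) => w0 w1 w2 w3.
all: move: (mderiv (o4 0) (X (o4 0))) (mderiv (o4 0) (X (o4 1))) (mderiv (o4 0) (X (o4 2))) (mderiv (o4 0) (X (o4 3))) => a00 a01 a02 a03.
all: move: (mderiv (o4 1) (X (o4 0))) (mderiv (o4 1) (X (o4 1))) (mderiv (o4 1) (X (o4 2))) (mderiv (o4 1) (X (o4 3))) => a10 a11 a12 a13.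
all: move: (mderiv (o4 2) (X (o4 0))) (mderiv (o4 2) (X (o4 1))) (mderiv (o4 2) (X (o4 2))) (mderiv (o4 2) (X (o4 3))) => a20 a21 a22 a23.
all: move: (mderiv (o4 3) (X (o4 0))) (mderiv (o4 3) (X (o4 1))) (mderiv (o4 3) (X (o4 2))) (mderiv (o4 3) (X (o4 3))) => a30 a31 a32 a33.
all: move: (X (o4 0)) (X (o4 1)) (X (o4 2)) (X (o4 3)) (S (o4 0)) (S (o4 1)) (S (o4 2)) (S (o4 3)) => x0 x1 x2 x3 s0 s1 s2 s3.
all: ring.
Qed.

End Restricted.

Section Transport.
Variable C : numClosedFieldType.
Variables (M : 'I_5 -> 'I_5 -> C) (dM : 'I_5 -> 'I_5 -> 'I_5 -> C) (y : 'rV[C]_5) (d : C).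
Hypotheses (MN : forall i j, M j i = - M i j) (dMN : forall k i j, dM k j i = - dM k i j).
Hypotheses (My : forall w, bil M y w = 0)
  (dMy : forall t w, der dM t y w = - bil M t w)
  (yd : forall u w, der dM y u w = d * bil M u w) (ymax : y 0 ord_max = 1).

Definition good (u : 'rV[C]_5) := u = y \/ exists k : 'I_4, u = delta_mx 0 (w4 k).

(** As [y] has last coordinate 1, it spans C^5 together with the first four basis vectors. *)
Lemma good_eq0 F : lin F -> (forall u, good u -> F u = 0) -> forall u, F u = 0.
Proof.
move=> lF F0; apply: lin_eq0 => // i; have Fw k : F (delta_mx 0 (w4 k)) = 0.
  by apply: F0; right; exists k.
have [->|[k ->]] := ord5P i; last exact: Fw.
have := F0 y (or_introl erefl); rewrite lin_sum // (bigD1 ord_max) //= ymax mul1r.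
rewrite big1 ?addr0 // => j jm; have [E|[k ->]] := ord5P j; first by rewrite E eqxx in jm.
by rewrite Fw mulr0.
Qed.

Let bilMN u w : bil M w u = - bil M u w. Proof. exact: bilN. Qed.
Let My' w : bil M w y = 0. Proof. by rewrite bilMN My oppr0. Qed.
Let dMN' t u w : der dM t w u = - der dM t u w. Proof. exact: derN. Qed.

(** i_R d Om = (d + 2) Om: Cartan's formula, Euler's identity and i_R Om = 0. *)
Let ext_y1 u w : ext dM y u w = (d + 2) * bil M u w.
Proof. by rewrite /ext yd !dMy (bilMN u w); ring. Qed.
Let ext12 u w z : ext dM w u z = - ext dM u w z.
Proof. by rewrite /ext (dMN' z u w); ring. Qed.
Let ext23 u w z : ext dM u z w = - ext dM u w z.
Proof. by rewrite /ext (dMN' u w z); ring. Qed.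
Let ext_y2 u w : ext dM u y w = - (d + 2) * bil M u w.
Proof. by rewrite ext12 ext_y1 mulNr. Qed.
Let ext_y3 u w : ext dM u w y = (d + 2) * bil M u w.
Proof. by rewrite ext23 ext_y2 mulNr opprK. Qed.

(** Inserting [y] kills the expression since i_y M = 0. Otherwise it is alternating in four vectors
    out of four, so a single value decides. *)
Lemma plv_transport :
  plv M (delta_mx 0 (w4 (o4 0))) (delta_mx 0 (w4 (o4 1)))
        (delta_mx 0 (w4 (o4 2))) (delta_mx 0 (w4 (o4 3))) = 0 ->
  forall u1 u2 u3 u4, plv M u1 u2 u3 u4 = 0.
Proof.
move=> pl0; apply: (plv_eq0 good_eq0) => u1 u2 u3 u4 g1 g2 g3 g4.
case: g1 => [->|[a ->]]; first by rewrite /plv !My; ring.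
case: g2 => [->|[b ->]]; first by rewrite /plv !(My, My'); ring.
case: g3 => [->|[c ->]]; first by rewrite /plv !(My, My'); ring.
case: g4 => [->|[e ->]]; first by rewrite /plv !(My, My'); ring.
move: a b c e; pose D k := delta_mx 0 (w4 k) : 'rV[C]_5.
have bilD0 k : bil M (D k) (D k) = 0.
  by apply/eqP; rewrite -eqNr -bilMN.
apply: alternating4_eq0 => /=; rewrite -/(D _) /plv.
- by move=> i j k l; rewrite (bilMN (D i) (D j)); ring.
- by move=> i k l; rewrite bilD0; ring.
- by move=> i j k l; rewrite (bilMN (D j) (D k)); ring.
- by move=> i j k; rewrite bilD0; ring.
- by move=> i j k l; rewrite (bilMN (D k) (D l)); ring.
- by move=> i j k; rewrite bilD0; ring.
move=> i j k l ij jk kl; have [i0 j1 k2 l3] : [/\ i = o4 0, j = o4 1, k = o4 2 & l = o4 3].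
  have := ltn_ord l; split; apply/val_inj; rewrite val_o4 //=; lia.
by rewrite i0 j1 k2 l3.
Qed.

(** Inserting [y] for [v] gives 0, and inserting it for another argument gives a multiple of the
    Plücker expression by [ext_y1]. The remaining arguments are alternating among four basis
    vectors. *)
Lemma frv_transport : (forall u1 u2 u3 u4, plv M u1 u2 u3 u4 = 0) ->
  (forall v : 'I_4, frv M dM (delta_mx 0 (w4 v))
     (delta_mx 0 (w4 (o4 0))) (delta_mx 0 (w4 (o4 1)))
     (delta_mx 0 (w4 (o4 2))) (delta_mx 0 (w4 (o4 3))) = 0) ->
  forall v u1 u2 u3 u4, frv M dM v u1 u2 u3 u4 = 0.
Proof.
move=> pl fr0; apply: (frv_eq0 good_eq0) => v u1 u2 u3 u4 g0 g1 g2 g3 g4.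
case: g0 => [->|[f ->]]; first by rewrite /frv !My; ring.
have frN k (x1 x2 x3 : 'rV[C]_5) : - k * plv M (delta_mx 0 (w4 f)) x1 x2 x3 = 0.
  by rewrite pl mulr0.
case: g1 => [->|[a ->]].
  by rewrite /frv !(ext_y1, My') -[RHS](frN (d + 2) u2 u3 u4) /plv; ring.
case: g2 => [->|[b ->]].
  rewrite /frv !(ext_y1, ext_y2, My') -[RHS](frN (- (d + 2)) (delta_mx 0 (w4 a)) u3 u4) /plv; ring.
case: g3 => [->|[c ->]].
  rewrite /frv !(ext_y2, ext_y3, My').
  rewrite -[RHS](frN (d + 2) (delta_mx 0 (w4 a)) (delta_mx 0 (w4 b)) u4) /plv; ring.
case: g4 => [->|[e ->]].
  rewrite /frv !(ext_y3, My').
  rewrite -[RHS](frN (- (d + 2)) (delta_mx 0 (w4 a)) (delta_mx 0 (w4 b)) (delta_mx 0 (w4 c))).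
  by rewrite /plv; ring.
move: a b c e; pose D k := delta_mx 0 (w4 k) : 'rV[C]_5.
have z1 u w : ext dM u u w = 0 by apply/eqP; rewrite -eqNr -ext12.
have z2 u w : ext dM u w w = 0 by apply/eqP; rewrite -eqNr -ext23.
apply: alternating4_eq0 => /=; rewrite -/(D _) /frv.
- by move=> i j k l; rewrite (ext12 (D i) (D j) (D k)) (ext12 (D i) (D j) (D l)); ring.
- by move=> i k l; rewrite !z1; ring.
- by move=> i j k l; rewrite (ext12 (D j) (D k) (D l)) (ext23 (D i) (D j) (D k)); ring.
- by move=> i j k; rewrite !(z1, z2); ring.
- by move=> i j k l; rewrite (ext23 (D j) (D k) (D l)) (ext23 (D i) (D k) (D l)); ring.
- by move=> i j k; rewrite !z2; ring.
move=> i j k l ij jk kl; have [i0 j1 k2 l3] : [/\ i = o4 0, j = o4 1, k = o4 2 & l = o4 3].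
  have := ltn_ord l; split; apply/val_inj; rewrite val_o4 //=; lia.
by rewrite i0 j1 k2 l3; apply: fr0.
Qed.

End Transport.

Section Base.
Variables (C : numClosedFieldType) (p q r s : nat) (lam : int).
Implicit Types (Om : form 5 {mpoly C[5]}) (B : 'M[C]_5).
Local Notation S := (diagonal_field C p q r s).

(** A linear space of forms: integrability and the codimension of the singular set are left out, the
    former because it follows ([base_plucker], [base_frob]), the latter because it is only an open
    condition. *)
Definition base Om := [/\ is_kform 2 Om, forall I, Om I \is homog 4, radial0 Om &
  exists X : 'I_4 -> {mpoly C[4]},
   (forall i, bracket S X i = lam%:~R *: X i) /\
   forall k l, comp_mpoly (emb C) (ent Om (w4 k) (w4 l)) =
     ent (contraction S (contraction X (volume 4 _))) k l].

Lemma mderiv_diagonal i j : mderiv j (S i) =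
  if j == i then mpolyC 4 (tnth [tuple p; q; r; s] i)%:R else 0.
Proof.
rewrite mderivZ mderivX mnm1E; case: (eqVneq i j) => [->|ij]; last by rewrite scale0r scaler0.
have -> : mnm_sub (mnm1 j) (mnm1 j) = @mnm0 4.
  by apply/mnmP => h; rewrite mnmBE subnn mnm0E.
by rewrite scale1r mpolyX0 alg_mpolyC.
Qed.

(** The derivative of the identity sum_i x_i Om_ij = 0 along x_k. *)
Lemma radial_deriv Om y t w : radial0 Om ->
  der (dMat Om y) t y w = - bil (Mat Om y) t w.
Proof.
move=> R0; apply/eqP; rewrite -addr_eq0; apply/eqP.
pose F t := der (dMat Om y) t y w + bil (Mat Om y) t w.
apply: (lin_eq0 (F := F)) => [a u v|k]; first by rewrite /F der_lin1 bil_linl; ring.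
pose G w := der (dMat Om y) (delta_mx 0 k) y w + bil (Mat Om y) (delta_mx 0 k) w.
apply: (lin_eq0 (F := G)) => [a u v|j]; first by rewrite /G der_lin3 bil_linr; ring.
rewrite /G (lin_sum _ (der_lin2 _ _ _)) bil_delta.
have P0 : \sum_i 'X_i * ent Om i j = 0.
  apply: eval_at_inj => x; rewrite eval_at0 eval_at_sum -[RHS](R0 x (delta_mx 0 j)).
  rewrite (lin_sum _ (bil_linl _ _)); apply: eq_bigr => i _.
  by rewrite bil_delta eval_atM eval_atXU.
have := congr1 (fun P => eval_at y (mderiv k P)) P0.
rewrite mderiv0 eval_at0 raddf_sum eval_at_sum /= => dP0; rewrite -[RHS]dP0.
under [RHS]eq_bigr => i _ do rewrite mderivM eval_atD !eval_atM eval_atXU.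
rewrite big_split /= addrC; congr (_ + _).
  by apply: eq_bigr => i _; rewrite der_delta.
rewrite (bigD1 k) //= mderivX mnm1E eqxx scale1r.
have -> : mnm_sub (mnm1 k) (mnm1 k) = @mnm0 5.
  by apply/mnmP => h; rewrite mnmBE subnn mnm0E.
rewrite mpolyX0 -(mpolyC1 5 C) eval_atC mul1r big1 ?addr0 // => i /negPf ik.
by rewrite mderivX mnm1E ik scale0r eval_at0 mul0r.
Qed.

Lemma euler_deriv Om y u w : (forall I, Om I \is homog 4) ->
  der (dMat Om y) y u w = 4%:R * bil (Mat Om y) u w.
Proof.
move=> Om4; rewrite /der /bil mulr_sumr.
under eq_bigr => k _ do rewrite mulr_sumr.
rewrite exchange_big; apply: eq_bigr => i _ /=; rewrite mulr_sumr.
under eq_bigr => k _ do rewrite mulr_sumr.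
rewrite exchange_big; apply: eq_bigr => j _ /=.
have := congr1 (eval_at y) (euler (ent_homog i j Om4)).
rewrite eval_at_sum eval_atZ -/(Mat Om y i j) => E.
rewrite mulrCA -E mulr_sumr; apply: eq_bigr => k _.
by rewrite eval_atM eval_atXU /dMat; ring.
Qed.

(** At a point of the hyperplane x_5 = 1 the relations on the first four basis vectors are those of
    i_S i_X nu_4; radial contraction and homogeneity transport them to all vectors. *)
Lemma base_vector Om (y : 'rV[C]_5) : base Om -> y 0 ord_max = 1 ->
  (forall u1 u2 u3 u4, plv (Mat Om y) u1 u2 u3 u4 = 0) /\
  (forall v u1 u2 u3 u4, frv (Mat Om y) (dMat Om y) v u1 u2 u3 u4 = 0).
Proof.
move=> [Om2 Om4 R0 [X [br XE]]] ymax.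
pose z := \row_k y 0 (w4 k); have yz : y = pt z.
  have [pm pk] := ptE z; apply/rowP => i.
  by have [->|[k ->]] := ord5P i; rewrite ?pm ?pk // mxE.
have ME k l : Mat Om y (w4 k) (w4 l) =
    eval_at z (ent (contraction S (contraction X (volume 4 _))) k l).
  by rewrite -XE eval_emb -yz.
have dME h k l : dMat Om y (w4 h) (w4 k) (w4 l) =
    eval_at z (mderiv h (ent (contraction S (contraction X (volume 4 _))) k l)).
  by rewrite -XE mderiv_emb eval_emb -yz.
have MN := MatN Om y; have dMN := dMatN Om y.
have plyv : forall u1 u2 u3 u4, plv (Mat Om y) u1 u2 u3 u4 = 0.
  apply: (plv_transport (y := y)) => //; rewrite /plv !bil_delta !ME.
  by rewrite -!eval_atM -eval_atB -eval_atD plucker_restricted eval_at0.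
split=> //; apply: (frv_transport (y := y) (d := 4%:R)) => //.
- by move=> t w; apply: radial_deriv.
- by move=> u w; apply: euler_deriv.
move=> v; rewrite /frv /ext !bil_delta !der_delta !ME !dME.
have := congr1 (eval_at z) (frob_restricted v mderiv_diagonal br).
move: (contraction S _) => om {XE ME dME}.
by rewrite /frobp /dent !(eval_atB, eval_atD, eval_atM) eval_at0.
Qed.

(* Homogeneity extends identities from the hyperplane [x_5 = 1]. *)
Lemma eq0_off_hyperplane d (P : {mpoly C[5]}) : P \is homog d ->
  (forall y : 'rV[C]_5, y 0 ord_max = 1 -> eval_at y P = 0) -> P = 0.
Proof.
move=> Pd P0; have /eqP : 'X_ord_max * P = 0; last first.
  rewrite mulf_eq0 => /orP[/eqP X0|/eqP //].
  have := congr1 (eval_at (const_mx 1)) X0; rewrite eval_atXU mxE eval_at0 => /eqP.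
  by rewrite oner_eq0.
apply: eval_at_inj => x; rewrite eval_atM eval_atXU eval_at0.
have [->|x0] := eqVneq (x 0 ord_max) 0; first by rewrite mul0r.
have -> : x = x 0 ord_max *: ((x 0 ord_max)^-1 *: x) by rewrite scalerA divff // scale1r.
by rewrite (eval_homog _ _ Pd) P0 ?mulr0 // mxE mulVf.
Qed.

Lemma base_plucker Om : base Om -> plucker Om.
Proof.
move=> bOm i j k l; have [_ Om4 _ _] := bOm.
have h a b : ent Om a b \is homog 4 by apply: ent_homog.
apply: (@eq0_off_hyperplane (4 + 4)) => [|y ymax].
  by rewrite rpredD ?rpredB //; apply: dhomogM.
have [pl _] := base_vector bOm ymax.
have := pl (delta_mx 0 i) (delta_mx 0 j) (delta_mx 0 k) (delta_mx 0 l).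
by rewrite /plv !bil_delta /Mat -!eval_atM -eval_atB -eval_atD.
Qed.

Lemma base_frob Om : base Om -> frob Om.
Proof.
move=> bOm v i j k l; have [_ Om4 _ _] := bOm.
have h a b : ent Om a b \is homog 4 by apply: ent_homog.
have dh a b c : dent Om a b c \is homog 3.
  by rewrite rpredD ?rpredB //; apply: mderiv_homog.
apply: (@eq0_off_hyperplane (4 + 3)) => [|y ymax].
  have hM a b c e f : ent Om a b * dent Om c e f \is homog (4 + 3) by apply: dhomogM.
  by apply: rpredB => //; apply: rpredD => //; apply: rpredB.
have [_ fr] := base_vector bOm ymax.
have := fr (delta_mx 0 v) (delta_mx 0 i) (delta_mx 0 j) (delta_mx 0 k) (delta_mx 0 l).
rewrite /frv /ext !bil_delta !der_delta /Mat /dMat.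
by rewrite /frobp /dent !(eval_atB, eval_atD, eval_atM).
Qed.

End Base.

(** * Codimension of the singular set *)

(** Leading coefficients that survive keep the sizes, hence the shape of the Sylvester matrix. *)
Lemma resultant_map (aR rR : nzRingType) (f : {rmorphism aR -> rR}) (p q : {poly aR}) :
  f (lead_coef p) != 0 -> f (lead_coef q) != 0 ->
  f (resultant p q) = resultant (map_poly f p) (map_poly f q).
Proof.
move=> nz_fp nz_fq; rewrite /resultant /Sylvester_mx !size_map_poly_id0 //.
rewrite -det_map_mx /= map_col_mx; congr (\det (col_mx _ _));
  by apply: map_lin1_mx => v; rewrite map_poly_rV rmorphM /= map_rVpoly.
Qed.

Section Lines.
Variables (C : numClosedFieldType) (n : nat).

(** The restriction of [f] to the line w + X v. Base point and direction lie in a ring [R], so that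
    they may depend on a parameter or on indeterminates. *)
Definition line (R : comNzRingType) (io : C -> R) (w v : 'I_n -> R) (f : {mpoly C[n]}) : {poly R} :=
  mmap (polyC \o io) (fun j => (w j)%:P + v j *: 'X) f.

Section OneRing.
Variables (R : comNzRingType) (io : {rmorphism C -> R}) (w v : 'I_n -> R).

Lemma lineD f g : line io w v (f + g) = line io w v f + line io w v g.
Proof. exact: rmorphD. Qed.

Lemma lineZ c f : line io w v (c *: f) = io c *: line io w v f.
Proof. by rewrite /line mmapZ /= mul_polyC. Qed.

Lemma coef_prod_affine (m : multinom n) (r : seq 'I_n) :
  let P := \prod_(j <- r) ((w j)%:P + v j *: 'X) ^+ m j in
  (size P <= (\sum_(j <- r) m j).+1)%N /\
  P`_(\sum_(j <- r) m j) = \prod_(j <- r) v j ^+ m j.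
Proof.
elim: r => [|j r [IHs IHc]] /=; first by rewrite !big_nil size_poly1 coef1.
rewrite !big_cons; set Q := \prod_(j <- r) _ in IHs IHc *.
set e := (\sum_(j <- r) m j)%N in IHs IHc *.
elim: (m j) => [|k [IHs' IHc']]; first by rewrite expr0 mul1r expr0 mul1r.
rewrite exprS -mulrA; set T := _ ^+ k * Q in IHs' IHc' *.
have -> : ((w j)%:P + v j *: 'X) * T = (w j) *: T + v j *: (T * 'X).
  by rewrite mulrDl mul_polyC -scalerAl ['X * T]mulrC.
split.
  rewrite (leq_trans (size_polyD _ _)) // geq_max.
  rewrite (leq_trans (size_scale_leq _ _)) ?(leq_trans IHs') //=.
  rewrite (leq_trans (size_scale_leq _ _)) // (leq_trans (size_polyMleq _ _)) //.
  by rewrite size_polyX addn2 /= ltnS.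
rewrite coefD !coefZ coefMX addSn /= IHc' nth_default ?mulr0 ?add0r //.
by rewrite exprS mulrA.
Qed.

Lemma line_homog d f : f \is homog d ->
  (size (line io w v f) <= d.+1)%N /\ (line io w v f)`_d = mmap io v f.
Proof.
move=> /dhomogP fd; rewrite /line /mmap !big_seq; split.
  apply: (big_ind (fun p : {poly R} => (size p <= d.+1)%N)); first by rewrite size_poly0.
    by move=> p q ps qs; rewrite (leq_trans (size_polyD _ _)) // geq_max ps.
  move=> m /fd /= <-; rewrite mul_polyC (leq_trans (size_scale_leq _ _)) // mdegE.
  by have [] := coef_prod_affine m (index_enum _).
rewrite coef_sum; apply: eq_bigr => m /fd /= <-; rewrite coefCM mdegE.
by have [_ ->] := coef_prod_affine m (index_enum _).
Qed.

Lemma lead_line d f : f \is homog d -> mmap io v f != 0 ->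
  lead_coef (line io w v f) = mmap io v f.
Proof.
move=> fd fv; have [s c] := line_homog fd.
rewrite lead_coefE; suff -> : size (line io w v f) = d.+1 by [].
apply/eqP; rewrite eqn_leq s ltnNge; apply: contraNN fv => sd.
by rewrite -c nth_default.
Qed.

End OneRing.

Lemma map_line (R R' : comNzRingType) (io : {rmorphism C -> R}) (io' : {rmorphism C -> R'})
    (phi : {rmorphism R -> R'}) (w v : 'I_n -> R) f : (forall c, phi (io c) = io' c) ->
  map_poly phi (line io w v f) = line io' (phi \o w) (phi \o v) f.
Proof.
move=> pio; rewrite /line; elim/mpoly_ring_ind: f => [c|j|p q Pp Pq|p q Pp Pq].
- by rewrite !mmapC /= map_polyC /= pio.
- by rewrite !mmapX !mmap1U rmorphD /= map_polyC /= map_polyZ map_polyX.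
- by rewrite !mmapD rmorphD /= Pp Pq.
- by rewrite !rmorphM /= Pp Pq.
Qed.

Lemma mmap_comp (R R' : comNzRingType) (io : {rmorphism C -> R}) (io' : {rmorphism C -> R'})
    (phi : {rmorphism R -> R'}) (v : 'I_n -> R) f : (forall c, phi (io c) = io' c) ->
  phi (mmap io v f) = mmap io' (phi \o v) f.
Proof.
move=> pio; elim/mpoly_ring_ind: f => [c|j|p q Pp Pq|p q Pp Pq].
- by rewrite !mmapC pio.
- by rewrite !mmapX !mmap1U.
- by rewrite !mmapD rmorphD /= Pp Pq.
- by rewrite !rmorphM /= Pp Pq.
Qed.

Definition lineC (w v : 'rV[C]_n) (f : {mpoly C[n]}) : {poly C} :=
  line (R := C) idfun (fun j => w 0 j) (fun j => v 0 j) f.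

Lemma horner_lineC w v f s : (lineC w v f).[s] = eval_at (w + s *: v) f.
Proof.
rewrite /lineC /line; elim/mpoly_ring_ind: f => [c|j|p q Pp Pq|p q Pp Pq].
- by rewrite mmapC hornerC eval_atC.
- by rewrite mmapX mmap1U eval_atXU !mxE !hornerE mulrC.
- by rewrite mmapD hornerD eval_atD Pp Pq.
- by rewrite rmorphM hornerM eval_atM Pp Pq.
Qed.

Lemma resultantP (p q : {poly C}) : p != 0 ->
  resultant p q != 0 <-> forall s, ~ (p.[s] = 0 /\ q.[s] = 0).
Proof.
move=> p0; rewrite resultant_eq0 -leqNgt.
have -> : (size (gcdp p q) <= 1)%N = coprimep p q.
  rewrite coprimep_def eqn_leq [(0 < _)%N]lt0n size_poly_eq0 gcdp_eq0 (negPf p0) andbT //.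
split=> [/Pdiv.ClosedField.coprimepP pq s [ps qs]|pq].
  by have /eqP := pq s (introT eqP ps).
apply/Pdiv.ClosedField.coprimepP => s /eqP ps; apply/eqP => qs.
by apply: (pq s).
Qed.

(* The plane spanned by [v] and [w] meets the common zeros of [f] and [g] in
   the origin only. *)
Definition transverse (f g : {mpoly C[n]}) (v w : 'rV[C]_n) :=
  [/\ eval_at v f != 0, eval_at v g != 0 &
      forall s, ~ (eval_at (w + s *: v) f = 0 /\ eval_at (w + s *: v) g = 0)].

Lemma lead_lineC d f w v : f \is homog d -> eval_at v f != 0 ->
  lead_coef (lineC w v f) = eval_at v f.
Proof. by move=> fd fv; rewrite /lineC (lead_line (io := idfun) _ fd). Qed.

Lemma transverse_resultant d f g v w : f \is homog d -> eval_at v f != 0 ->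
  eval_at v g != 0 ->
  resultant (lineC w v f) (lineC w v g) != 0 <-> transverse f g v w.
Proof.
move=> fd fv gv; rewrite resultantP; last by rewrite -lead_coef_eq0 (lead_lineC _ fd).
split=> [nc|[_ _ nc] s]; last by rewrite !horner_lineC; apply: nc.
by split=> // s; rewrite -!horner_lineC; apply: nc.
Qed.

Section OneParameter.
Variables (d : nat) (F G : {poly {poly C}}) (f g : C -> {mpoly C[n]}) (v : C -> 'rV[C]_n)
  (w : 'rV[C]_n) (t0 : C).
Hypotheses (fd : forall t, f t \is homog d) (gd : forall t, g t \is homog d).
Hypotheses (FE : forall t, map_poly (horner_eval t) F = lineC w (v t) (f t))
  (GE : forall t, map_poly (horner_eval t) G = lineC w (v t) (g t)).
Hypotheses (sF : (size F <= d.+1)%N) (sG : (size G <= d.+1)%N).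

(** Transversality is the nonvanishing of both leading coefficients and of the resultant along the
    line; with the parameter as an indeterminate, their product is a polynomial in t that is nonzero
    at [t0]. *)
Lemma transverse_open : transverse (f t0) (g t0) (v t0) w ->
  exists2 r : {poly C}, r != 0 & forall t, r.[t] != 0 -> transverse (f t) (g t) (v t) w.
Proof.
move=> tr; have [ft gt _] := tr.
have coefE (K : {poly {poly C}}) k t : (forall t, k t \is homog d) ->
    (forall t, map_poly (horner_eval t) K = lineC w (v t) (k t)) ->
    (K`_d).[t] = eval_at (v t) (k t).
  move=> kd KE.
  have [_ E] := line_homog idfun (fun j => w 0 j) (fun j => v t 0 j) (kd t).
  rewrite -[RHS]/(mmap idfun (fun j => v t 0 j) (k t)) -E.
  by rewrite -[line _ _ _ _]/(lineC w (v t) (k t)) -KE coef_map.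
have leadE (K : {poly {poly C}}) k : (forall t, k t \is homog d) ->
    (forall t, map_poly (horner_eval t) K = lineC w (v t) (k t)) ->
    (size K <= d.+1)%N -> eval_at (v t0) (k t0) != 0 -> lead_coef K = K`_d.
  move=> kd KE sK kt; rewrite lead_coefE; suff -> : size K = d.+1 by [].
  apply/eqP; rewrite eqn_leq sK ltnNge; apply: contraNN kt => sd.
  by rewrite -(coefE K k) // nth_default // horner0.
have lF := leadE F f fd FE sF ft; have lG := leadE G g gd GE sG gt.
have res t : eval_at (v t) (f t) != 0 -> eval_at (v t) (g t) != 0 ->
    (resultant F G).[t] = resultant (lineC w (v t) (f t)) (lineC w (v t) (g t)).
  move=> fn gn; rewrite -FE -GE -resultant_map //.
    by move: fn; rewrite -(coefE F f t fd FE) -lF.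
  by move: gn; rewrite -(coefE G g t gd GE) -lG.
exists (F`_d * G`_d * resultant F G).
  apply: contraTneq isT => r0; have := congr1 (fun r : {poly C} => r.[t0]) r0.
  rewrite horner0 !hornerM (coefE _ f) // (coefE _ g) // res // => /eqP.
  rewrite !mulf_eq0 (negPf ft) (negPf gt) /= => /eqP r00.
  by have /(transverse_resultant w (fd t0) ft gt) := tr; rewrite r00 eqxx.
move=> t; rewrite !hornerM !mulf_eq0 !negb_or (coefE _ f) // (coefE _ g) //.
move=> /andP[/andP[fn gn]]; rewrite res // => rn.
exact/(transverse_resultant w (fd t) fn gn).
Qed.

End OneParameter.

Lemma transverse_open_form d f0 g0 f1 g1 v w :
  f0 \is homog d -> g0 \is homog d -> f1 \is homog d -> g1 \is homog d ->
  transverse f0 g0 v w -> exists2 r : {poly C}, r != 0 &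
    forall t, r.[t] != 0 -> transverse (t *: f1 + f0) (t *: g1 + g0) v w.
Proof.
move=> f0d g0d f1d g1d tr.
pose w' (j : 'I_n) : {poly C} := (w 0 j)%:P; pose v' (j : 'I_n) : {poly C} := (v 0 j)%:P.
pose K k0 k1 := ('X : {poly C}) *: line polyC w' v' k1 + line polyC w' v' k0.
have KE k0 k1 t : map_poly (horner_eval t) (K k0 k1) = lineC w v (t *: k1 + k0).
  have h k : map_poly (horner_eval t) (line polyC w' v' k) = lineC w v k.
    rewrite (map_line (io' := idfun)) => [|c]; last exact: hornerC.
    by congr line; apply/funext => j; rewrite /= /horner_eval hornerC.
  rewrite rmorphD /= map_polyZ /= !h /horner_eval hornerX.
  by rewrite /lineC (lineD idfun) (lineZ idfun).
have Ks k0 k1 : k0 \is homog d -> k1 \is homog d -> (size (K k0 k1) <= d.+1)%N.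
  move=> k0d k1d; rewrite (leq_trans (size_polyD _ _)) // geq_max.
  rewrite (leq_trans (size_scale_leq _ _)) /=; first by have [] := line_homog polyC w' v' k0d.
  by have [] := line_homog polyC w' v' k1d.
have trd k0 k1 t : k0 \is homog d -> k1 \is homog d -> t *: k1 + k0 \is homog d.
  by move=> *; rewrite rpredD // dhomogZ.
apply: (transverse_open (d := d) (F := K f0 f1) (G := K g0 g1) (t0 := 0)
  (f := fun t => t *: f1 + f0) (g := fun t => t *: g1 + g0) (v := fun=> v)) => //.
- by move=> t; apply: trd.
- by move=> t; apply: trd.
- exact: Ks.
- exact: Ks.
- by rewrite !scale0r !add0r.
Qed.

Lemma transverse_open_dir d f g v u w : f \is homog d -> g \is homog d ->
  transverse f g v w -> exists2 r : {poly C}, r != 0 &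
    forall t, r.[t] != 0 -> transverse f g (v + t *: u) w.
Proof.
move=> fd gd tr.
pose w' (j : 'I_n) : {poly C} := (w 0 j)%:P.
pose v' (j : 'I_n) : {poly C} := (v 0 j)%:P + u 0 j *: 'X.
have KE k t : map_poly (horner_eval t) (line polyC w' v' k) = lineC w (v + t *: u) k.
  rewrite (map_line (io' := idfun)) => [|c]; last exact: hornerC.
  congr line; apply/funext => j; rewrite /= /horner_eval ?hornerC //.
  by rewrite !mxE !hornerE mulrC.
apply: (transverse_open (d := d) (F := line polyC w' v' f) (G := line polyC w' v' g)
  (t0 := 0) (f := fun=> f) (g := fun=> g) (v := fun t => v + t *: u)) => //.
- by have [] := line_homog polyC w' v' fd.
- by have [] := line_homog polyC w' v' gd.
- by rewrite scale0r addr0.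
Qed.

Definition invariant_under (v : 'rV[C]_n) (H : {mpoly C[n]}) :=
  forall x t, eval_at (x + t *: v) H = eval_at x H.

(* The resultant of [f] and [g] along the lines of direction [v]. *)
Lemma transverse_eliminant d f g v w : f \is homog d.+1 -> g \is homog d.+1 ->
  transverse f g v w -> exists H, [/\ H != 0, invariant_under v H &
    forall x, eval_at x f = 0 -> eval_at x g = 0 -> eval_at x H = 0].
Proof.
move=> fd gd tr; have [fv gv nc] := tr.
have [j0 vj0] : exists j, v 0 j != 0.
  apply: contrapT => nv; have v0 : v = 0 *: v.
    by apply/rowP => j; rewrite scale0r mxE; apply/eqP/negPn/negP => vj; apply: nv; exists j.
  by rewrite v0 (eval_homog _ _ fd) expr0n mul0r eqxx in fv.
(* [pr] projects along [v] onto the hyperplane where the coordinate [j0] vanishes; restricting to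
   the line through [pr x] makes the resultant depend only on the line of direction [v] through
   x. *)
pose c (x : 'rV[C]_n) : C := x 0 j0 / v 0 j0; pose pr (x : 'rV[C]_n) := x - c x *: v.
have prD x t : pr (x + t *: v) = pr x.
  by apply/rowP => j; rewrite !mxE /c !mxE; field.
pose ev (x : 'rV[C]_n) : {rmorphism {mpoly C[n]} -> C} := meval (fun i => x 0 i).
pose cX : {mpoly C[n]} := (v 0 j0)^-1 *: 'X_j0.
pose W j : {mpoly C[n]} := 'X_j - v 0 j *: cX; pose V j := mpolyC n (v 0 j).
have ev_line x k : map_poly (ev x) (line (@mpolyC n C) W V k) = lineC (pr x) v k.
  rewrite (map_line (io' := idfun)) => [|a]; last exact: mevalC.
  congr line; apply/funext => j; last exact: mevalC.
  by rewrite /W /= mevalB mevalXU !mxE !mevalZ mevalXU /c; ring.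
pose H := resultant (line (@mpolyC n C) W V f) (line (@mpolyC n C) W V g).
have lead x k : k \is homog d.+1 -> eval_at v k != 0 ->
    ev x (lead_coef (line (@mpolyC n C) W V k)) = eval_at v k.
  move=> kd kv; have E y : ev y (mmap (@mpolyC n C) V k) = eval_at v k.
    rewrite (mmap_comp (io' := idfun)) => [|a]; last exact: mevalC.
    by rewrite /eval_at /meval; congr mmap; apply/funext => j; rewrite /= mevalC.
  rewrite (lead_line (io := @mpolyC n C) _ kd) ?E //.
  by apply: contraNneq kv => k0; rewrite -(E x) k0 rmorph0.
have HE x : eval_at x H = resultant (lineC (pr x) v f) (lineC (pr x) v g).
  by rewrite -!ev_line -[LHS]/(ev x H) -(resultant_map (f := ev x)) ?lead.
exists H; split.
- apply: contraTneq isT => H0.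
  have : resultant (lineC (pr w) v f) (lineC (pr w) v g) != 0.
    apply/(transverse_resultant _ fd fv gv); split=> // s.
    have -> : pr w + s *: v = w + (s - c w) *: v.
      by rewrite /pr scalerBl addrAC addrA.
    exact: nc.
  by rewrite -HE H0 eval_at0 eqxx.
- by move=> x t; rewrite !HE prD.
move=> x fx gx; rewrite HE; apply/eqP/negPn/negP.
move=> /(transverse_resultant _ fd fv gv)[_ _ /(_ (c x))].
by rewrite /pr subrK; apply.
Qed.

End Lines.

(** * The codimension criterion *)

Section Codim.
Variables (C : numClosedFieldType) (n : nat).
Implicit Types (Y Z : set 'rV[C]_n) (v x y : 'rV[C]_n).

Definition eliminable Z v := exists H : {mpoly C[n]},
  [/\ H != 0, invariant_under v H & forall x, Z x -> eval_at x H = 0].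

(* The only nonempty set invariant under all directions along which [Z] has a
   proper projection is the whole space. *)
Definition thin Z := forall Y, (exists y, Y y) ->
  (forall v, eliminable Z v -> forall x t, Y x -> Y (x + t *: v)) -> forall x, Y x.

Lemma neq0_eval (H : {mpoly C[n]}) : H != 0 -> exists x, eval_at x H != 0.
Proof.
move=> H0; apply: contrapT => nx; move/eqP: H0; apply; apply: eval_at_inj => x.
by rewrite eval_at0; apply/eqP/negPn/negP => Hx; apply: nx; exists x.
Qed.

Lemma setT_irreducible : irreducible (@zariski_closed C n) classical_sets.setT.
Proof.
split=> [|A B [E ->] [F ->] AB]; first by exists 0.
apply: contrapT => /not_orP[nA nB].
have [P EP P0] : exists2 P, E P & P != 0.
  apply: contrapT => nP; apply: nA => x _ P EP; have [->|P0] := eqVneq P 0.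
    by rewrite eval_at0.
  by case: nP; exists P.
have [Q FQ Q0] : exists2 Q, F Q & Q != 0.
  apply: contrapT => nQ; apply: nB => x _ Q FQ; have [->|Q0] := eqVneq Q 0.
    by rewrite eval_at0.
  by case: nQ; exists Q.
have /neq0_eval[x] : P * Q != 0 by rewrite mulf_neq0.
rewrite eval_atM mulf_eq0 negb_or => /andP[Px Qx].
case: (AB x I) => [HA|HB].
  by move: Px; rewrite (HA P EP) eqxx.
by move: Qx; rewrite (HB Q FQ) eqxx.
Qed.

Lemma setT_closed : zariski_closed (classical_sets.setT : set 'rV[C]_n).
Proof. by exists classical_sets.set0; apply/seteqP; split=> // x _ P []. Qed.

Definition shift_mpoly (v : 'rV[C]_n) (P : {mpoly C[n]}) : {mpoly C[n]} :=
  comp_mpoly [tuple 'X_i + mpolyC n (v 0 i) | i < n] P.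

Lemma eval_shift v P x : eval_at x (shift_mpoly v P) = eval_at (x + v) P.
Proof.
rewrite /eval_at comp_mpoly_meval; apply: meval_eq => i.
by rewrite tnth_mktuple mevalD mevalXU mevalC mxE.
Qed.

(** The Zariski closure of Y + C v. *)
Definition sweep Y v : set 'rV[C]_n := [set x | forall P : {mpoly C[n]},
  (forall y t, Y y -> eval_at (y + t *: v) P = 0) -> eval_at x P = 0]%classic.

Lemma sweep_closed Y v : zariski_closed (sweep Y v).
Proof.
by exists [set P | forall y t, Y y -> eval_at (y + t *: v) P = 0]%classic.
Qed.

Lemma eval_line_poly x v (P : {mpoly C[n]}) :
  exists p : {poly C}, forall t, p.[t] = eval_at (x + t *: v) P.
Proof. by exists (lineC x v P) => t; rewrite horner_lineC. Qed.

(** If P * Q vanishes on the lines of direction [v] through Y, then on each such line P or Q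
    vanishes identically, being polynomials in t. The points whose whole line annihilates P form a
    closed set, so irreducibility of Y selects one of P and Q for all lines. *)
Lemma sweep_irreducible Y v : irreducible (@zariski_closed C n) Y ->
  irreducible (@zariski_closed C n) (sweep Y v).
Proof.
move=> [[y0 Yy0] Yirr]; split=> [|A B [E AE] [F BF] AB].
  by exists y0 => P P0; have := P0 y0 0 Yy0; rewrite scale0r addr0.
apply: contrapT => /not_orP[nA nB].
have ex (D : set {mpoly C[n]}) (G : set 'rV[C]_n) : G = [set x | forall P, D P -> eval_at x P = 0]%classic ->
    ~ (sweep Y v `<=` G)%classic ->
    exists P, D P /\ exists y t, Y y /\ eval_at (y + t *: v) P != 0.
  move=> -> nG; apply: contrapT => nP; apply: nG => x sx P DP; apply: sx => y t Yy.
  by apply/eqP/negPn/negP => Py; apply: nP; exists P; split=> //; exists y, t.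
have [P [EP [y1 [t1 [Y1 P1]]]]] := ex E A AE nA.
have [Q [FQ [y2 [t2 [Y2 Q2]]]]] := ex F B BF nB.
pose cl (P : {mpoly C[n]}) := [set y | forall t, eval_at (y + t *: v) P = 0]%classic.
have cl_closed K : zariski_closed (cl K).
  exists [set L | exists t, L = shift_mpoly (t *: v) K]%classic; apply/seteqP; split=> y /=.
    by move=> Ky _ [t ->]; rewrite eval_shift.
  by move=> Ky t; rewrite -eval_shift; apply: Ky; exists t.
have [] := Yirr _ _ (cl_closed P) (cl_closed Q).
- move=> y Yy; have [p pE] := eval_line_poly y v P; have [q qE] := eval_line_poly y v Q.
  have /eqP : p * q = 0.
    apply: poly_eq0_horner => t; rewrite hornerM pE qE.
    have : (A `|` B)%classic (y + t *: v) by apply: AB => L; apply.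
    by rewrite AE BF => -[/= /(_ P EP) ->|/= /(_ Q FQ) ->]; rewrite ?mul0r ?mulr0.
  rewrite mulf_eq0 => /orP[] /eqP z0; [left|right] => t.
    by rewrite -pE z0 horner0.
  by rewrite -qE z0 horner0.
- by move=> /(_ y1 Y1 t1) E1; rewrite E1 eqxx in P1.
- by move=> /(_ y2 Y2 t2) E2; rewrite E2 eqxx in Q2.
Qed.

(** The chain is Y, its sweep, the whole space. As Y is not everything, some eliminable direction
    [v] moves it, so the sweep is strictly larger; the eliminant of [v] vanishes on Y and is
    invariant under [v], so the sweep is not everything. *)
Lemma thin_codim_ge2 Z : thin Z -> (exists x, ~ Z x) -> codim_ge (@zariski_closed C n) 2 Z.
Proof.
move=> thinZ [x1 nZx1] Y clY irrY YZ.
have [v [Zv [x0 [t0 [Yx0 nY]]]]] : exists v, eliminable Z v /\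
    exists x t, Y x /\ ~ Y (x + t *: v).
  apply: contrapT => nv; apply: nZx1; apply: YZ; apply: thinZ.
    by have [[y Yy] _] := irrY; exists y.
  move=> v Zv x t Yx; apply: contrapT => nYx; apply: nv.
  by exists v; split=> //; exists x, t.
have subY : (Y `<=` sweep Y v)%classic.
  by move=> y Yy P P0; have := P0 y 0 Yy; rewrite scale0r addr0.
exists (fun i => if i is 0%N then Y else if i is 1%N then sweep Y v else classical_sets.setT).
split=> // [[|[|i]] _|[|[|i]]] //.
- by split; [exact: sweep_closed|exact: sweep_irreducible].
- by split; [exact: setT_closed|exact: setT_irreducible].
- move=> _; split=> // sY; apply: nY; apply: sY => P; exact.
move=> _; split=> // Ts; have [H [/neq0_eval[x Hx] Hv HZ]] := Zv.
have Hx0 := Ts x I H (fun y t Yy => etrans (Hv y t) (HZ y (YZ y Yy))).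
by rewrite Hx0 eqxx in Hx.
Qed.

End Codim.

(** * The family as pullbacks of a linear space of forms *)

Section Family.
Variables (C : numClosedFieldType) (p q r s : nat) (lam : int).
Implicit Types (Om : form 5 {mpoly C[5]}) (A B : 'M[C]_5) (v w x : 'rV[C]_5).
Local Notation S := (diagonal_field C p q r s).
Local Notation base := (base (C := C) p q r s lam).

Lemma entD (c : C) Om1 Om2 i j : ent (c *: Om1 + Om2) i j = c *: ent Om1 i j + ent Om2 i j.
Proof. by apply: eval_at_inj => x; rewrite eval_atD eval_atZ; apply: MatD. Qed.

Lemma contractionD n (c : C) (Z : 'I_n -> {mpoly C[n]}) (al be : form n {mpoly C[n]}) :
  contraction Z (c *: al + be) = c *: contraction Z al + contraction Z be.
Proof.
apply/ffunP => K; rewrite !ffunE scaler_sumr -big_split; apply: eq_bigr => i _ /=.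
by rewrite !ffunE !mulrDr !scalerAr.
Qed.

Lemma contractionDl n (c : C) (Z1 Z2 : 'I_n -> {mpoly C[n]}) (al : form n {mpoly C[n]}) :
  contraction (fun i => c *: Z1 i + Z2 i) al = c *: contraction Z1 al + contraction Z2 al.
Proof.
apply/ffunP => K; rewrite !ffunE scaler_sumr -big_split; apply: eq_bigr => i _ /=.
by rewrite mulrDl mulrDr -!(scalerAl, scalerAr).
Qed.

Lemma baseD c Om1 Om2 : base Om1 -> base Om2 -> base (c *: Om1 + Om2).
Proof.
move=> [k1 h1 r1 [X1 [b1 E1]]] [k2 h2 r2 [X2 [b2 E2]]]; split.
- by move=> I I2; rewrite !ffunE k1 // k2 // scaler0 addr0.
- by move=> I; rewrite !ffunE rpredD // dhomogZ.
- move=> x; apply: lin_eq0 => [|j]; first exact: bil_linr.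
  rewrite (lin_sum _ (bil_linl _ _)).
  under eq_bigr => i _ do rewrite bil_delta MatD mulrDr mulrCA.
  rewrite big_split -mulr_sumr /=.
  have E Om : radial0 Om -> \sum_i x 0 i * Mat Om x i j = 0.
    move=> R0; rewrite -[RHS](R0 x (delta_mx 0 j)) (lin_sum _ (bil_linl _ _)).
    by apply: eq_bigr => i _; rewrite bil_delta.
  by rewrite !E // mulr0 addr0.
exists (fun i => c *: X1 i + X2 i); split=> [i|k l].
  rewrite scalerDr scalerA mulrC -scalerA -b1 -b2 /bracket scaler_sumr -big_split.
  apply: eq_bigr => j _ /=; rewrite mderivD mderivZ mulrDr mulrDl.
  rewrite -!mul_mpolyC; ring.
rewrite contractionDl contractionD entD comp_mpolyD comp_mpolyZ E1 E2.
have entD4 (al be : form 4 {mpoly C[4]}) : ent (c *: al + be) k l = c *: ent al k l + ent be k l.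
  rewrite /ent; case: ltngtP => _; rewrite ?ffunE ?scaler0 ?addr0 //.
  by rewrite opprD scalerN.
by rewrite entD4.
Qed.

Lemma base0 : base 0.
Proof.
split.
- by move=> I _; rewrite ffunE.
- by move=> I; rewrite ffunE rpred0.
- move=> x u; rewrite /bil big1 // => i _; rewrite big1 // => j _.
  by rewrite /Mat /ent !ffunE oppr0 !if_same eval_at0 mulr0.
exists (fun=> 0); split=> [i|k l].
  by rewrite scaler0 /bracket big1 // => j _; rewrite mderiv0 !mul0r mulr0 subr0.
have -> : contraction (fun=> 0) (volume 4 {mpoly C[4]}) = 0.
  by apply/ffunP => K; rewrite !ffunE big1 // => i _; rewrite mul0r mulr0.
have -> : contraction S (0 : form 4 {mpoly C[4]}) = 0.
  by apply/ffunP => K; rewrite !ffunE big1 // => i _; rewrite ffunE !mulr0.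
by rewrite /ent !ffunE oppr0 !if_same comp_mpoly0 oppr0 !if_same.
Qed.

Lemma baseZ c Om : base Om -> base (c *: Om).
Proof. by move=> bOm; rewrite -[_ *: _]addr0; apply: baseD bOm base0. Qed.

Definition comb (a : 'I_5 -> 'I_5 -> C) Om : {mpoly C[5]} :=
  \sum_i \sum_j a i j *: ent Om i j.

Lemma combD a c Om1 Om2 : comb a (c *: Om1 + Om2) = c *: comb a Om1 + comb a Om2.
Proof.
rewrite /comb scaler_sumr -big_split; apply: eq_bigr => i _ /=.
rewrite scaler_sumr -big_split; apply: eq_bigr => j _ /=.
by rewrite entD scalerDr !scalerA mulrC.
Qed.

Lemma comb_homog a Om : (forall I, Om I \is homog 4) -> comb a Om \is homog 4.
Proof.
move=> h; apply: rpred_sum => i _; apply: rpred_sum => j _; apply: dhomogZ.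
exact: ent_homog.
Qed.

Lemma Sing_ent Om x i j : Sing Om x -> Mat Om x i j = 0.
Proof.
move=> Sx; rewrite /Mat /ent; case: ltngtP => _; rewrite ?eval_at0 ?eval_atN ?Sx //.
by rewrite oppr0.
Qed.

(** Transversality is open in the direction, so [v] and some v + t1 e_i with t1 nonzero are
    eliminable. An invariant set is then invariant under every e_i, hence is everything. *)
Lemma transverse_thin n d f g (v w : 'rV[C]_n) (Z : set 'rV[C]_n) :
  f \is homog d.+1 -> g \is homog d.+1 -> transverse f g v w ->
  (forall z, Z z -> eval_at z f = 0 /\ eval_at z g = 0) -> thin Z.
Proof.
move=> fd gd tr Zfg Y [y0 Yy0] inv x.
have elim u : transverse f g u w -> eliminable Z u.
  move=> /(transverse_eliminant fd gd)[H [H0 Hu HS]]; exists H; split=> // z /Zfg[].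
  exact: HS.
have inv_v := inv v (elim v tr).
have inv_e i y t : Y y -> Y (y + t *: delta_mx 0 i).
  move=> Yy; have [rr r0 rtr] := transverse_open_dir (delta_mx 0 i) fd gd tr.
  have [t1] : exists t1, (rr * 'X).[t1] != 0.
    apply: contrapT => nt; have /eqP : rr * 'X = 0.
      apply: poly_eq0_horner => t1; apply/eqP/negPn/negP => rt1.
      by apply: nt; exists t1.
    by rewrite mulf_eq0 (negPf r0) polyX_eq0.
  rewrite hornerM hornerX mulf_eq0 negb_or => /andP[/rtr/elim/inv inv1 t10].
  have -> : y + t *: delta_mx 0 i =
      (y + (t / t1) *: (v + t1 *: delta_mx 0 i)) + (- (t / t1)) *: v.
    by rewrite scalerDr scalerA mulfVK // scaleNr addrA addrAC addrK.
  exact: inv_v (inv1 _ _ Yy).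
rewrite -[x](subrK y0) [x - y0]row_sum_delta.
elim/big_rec: _ => [|i z _ Yz]; first by rewrite add0r.
by rewrite -addrA addrC; apply: inv_e.
Qed.

(** A certificate, open along lines of forms, that the singular set has codimension at least 2. *)
Definition general Om := exists a b v w, transverse (comb a Om) (comb b Om) v w.

Lemma eval_comb_Sing a Om x : Sing Om x -> eval_at x (comb a Om) = 0.
Proof.
move=> Sx; rewrite eval_at_sum big1 // => i _; rewrite eval_at_sum big1 // => j _.
by rewrite eval_atZ -/(Mat Om x i j) Sing_ent ?mulr0.
Qed.

Lemma Sing_act B Om x : B \in unitmx -> is_kform 2 Om -> Sing (act B Om) x ->
  Sing Om (x *m B^T).
Proof.
move=> uB Om2 Sx I; case: (eqVneq #|I| 2%N) => [/card2P[i [j [ij ->]]]|/Om2 ->]; last exact: eval_at0.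
rewrite -(ent_lt _ ij) -/(Mat Om _ i j) -(actK uB Om2) Mat_act trmx_inv -mulmxA mulmxV ?unitmx_tr //.
by rewrite mulmx1 /bil big1 // => k _; rewrite big1 // => l _; rewrite Sing_ent ?mulr0.
Qed.

Lemma base_foliation B Om : B \in unitmx -> base Om -> general Om ->
  foliation_form 3 (act B Om).
Proof.
move=> uB bOm [a [b [v [w tr]]]]; have [Om2 Om4 R0 _] := bOm.
have h c := comb_homog c Om4.
have B1 i : tnth (linsub B) i \is homog 1.
  rewrite tnth_mktuple; apply: rpred_sum => j _; apply: dhomogZ.
  by rewrite dhomogX; apply/eqP; apply: mdeg1.
have evalB c u : eval_at (u *m (invmx B)^T) (comp_mpoly (linsub B) (comb c Om)) =
    eval_at u (comb c Om).
  by rewrite eval_linsub -mulmxA -trmx_mul mulmxV // trmx1 mulmx1.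
have trB : transverse (comp_mpoly (linsub B) (comb a Om)) (comp_mpoly (linsub B) (comb b Om))
    (v *m (invmx B)^T) (w *m (invmx B)^T).
  case: tr => f0 g0 nc; split; rewrite ?evalB // => t.
  by rewrite scalemxAl -mulmxDl !evalB; apply: nc.
have SB z : Sing (act B Om) z -> eval_at z (comp_mpoly (linsub B) (comb a Om)) = 0 /\
    eval_at z (comp_mpoly (linsub B) (comb b Om)) = 0.
  by move=> /(Sing_act uB Om2) Sz; rewrite !eval_linsub !eval_comb_Sing.
split.
- exact: act_kform.
- exact: act_homog.
- by apply/contraction_radial; [exact: act_kform|exact: act_radial].
- apply: plucker_frob_integrable.
  + exact: act_kform.
  + move=> O0; case: trB => /eqP[]; apply: proj1; apply: SB => I.
    by rewrite O0 ffunE eval_at0.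
  + apply: plucker_act; exact: base_plucker bOm.
  + apply: frob_act; exact: base_frob bOm.
apply: thin_codim_ge2.
  by apply: transverse_thin trB SB; apply: homog_comp.
exists (v *m (invmx B)^T) => /SB[E _]; case: trB => /eqP[].
by rewrite E.
Qed.

Lemma actZ A c Om : act A (c *: Om) = c *: act A Om.
Proof.
have Z0 Om' x i j : Mat (c *: Om') x i j = c * Mat Om' x i j.
  rewrite -[c *: _]addr0 MatD /Mat (_ : ent 0 i j = 0) ?eval_at0 ?addr0 //.
  by rewrite /ent !ffunE oppr0 !if_same.
apply: eq_act => [|I I2|x k l]; first exact: act_kform.
  by rewrite ffunE act_kform // scaler0.
rewrite Z0 !Mat_act /bil mulr_sumr; apply: eq_bigr => i _; rewrite mulr_sumr.
by apply: eq_bigr => j _; rewrite Z0; ring.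
Qed.

Lemma radial0Z c Om : radial0 Om -> radial0 (c *: Om).
Proof.
move=> R0 x u; rewrite -[RHS](mulr0 c) -(R0 x u) /bil mulr_sumr; apply: eq_bigr => i _.
rewrite mulr_sumr; apply: eq_bigr => j _.
rewrite -[c *: _]addr0 MatD /Mat (_ : ent 0 i j = 0) ?eval_at0; first ring.
by rewrite /ent !ffunE oppr0 !if_same.
Qed.

(** In the chart given by [A], the form [act A Om1] is a multiple of one in [base], and Om1 is
    recovered by the inverse of [A]. *)
Lemma family_sub F : affine_family p q r s lam 3 F ->
  exists B Om, [/\ B \in unitmx, base Om, foliation_form 3 (act B Om) & F = proj_class (act B Om)].
Proof.
move=> [[Om1 [fOm1 ->]] [_ [A [X [[c [c0 ->]] uA bX E]]]]].
have [Om12 Om14 R1 _ _] := fOm1.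
exists (invmx A), (act A Om1); split; rewrite ?actK ?unitmx_inv //.
have -> : act A Om1 = c^-1 *: act A (c *: Om1).
  by rewrite actZ scalerA mulVf // scale1r.
have Om2 : is_kform 2 (c *: Om1) by move=> I I2; rewrite ffunE Om12 // scaler0.
apply: baseZ; split.
- exact: act_kform.
- by apply: act_homog => I; rewrite ffunE; apply: dhomogZ.
- by rewrite actZ; apply/radial0Z/act_radial/contraction_radial.
by exists X; split=> // k l; rewrite -E pullback_chart.
Qed.

Lemma family_sup B Om : B \in unitmx -> base Om -> foliation_form 3 (act B Om) ->
  affine_family p q r s lam 3 (proj_class (act B Om)).
Proof.
move=> uB bOm fOm; split; first by exists (act B Om).
have [Om2 _ _ [X [bX E]]] := bOm.
exists (act B Om), (invmx B), X; split=> //.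
- by exists 1; rewrite oner_neq0 scale1r.
- by rewrite unitmx_inv.
apply: eq_kform2 => [||k l _].
- exact/pullback_kform/act_kform.
- exact/contraction_kform/contraction_kform/volume_kform.
by rewrite pullback_chart ?actK //; apply: act_kform.
Qed.

End Family.

(** * Curves of forms *)

Section PolynomialCurves.
Variables (C : numClosedFieldType) (n : nat).
Local Notation A := {mpoly C[n]}.

(* [F] is a polynomial curve whose velocity at [0] is [F1]. *)
Definition curve (F : C -> A) (F1 : A) :=
  exists K : {poly A}, (forall t, K.[mpolyC n t] = F t) /\ K`_1 = F1.

Lemma curve_ext F G F1 G1 : F =1 G -> F1 = G1 -> curve F F1 -> curve G G1.
Proof. by move=> FG <- [K [KF K1]]; exists K; split=> // t; rewrite KF. Qed.

Lemma curve_const p : curve (fun=> p) 0.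
Proof. by exists p%:P; rewrite coefC; split=> // t; rewrite hornerC. Qed.

Lemma curve_affine p q : curve (fun t => p + t *: q) q.
Proof.
exists (p%:P + q *: 'X); rewrite coefD coefZ coefX coefC add0r mulr1; split=> // t.
by rewrite !hornerE [q * _]mulrC mul_mpolyC.
Qed.

Lemma curveD F G F1 G1 : curve F F1 -> curve G G1 -> curve (fun t => F t + G t) (F1 + G1).
Proof.
by move=> [K [KF K1]] [L [LG L1]]; exists (K + L); rewrite coefD K1 L1; split=> // t; rewrite hornerD KF LG.
Qed.

Lemma curve_sum (I : finType) (F : I -> C -> A) F1 : (forall i, curve (F i) (F1 i)) ->
  curve (fun t => \sum_i F i t) (\sum_i F1 i).
Proof.
move=> h; apply: (@curve_ext (fun t => \sum_(i <- index_enum I) F i t) _ (\sum_(i <- index_enum I) F1 i)) => //.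
elim: (index_enum I) => [|i r IHr].
  by apply: curve_ext (curve_const 0) => [t|]; rewrite big_nil.
by apply: curve_ext (curveD (h i) IHr) => [t|]; rewrite big_cons.
Qed.

Lemma curveM F G F1 G1 : curve F F1 -> curve G G1 ->
  curve (fun t => F t * G t) (F1 * G 0 + F 0 * G1).
Proof.
move=> [K [KF K1]] [L [LG L1]]; exists (K * L); split=> [t|].
  by rewrite hornerM KF LG.
rewrite coefM !big_ord_recl big_ord0 /= addr0 addrC K1 L1.
by rewrite -(KF 0) -(LG 0) mpolyC0 !horner_coef0.
Qed.

Lemma curve_mcoeff F F1 m : curve F F1 ->
  exists g : {poly C}, (forall t, g.[t] = (F t)@_m) /\ g`_1 = F1@_m.
Proof.
move=> [K [KF <-]]; exists (map_poly (mcoeff m) K); split=> [t|]; last first.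
  by rewrite coef_map_id0 ?mcoeff0.
rewrite -KF (horner_coef K) raddf_sum /= (@horner_coef_wide _ (size K)); last exact: size_poly.
apply: eq_bigr => i _; rewrite coef_map_id0 ?mcoeff0 // -rmorphXn /= mulrC [in RHS]mulrC.
by rewrite mcoeffCM.
Qed.

End PolynomialCurves.

Section ActionCurves.
Variable C : numClosedFieldType.
Implicit Types (B : 'M[C]_5) (Om : form 5 {mpoly C[5]}).

Definition dlin B (P : {mpoly C[5]}) : {mpoly C[5]} :=
  \sum_a (\sum_h B a h *: 'X_h) * mderiv a P.

(* The Lie derivative of [Om] along the linear vector field [B]. *)
Definition lie B Om k l : {mpoly C[5]} := dlin B (ent Om k l)
  + \sum_i (B i k *: ent Om i l + B i l *: ent Om k i).

Lemma comp_linsub1 P : comp_mpoly (linsub (1%:M : 'M[C]_5)) P = P.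
Proof. by apply: eval_at_inj => x; rewrite eval_linsub trmx1 mulmx1. Qed.

Lemma curve_comp B P :
  curve (fun t => comp_mpoly (linsub (1%:M + t *: B)) P) (dlin B P).
Proof.
have l1 P' : comp_mpoly (linsub (1%:M + (0 : C) *: B)) P' = P' by rewrite scale0r addr0 comp_linsub1.
elim/mpoly_ring_ind: P => [c|j|p q Pp Pq|p q Pp Pq].
- apply: curve_ext (curve_const (mpolyC 5 c)) => [t|]; first by rewrite comp_mpolyC.
  by rewrite /dlin big1 // => a _; rewrite mderivC mulr0.
- apply: curve_ext (curve_affine 'X_j (\sum_h B j h *: 'X_h)) => [t|].
    apply: eval_at_inj => x; rewrite eval_linsub eval_atD eval_atZ !eval_atXU eval_at_sum.
    rewrite linearD linearZ /= mulmxDr trmx1 mulmx1 -scalemxAr !mxE; congr (_ + _ * _).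
    by apply: eq_bigr => h _; rewrite eval_atZ eval_atXU mxE mulrC.
  rewrite /dlin [RHS](bigD1 j) //= mderivX mnm1E eqxx scale1r.
  have -> : mnm_sub (mnm1 j) (mnm1 j) = @mnm0 5.
    by apply/mnmP => h; rewrite mnmBE subnn mnm0E.
  rewrite mpolyX0 mulr1 [X in _ = _ + X]big1 ?addr0 // => h /negPf hj.
  by rewrite mderivX mnm1E eq_sym hj scale0r mulr0.
- apply: curve_ext (curveD Pp Pq) => [t|]; first by rewrite comp_mpolyD.
  by rewrite /dlin -big_split; apply: eq_bigr => a _; rewrite mderivD mulrDr.
- apply: curve_ext (curveM Pp Pq) => [t|]; first by rewrite rmorphM.
  rewrite !l1 /dlin mulr_suml mulr_sumr -big_split; apply: eq_bigr => a _ /=.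
  by rewrite mderivM; ring.
Qed.

Lemma sum_delta (F : 'I_5 -> {mpoly C[5]}) k :
  \sum_i mpolyC 5 ((1%:M : 'M[C]_5) i k) * F i = F k.
Proof.
rewrite (bigD1 k) //= mxE eqxx mpolyC1 mul1r big1 ?addr0 // => i /negPf ik.
by rewrite mxE ik mpolyC0 mul0r.
Qed.

(** The product rule at t = 0: the substitution contributes [dlin], the two matrix factors
    contribute the index terms of [lie], and the moving form contributes Om1. *)
Lemma curve_act B Om0 Om1 I :
  curve (fun t => act (1%:M + t *: B) (Om0 + t *: Om1) I)
    ((of_ent (lie B Om0) + (of_ent (ent Om1) : form 5 {mpoly C[5]})) I).
Proof.
have cB i k : curve (fun t => mpolyC 5 ((1%:M + t *: B : 'M[C]_5) i k)) (mpolyC 5 (B i k)).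
  apply: curve_ext (curve_affine (mpolyC 5 ((1%:M : 'M[C]_5) i k)) (mpolyC 5 (B i k))) => [t|] //.
  by rewrite !mxE mpolyCD -mul_mpolyC -mpolyCM.
have cX : curve (fun t => mpolyC 5 t) (1 : {mpoly C[5]}).
  apply: curve_ext (curve_affine 0 1) => [t|] //.
  by rewrite add0r alg_mpolyC.
have c1 i j : curve (fun t => comp_mpoly (linsub (1%:M + t *: B)) (ent (Om0 + t *: Om1) i j))
    (dlin B (ent Om0 i j) + ent Om1 i j).
  have := curveD (curve_comp B (ent Om0 i j)) (curveM cX (curve_comp B (ent Om1 i j))).
  apply: curve_ext => [t|].
    by rewrite [Om0 + _]addrC entD comp_mpolyD comp_mpolyZ mul_mpolyC addrC.
  by rewrite scale0r addr0 comp_linsub1 mpolyC0 mul0r addr0 mul1r.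
rewrite ffunE; have cE k l : curve (fun t => ent (act (1%:M + t *: B) (Om0 + t *: Om1)) k l)
    (lie B Om0 k l + ent Om1 k l).
  have := curve_sum (fun i => curve_sum (fun j => curveM (curveM (cB i k) (cB j l)) (c1 i j))).
  apply: curve_ext => [t|].
    rewrite ent_act; apply: eq_bigr => i _; apply: eq_bigr => j _.
    by rewrite -mul_mpolyC mpolyCM.
  rewrite !scale0r !addr0.
  under eq_bigr => i _ do under eq_bigr => j _ do rewrite comp_linsub1 !mulrDl -!mulrA.
  under eq_bigr => i _ do rewrite !big_split /=.
  rewrite !big_split /=.
  have -> : \sum_i \sum_j mpolyC 5 (B i k) * (mpolyC 5 ((1%:M : 'M[C]_5) j l) * ent Om0 i j) =
      \sum_i B i k *: ent Om0 i l.
    by apply: eq_bigr => i _; rewrite -mulr_sumr sum_delta mul_mpolyC.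
  have -> : \sum_i \sum_j mpolyC 5 ((1%:M : 'M[C]_5) i k) * (mpolyC 5 (B j l) * ent Om0 i j) =
      \sum_j B j l *: ent Om0 k j.
    under eq_bigr => i _ do rewrite -mulr_sumr.
    by rewrite sum_delta; apply: eq_bigr => j _; rewrite mul_mpolyC.
  have -> : \sum_i \sum_j mpolyC 5 ((1%:M : 'M[C]_5) i k) *
        (mpolyC 5 ((1%:M : 'M[C]_5) j l) * (dlin B (ent Om0 i j) + ent Om1 i j)) =
      dlin B (ent Om0 k l) + ent Om1 k l.
    by under eq_bigr => i _ do rewrite -mulr_sumr; rewrite sum_delta sum_delta.
  by rewrite /lie big_split /= addrA [_ + dlin _ _]addrC.
case: (eqVneq #|I| 2%N) => [/card2P[k [l [kl ->]]]|I2].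
  apply: curve_ext (cE k l) => [t|]; first by rewrite ent_lt.
  by rewrite !ffunE enum_set2.
rewrite !of_ent_kform // addr0; apply: curve_ext (curve_const 0) => [t|] //.
by rewrite act_kform.
Qed.

Lemma kformD k c Om0 Om1 : is_kform k Om0 -> is_kform k Om1 -> is_kform k (c *: Om0 + Om1).
Proof. by move=> k0 k1 I Ik; rewrite !ffunE k0 // k1 // scaler0 addr0. Qed.

Lemma MatDr c Om0 Om1 x i j : Mat (Om0 + c *: Om1) x i j = Mat Om0 x i j + c * Mat Om1 x i j.
Proof. by rewrite addrC MatD addrC. Qed.

Lemma actD B c Om0 Om1 : act B (Om0 + c *: Om1) = act B Om0 + c *: act B Om1.
Proof.
apply: eq_act => [||x k l]; first exact: act_kform.
  by rewrite addrC; apply: kformD; apply: act_kform.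
rewrite MatDr !Mat_act /bil mulr_sumr -big_split; apply: eq_bigr => i _.
rewrite mulr_sumr -big_split; apply: eq_bigr => j _.
by rewrite MatDr mulrDr [in RHS]mulrCA.
Qed.

Lemma ent_kform Om : is_kform 2 Om -> of_ent (ent Om) = Om.
Proof.
move=> Om2; apply: eq_kform2 => [||i j _] //; first exact: of_ent_kform.
by rewrite ent_of_ent // => *; [apply: entN|apply: entii].
Qed.

End ActionCurves.

(** * Coordinates of forms *)

Section Coordinates.
Variable C : numClosedFieldType.
Implicit Types (B : 'M[C]_5) (Om : form 5 {mpoly C[5]}).
Local Notation N := #|coord_index 3|.
Local Notation crd := (@coordinates C 3).

Lemma crdD c Om1 Om2 i : crd (c *: Om1 + Om2) i = c * crd Om1 i + crd Om2 i.
Proof. by rewrite /coordinates !ffunE mcoeffD mcoeffZ. Qed.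

Lemma crdZ c Om i : crd (c *: Om) i = c * crd Om i.
Proof. by rewrite /coordinates !ffunE mcoeffZ. Qed.

Definition form_of (y : 'I_N -> C) : form 5 {mpoly C[5]} :=
  \sum_i y i *: [ffun I => if I == (enum_val i).1 then 'X_[bmnm (enum_val i).2] else 0].

Lemma crd_form_of y i : crd (form_of y) i = y i.
Proof.
rewrite /coordinates sum_ffunE raddf_sum (bigD1 i) //= !ffunE eqxx mcoeffZ mcoeffX eqxx mulr1.
rewrite big1 ?addr0 // => j ji; rewrite !ffunE; case: eqP => [e1|_]; last by rewrite scaler0 mcoeff0.
rewrite mcoeffZ mcoeffX; case: eqP => [e2|_]; last by rewrite mulr0.
case/eqP: ji; apply: enum_val_inj; move: e1 e2; case: (enum_val i) => a b; case: (enum_val j) => c d /=.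
by move=> -> /val_inj ->.
Qed.

Lemma homog_coef0 n d (P : {mpoly C[n]}) m : P \is homog d -> mdeg m != d -> P@_m = 0.
Proof.
move=> /dhomogP Pd md; apply: memN_msupp_eq0; apply: contraNN md => /Pd /= ->.
exact: eqxx.
Qed.

Lemma form_of_crd Om : (forall I, Om I \is homog 4) -> form_of (crd Om) = Om.
Proof.
move=> h; apply/ffunP => I; apply/mpolyP => m.
have [m4|m4] := ltnP (mdeg m) 5.
  have := crd_form_of (crd Om) (enum_rank (I, BMultinom m4)).
  by rewrite /coordinates enum_rankK.
rewrite [RHS](@homog_coef0 _ 4) ?gtn_eqF // sum_ffunE raddf_sum big1 // => i _; rewrite !ffunE; case: eqP => _; last first.
  by rewrite scaler0 raddf0.
rewrite /= mcoeffZ mcoeffX; case: eqP => [e|_]; last by rewrite mulr0.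
by move: m4; rewrite -e leqNgt bmdeg.
Qed.

Lemma curve_crd B Om0 Om1 : is_kform 2 Om0 -> is_kform 2 Om1 ->
  exists gam : 'I_N -> {poly C}, forall i,
    (forall t, (gam i).[t] = crd (act (1%:M + t *: B) (Om0 + t *: Om1)) i) /\
    (gam i)`_0 = crd Om0 i /\ (gam i)`_1 = crd (of_ent (lie B Om0) + Om1) i.
Proof.
move=> k0 k1; have G i : exists g : {poly C},
    (forall t, g.[t] = crd (act (1%:M + t *: B) (Om0 + t *: Om1)) i) /\
    g`_0 = crd Om0 i /\ g`_1 = crd (of_ent (lie B Om0) + Om1) i; last first.
  by have [gam gamE] := choice G; exists gam.
have [g [gE g1]] := curve_mcoeff (bmnm (enum_val i).2) (curve_act B Om0 Om1 (enum_val i).1).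
exists g; split=> //; split; last by rewrite g1 ent_kform.
by rewrite -horner_coef0 gE !scale0r !addr0 act1.
Qed.

End Coordinates.

(** * Irreducibility of the closure *)

Section Component.
Variables (C : numClosedFieldType) (p q r s : nat) (lam : int).
Implicit Types (Om : form 5 {mpoly C[5]}) (B : 'M[C]_5).
Local Notation N := #|coord_index 3|.
Local Notation crd := (@coordinates C 3).
Local Notation base := (base (C := C) p q r s lam).
Local Notation family := (@affine_family C p q r s lam 3).

Lemma meval_homog n d (P : {mpoly C[n]}) c (x : 'I_n -> C) : P \is homog d ->
  meval (fun i => c * x i) P = c ^+ d * meval x P.
Proof.
move=> /(eval_homog c (\row_i x i)); rewrite /eval_at.
rewrite (meval_eq (v2 := fun i => c * x i)) => [->|i]; last by rewrite !mxE.
by congr (_ * _); apply: meval_eq => i; rewrite mxE.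
Qed.

Lemma general_open Om0 Om1 : (forall I, Om0 I \is homog 4) -> (forall I, Om1 I \is homog 4) ->
  general Om0 -> exists2 rr : {poly C}, rr != 0 &
    forall t, rr.[t] != 0 -> general (Om0 + t *: Om1).
Proof.
move=> h0 h1 [a [b [v [w tr]]]].
have [rr r0 rrP] := transverse_open_form (comb_homog a h0) (comb_homog b h0)
  (comb_homog a h1) (comb_homog b h1) tr.
exists rr => // t /rrP trt; exists a, b, v, w.
by rewrite [Om0 + _]addrC !combD.
Qed.

Lemma unit_open B : exists2 rr : {poly C}, rr != 0 &
  forall t, rr.[t] != 0 -> 1%:M + t *: B \in unitmx.
Proof.
pose M : 'M[{poly C}]_5 := 1%:M + 'X *: map_mx polyC B.
have ME t : (\det M).[t] = \det (1%:M + t *: B).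
  rewrite -horner_evalE -det_map_mx; congr (\det _); apply/matrixP => i j.
  by rewrite !mxE /= horner_evalE hornerD hornerM hornerX hornerC -polyC_natr hornerC.
exists (\det M) => [|t]; last by rewrite ME unitmxE unitfE.
apply/eqP => M0; have := ME 0; rewrite M0 horner0 scale0r addr0 det1 => /esym/eqP.
by rewrite oner_eq0.
Qed.

Lemma baseDr Om0 Om1 (t : C) : base Om0 -> base Om1 -> base (Om0 + t *: Om1).
Proof. by move=> b0 b1; rewrite addrC; apply: baseD. Qed.

(** Invertibility of 1 + t B and the certificate [general] hold at t = 0 and are open in t, so a
    curve of pairs starting at (1, Om0) stays in the family for all but finitely many t. *)
Lemma family_curve B Om0 Om1 : base Om0 -> base Om1 -> general Om0 ->
  exists2 rr : {poly C}, rr != 0 & forall t, rr.[t] != 0 ->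
    family (proj_class (act (1%:M + t *: B) (Om0 + t *: Om1))).
Proof.
move=> b0 b1 g0; have [_ h0 _ _] := b0; have [_ h1 _ _] := b1.
have [r1 r10 r1P] := general_open h0 h1 g0; have [r2 r20 r2P] := unit_open B.
exists (r1 * r2) => [|t]; first by rewrite mulf_neq0.
rewrite hornerM mulf_eq0 negb_or => /andP[/r1P gt /r2P ut].
have bt := baseDr t b0 b1.
have ft := base_foliation ut bt gt; have Ft := family_sup ut bt ft.
exact Ft.
Qed.

Lemma neq0_horner (g : {poly C}) : g != 0 -> exists t, g.[t] != 0.
Proof.
move=> g0; apply: contrapT => ng; move/eqP: g0; apply; apply: poly_eq0_horner => t.
by apply/eqP/negPn/negP => gt; apply: ng; exists t.
Qed.

Lemma line_family B Om0 Om1 (P Q : {mpoly C[N]}) :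
  let M t := crd (act (1%:M + t *: B) (Om0 + t *: Om1)) in
  is_kform 2 Om0 -> is_kform 2 Om1 -> meval (M 0) P != 0 -> (exists t, meval (M t) Q != 0) ->
  exists2 g : {poly C}, g != 0 & forall t, g.[t] != 0 -> meval (M t) P != 0 /\ meval (M t) Q != 0.
Proof.
move=> M k0 k1 P0 [t1 Q1]; have [gam gamE] := curve_crd B k0 k1.
have E t G : (along gam G).[t] = meval (M t) G.
  by rewrite horner_along; apply: meval_eq => i; have [-> _] := gamE i.
exists (along gam P * along gam Q) => [|t].
  by rewrite mulf_neq0 //; apply/eqP => /(congr1 (horner^~ _)) e;
     [move: P0|move: Q1]; rewrite -E e horner0 eqxx.
by rewrite hornerM !E mulf_eq0 negb_or => /andP[].
Qed.

Variable Om0 : form 5 {mpoly C[5]}.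
Hypotheses (b0 : base Om0) (g0 : general Om0).

Lemma family0 : family (proj_class Om0).
Proof.
have k0 : is_kform 2 Om0 by case: b0.
have u1 := unitmx1 C 5.
have f0 := base_foliation u1 b0 g0; have F0 := family_sup u1 b0 f0.
by rewrite act1 in F0.
Qed.

(** The parameter space is linear. On the line joining the two given pairs some pair makes both P
    and Q nonzero, although it may not define a foliation. The line from (1, Om0) to that pair stays
    in the family for almost all t, and P and Q are not identically zero on it. *)
Lemma family_two (P Q : {mpoly C[N]}) B1 Om1 B2 Om2 : B1 \in unitmx -> base Om1 -> base Om2 ->
  meval (crd (act B1 Om1)) P != 0 -> meval (crd (act B2 Om2)) Q != 0 ->
  exists B Om, [/\ family (proj_class (act B Om)), meval (crd (act B Om)) P != 0 &
    meval (crd (act B Om)) Q != 0].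
Proof.
move=> u1 b1 b2 P1 Q2.
have k Om : base Om -> is_kform 2 Om by case.
have [B [Om [bOm P3 Q3]]] : exists B Om, [/\ base Om, meval (crd (act B Om)) P != 0 &
    meval (crd (act B Om)) Q != 0].
  (* With this direction, acting by B1 and then by 1 + t B' is acting by the point B1 + t (B2 - B1)
     of the segment. *)
  pose B' := invmx B1 *m (B2 - B1).
  have E t : act (1%:M + t *: B') (act B1 Om1 + t *: act B1 (Om2 - Om1)) =
      act (B1 + t *: (B2 - B1)) (Om1 + t *: (Om2 - Om1)).
    by rewrite -actD act_act mulmxDr mulmx1 -scalemxAr mulKVmx.
  have [||||g gn gP] := @line_family B' (act B1 Om1) (act B1 (Om2 - Om1)) P Q.
  - exact: act_kform.
  - exact: act_kform.
  - by rewrite E !scale0r !addr0.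
  - by exists 1; rewrite E !scale1r !subrKC.
  have [t /gP] := neq0_horner gn; rewrite E => -[Pt Qt].
  exists (B1 + t *: (B2 - B1)), (Om1 + t *: (Om2 - Om1)); split=> //.
  by apply: baseDr => //; rewrite addrC -scaleN1r; apply: baseD.
(* From here on, the second line, which starts at the general form Om0. *)
have bm : base (Om - Om0) by rewrite addrC -scaleN1r; apply: baseD.
have [rr r0 rP] := family_curve (B - 1%:M) b0 bm g0.
have [gam gamE] := curve_crd (B - 1%:M) (k _ b0) (k _ bm).
have E t G : (along gam G).[t] = meval (crd (act (1%:M + t *: (B - 1%:M)) (Om0 + t *: (Om - Om0)))) G.
  by rewrite horner_along; apply: meval_eq => i; have [-> _] := gamE i.
have nz G : meval (crd (act B Om)) G != 0 -> along gam G != 0.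
  move=> G0; apply: contraNneq G0 => e; have := E 1 G.
  by rewrite e horner0 !scale1r !subrKC => <-.
have [t] := neq0_horner (mulf_neq0 r0 (mulf_neq0 (nz P P3) (nz Q Q3))).
rewrite !hornerM !E !mulf_eq0 !negb_or => /and3P[/rP ft Pt Qt].
by exists (1%:M + t *: (B - 1%:M)), (Om0 + t *: (Om - Om0)).
Qed.
Local Notation Z := (@family_closure C p q r s lam 3).

Lemma sub_closure : (family `<=` Z)%classic.
Proof. by move=> F FF Y [_]; apply. Qed.

Lemma foliations_self : (@foliations_closed C 3) (@foliations C 3).
Proof.
exists classical_sets.set0; split=> //; apply/seteqP; split=> F; last by case.
by move=> FF; split.
Qed.

Lemma closure_foliations : (Z `<=` @foliations C 3)%classic.
Proof. by move=> F; apply; split; [exact: foliations_self|move=> G []]. Qed.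

Lemma not_in_closed A : @foliations_closed C 3 A -> ~ (family `<=` A)%classic ->
  exists P B Om, [/\ B \in unitmx, base Om, meval (crd (act B Om)) P != 0 &
    forall F, A F -> forall Om', F Om' -> meval (crd Om') P = 0].
Proof.
move=> [E [Eh ->]] nA; apply: contrapT => nex; apply: nA => F FF.
have [fF _] := FF; split=> // P EP Om FOm; apply/eqP/negPn/negP => P0; apply: nex.
have [B [Om1 [uB bOm1 _ FE]]] := family_sub FF; exists P, B, Om1; split=> //; last first.
  by move=> F' [_]; apply.
move: FOm; rewrite FE => -[c [c0 OmE]]; have [d Pd] := Eh P EP.
(* Homogeneity of the equation makes its vanishing independent of the representative of the
   class. *)
apply: contraNneq P0 => P1; rewrite OmE.
rewrite (meval_eq (v2 := fun i => c * crd (act B Om1) i)) => [|i]; last exact: crdZ.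
by rewrite (meval_homog _ _ Pd) P1 mulr0.
Qed.

Lemma closure_irreducible : irreducible (@foliations_closed C 3) Z.
Proof.
split; first by exists (proj_class Om0); apply: sub_closure; apply: family0.
move=> A B clA clB ZAB; apply: contrapT => /not_orP[nA nB].
have nf W : @foliations_closed C 3 W -> ~ (Z `<=` W)%classic -> ~ (family `<=` W)%classic.
  by move=> clW nW fW; apply: nW => F; apply.
have [P [B1 [Om1 [u1 b1 P1 PA]]]] := not_in_closed clA (nf _ clA nA).
have [Q [B2 [Om2 [u2 b2 Q2 QB]]]] := not_in_closed clB (nf _ clB nB).
have [B3 [Om3 [f3 P3 Q3]]] := family_two u1 b1 b2 P1 Q2.
have m3 : proj_class (act B3 Om3) (act B3 Om3) by exists 1; rewrite oner_neq0 scale1r.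
by case: (ZAB _ (sub_closure f3)) => [/PA/(_ _ m3)/eqP|/QB/(_ _ m3)/eqP]; apply/negP.
Qed.

End Component.

(** * Infinitesimal rigidity *)

(** The hypothesis makes v |-> v T^T injective on K, so rank K <= rank T. *)
Lemma sub_orthogonal (F : fieldType) n (K T : 'M[F]_n) : (T <= K)%MS ->
  (forall v : 'rV_n, (v <= K)%MS -> v *m T^T = 0 -> v = 0) -> (K <= T)%MS.
Proof.
move=> TK inj; have [_ <-] := mxrank_leqif_sup TK.
rewrite eqn_leq mxrankS //= -(mxrank_mul_ker K T^T).
have -> : (K :&: kermx T^T)%MS = 0.
  apply/eqP; rewrite -submx0; apply/rV_subP => v; rewrite sub_capmx => /andP[vK /sub_kermxP vT].
  by rewrite (inj v) ?sub0mx.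
by rewrite mxrank0 addn0 -(mxrank_tr T) mxrankM_maxr.
Qed.

Section Rigid.
Variables (C : numClosedFieldType).
Implicit Types (Om : form 5 {mpoly C[5]}) (B : 'M[C]_5).
Local Notation N := #|coord_index 3|.
Local Notation crd := (@coordinates C 3).

(** The coefficients of i_v Om /\ d Om', the polarization of [frobp]. *)
Definition frobq Om Om' v i j k l :=
  ent Om v i * dent Om' j k l - ent Om v j * dent Om' i k l
  + ent Om v k * dent Om' i j l - ent Om v l * dent Om' i j k.

(** Bilinear, without conjugation: orthogonality to a form with integer coefficients is an integer
    linear equation. *)
Definition dot Om Om' : C := \sum_i crd Om i * crd Om' i.

Lemma dentD c Om1 Om2 j k l : dent (c *: Om1 + Om2) j k l = c *: dent Om1 j k l + dent Om2 j k l.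
Proof.
rewrite /dent !entD !mderivD !mderivZ -!mul_mpolyC.
move: (mderiv _ _) (mderiv _ _) (mderiv _ _) (mderiv _ _) (mderiv _ _) (mderiv _ _) => a b e f g h.
by ring.
Qed.

Lemma frobqDl v i j k l c Om1 Om2 Om :
  frobq (c *: Om1 + Om2) Om v i j k l = c *: frobq Om1 Om v i j k l + frobq Om2 Om v i j k l.
Proof.
rewrite /frobq !entD -!mul_mpolyC.
move: (ent _ _ _) (ent _ _ _) (ent _ _ _) (ent _ _ _) (ent _ _ _) (ent _ _ _) (ent _ _ _) (ent _ _ _).
move: (dent _ _ _ _) (dent _ _ _ _) (dent _ _ _ _) (dent _ _ _ _) => *; ring.
Qed.

Lemma frobqDr v i j k l c Om1 Om2 Om :
  frobq Om (c *: Om1 + Om2) v i j k l = c *: frobq Om Om1 v i j k l + frobq Om Om2 v i j k l.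
Proof.
rewrite /frobq !dentD -!mul_mpolyC.
move: (ent _ _ _) (ent _ _ _) (ent _ _ _) (ent _ _ _) (dent _ _ _ _) (dent _ _ _ _) (dent _ _ _ _) (dent _ _ _ _).
move: (dent _ _ _ _) (dent _ _ _ _) (dent _ _ _ _) (dent _ _ _ _) => *; ring.
Qed.

Lemma frobqZ v i j k l c Om : frobq (c *: Om) (c *: Om) v i j k l = (c * c) *: frobp Om v i j k l.
Proof.
have z1 Om' : frobq 0 Om' v i j k l = 0.
  by have := frobqDl v i j k l (-1) 0 0 Om'; rewrite scaler0 addr0 scaleN1r addNr.
have z2 Om' : frobq Om' 0 v i j k l = 0.
  by have := frobqDr v i j k l (-1) 0 0 Om'; rewrite scaler0 addr0 scaleN1r addNr.
rewrite -[X in frobq X]addr0 frobqDl z1 addr0 -[X in frobq _ X]addr0 frobqDr z2 addr0.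
by rewrite scalerA.
Qed.

Definition basis_form (i : 'I_N) : form 5 {mpoly C[5]} :=
  [ffun I => if I == (enum_val i).1 then 'X_[bmnm (enum_val i).2] else 0].

Lemma bilinear_form_of (Phi : form 5 {mpoly C[5]} -> form 5 {mpoly C[5]} -> {mpoly C[5]})
    (y z : 'I_N -> C) :
  (forall c Om1 Om2 Om, Phi (c *: Om1 + Om2) Om = c *: Phi Om1 Om + Phi Om2 Om) ->
  (forall c Om1 Om2 Om, Phi Om (c *: Om1 + Om2) = c *: Phi Om Om1 + Phi Om Om2) ->
  Phi (form_of y) (form_of z) = \sum_i \sum_j (y i * z j) *: Phi (basis_form i) (basis_form j).
Proof.
move=> Dl Dr.
have z1 Om' : Phi 0 Om' = 0.
  by have := Dl (-1) 0 0 Om'; rewrite scaler0 addr0 scaleN1r addNr.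
have z2 Om' : Phi Om' 0 = 0.
  by have := Dr (-1) 0 0 Om'; rewrite scaler0 addr0 scaleN1r addNr.
have -> : Phi (form_of y) (form_of z) = \sum_i y i *: Phi (basis_form i) (form_of z).
  rewrite {1}/form_of; elim/big_rec2: _ => [|i P Om _ <-]; [exact: z1|exact: Dl].
apply: eq_bigr => i _.
have -> : Phi (basis_form i) (form_of z) = \sum_j z j *: Phi (basis_form i) (basis_form j).
  rewrite {1}/form_of; elim/big_rec2: _ => [|j P Om _ <-]; [exact: z2|exact: Dr].
by rewrite scaler_sumr; apply: eq_bigr => j _; rewrite scalerA.
Qed.

Definition quadric (b : 'I_N -> 'I_N -> C) : {mpoly C[N]} :=
  \sum_i \sum_j b i j *: ('X_i * 'X_j).

Lemma meval_quadric b y : meval y (quadric b) = \sum_i \sum_j y i * y j * b i j.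
Proof.
rewrite /quadric raddf_sum; apply: eq_bigr => i _; rewrite raddf_sum; apply: eq_bigr => j _ /=.
by rewrite mevalZ mevalM !mevalXU mulrC.
Qed.

Lemma meval_mderivXU a (v : 'I_N -> C) i :
  \sum_x v x * meval a (mderiv x ('X_i : {mpoly C[N]})) = v i.
Proof.
rewrite (bigD1 i) //= mderivX mnm1E eqxx scale1r.
have -> : mnm_sub (mnm1 i) (mnm1 i) = @mnm0 N.
  by apply/mnmP => h; rewrite mnmBE subnn mnm0E.
rewrite mpolyX0 meval1 mulr1 big1 ?addr0 // => h /negPf hi.
by rewrite mderivX mnm1E eq_sym hi scale0r meval0 mulr0.
Qed.

Lemma deriv_quadric b a (v : 'I_N -> C) : \sum_x v x * meval a (mderiv x (quadric b)) =
  \sum_i \sum_j (v i * a j * b i j + a i * v j * b i j).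
Proof.
have E x : meval a (mderiv x (quadric b)) = \sum_i \sum_j b i j *
    (meval a (mderiv x 'X_i) * a j + a i * meval a (mderiv x 'X_j)).
  have D1 : {morph (fun P => meval a (mderiv x P)) : P Q / P + Q}.
    by move=> P Q; rewrite mderivD mevalD.
  have D0 : meval a (mderiv x 0) = 0 by rewrite mderiv0 meval0.
  rewrite (big_morph _ D1 D0); apply: eq_bigr => i _.
  rewrite (big_morph _ D1 D0); apply: eq_bigr => j _.
  by rewrite mderivZ mevalZ mderivM mevalD !mevalM !mevalXU.
under eq_bigr => x _ do rewrite E mulr_sumr.
rewrite exchange_big; apply: eq_bigr => i _ /=.
under eq_bigr => x _ do rewrite mulr_sumr.
rewrite exchange_big; apply: eq_bigr => j _ /=.
rewrite -[in RHS](meval_mderivXU a v i) -[X in _ + a i * X * _](meval_mderivXU a v j).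
rewrite !mulr_suml mulr_sumr mulr_suml -big_split; apply: eq_bigr => x _ /=.
by move: (meval _ _) (meval _ _) => *; ring.
Qed.

(** A coefficient of Phi(Om, Om) is a quadratic polynomial in the coordinates of Om; its
    differential is the symmetrization of Phi. It serves for the Frobenius equations. *)
Lemma deriv_bilinear (Phi : form 5 {mpoly C[5]} -> form 5 {mpoly C[5]} -> {mpoly C[5]}) m a v :
  (forall c Om1 Om2 Om, Phi (c *: Om1 + Om2) Om = c *: Phi Om1 Om + Phi Om2 Om) ->
  (forall c Om1 Om2 Om, Phi Om (c *: Om1 + Om2) = c *: Phi Om Om1 + Phi Om Om2) ->
  let g := quadric (fun i j => (Phi (basis_form i) (basis_form j))@_m) in
  (forall y, meval y g = (Phi (form_of y) (form_of y))@_m) /\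
  \sum_x v x * meval a (mderiv x g) =
    (Phi (form_of v) (form_of a) + Phi (form_of a) (form_of v))@_m.
Proof.
move=> Dl Dr g.
have E y z : (Phi (form_of y) (form_of z))@_m =
    \sum_i \sum_j y i * z j * (Phi (basis_form i) (basis_form j))@_m.
  rewrite (bilinear_form_of _ _ Dl Dr) raddf_sum; apply: eq_bigr => i _ /=.
  by rewrite raddf_sum; apply: eq_bigr => j _ /=; rewrite mcoeffZ.
split=> [y|]; first by rewrite meval_quadric E.
rewrite deriv_quadric mcoeffD !E -big_split; apply: eq_bigr => i _ /=.
by rewrite -big_split.
Qed.

End Rigid.

(** * An infinitesimally rigid form yields a component *)

Section Component.
Variables (C : numClosedFieldType) (p q r s : nat) (lam : int).
Implicit Types (Om : form 5 {mpoly C[5]}) (B : 'M[C]_5).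
Local Notation N := #|coord_index 3|.
Local Notation crd := (@coordinates C 3).
Local Notation base := (base (C := C) p q r s lam).
Local Notation family := (@affine_family C p q r s lam 3).
Local Notation Z := (@family_closure C p q r s lam 3).

(* To first order, [Om0] has no other deformations than those of the family. *)
Definition rigid Om0 := forall eta, is_kform 2 eta -> (forall I, eta I \is homog 4) ->
  (forall v i j k l, frobq Om0 eta v i j k l + frobq eta Om0 v i j k l = 0) ->
  (forall B, dot (of_ent (lie B Om0)) eta = 0) ->
  (forall Om, base Om -> dot Om eta = 0) -> eta = 0.

Lemma foliation_class F Om : @foliations C 3 F -> F Om ->
  [/\ is_kform 2 Om, forall I, Om I \is homog 4, frob Om &
    forall c, c != 0 -> F (c *: Om)].
Proof.
move=> [Om1 [[k1 h1 _ i1 _] ->]] [c [c0 ->]]; split.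
- by move=> I I2; rewrite ffunE k1 // scaler0.
- by move=> I; rewrite ffunE; apply: dhomogZ.
- move=> v i j k l; have f1 := integrable_frob k1 i1.
  rewrite (_ : frobp _ _ _ _ _ _ = frobq (c *: Om1) (c *: Om1) v i j k l) //.
  by rewrite frobqZ f1 scaler0.
by move=> e e0; exists (e * c); rewrite mulf_neq0 // scalerA.
Qed.

Lemma meval_crdZ d P c Om : P \is homog d -> meval (crd (c *: Om)) P = c ^+ d * meval (crd Om) P.
Proof.
move=> Pd; rewrite -(meval_homog _ _ Pd); apply: meval_eq => i; exact: crdZ.
Qed.

(** Along the punctured line through x, [u] is a polynomial in c whose coefficients are the values
    of its homogeneous parts at x. *)
Lemma meval_pihomog n (u : {mpoly C[n]}) (x : 'I_n -> C) :
  (forall c, c != 0 -> meval (fun i => c * x i) u = 0) ->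
  forall k, meval x (pihomog mdeg k u) = 0.
Proof.
move=> u0 k; pose L := maxn (mmeasure mdeg u) k.+1.
have uE : u = \sum_(d < L) pihomog mdeg d u by apply: pihomog_partitionE; apply: leq_maxl.
pose g : {poly C} := \poly_(d < L) meval x (pihomog mdeg d u).
have gE c : g.[c] = meval (fun i => c * x i) u.
  rewrite [in RHS]uE raddf_sum horner_poly; apply: eq_bigr => d _ /=.
  by rewrite (meval_homog _ _ (pihomogP _ _ _)) mulrC.
have /eqP : 'X * g = 0.
  apply: poly_eq0_horner => c; rewrite hornerM hornerX gE.
  by have [->|c0] := eqVneq c 0; [rewrite mul0r|rewrite u0 ?mulr0].
rewrite mulf_eq0 polyX_eq0 /= => /eqP/(congr1 (fun g : {poly C} => g`_k)).
by rewrite coef_poly coef0 leq_maxr.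
Qed.

Section Rigid.
Variable Om0 : form 5 {mpoly C[5]}.
Hypotheses (b0 : base Om0) (g0 : general Om0) (rig : rigid Om0).

Definition on_family (g : {mpoly C[N]}) :=
  forall F Om, family F -> F Om -> meval (crd Om) g = 0.

(** Every first-order deformation L_B Om0 + Om1 is the velocity of the polynomial arc (1 + t B)^*
    (Om0 + t Om1), which lies in the family for almost all t, so equations of the family vanish
    along it. *)
Lemma family_arc B Om1 : base Om1 -> exists gam : 'I_N -> {poly C},
  (forall i, (gam i)`_0 = crd Om0 i /\ (gam i)`_1 = crd (of_ent (lie B Om0) + Om1) i) /\
  forall g, on_family g -> along gam g = 0.
Proof.
move=> b1; have [k0 _ _ _] := b0; have [k1 _ _ _] := b1.
have [gam gamE] := curve_crd B k0 k1; exists gam; split=> [i|g gf].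
  by have [_ ?] := gamE i.
have [rr r0 rP] := family_curve B b0 b1 g0.
have /eqP : rr * along gam g = 0; last by rewrite mulf_eq0 (negPf r0) => /eqP.
apply: poly_eq0_horner => t; rewrite hornerM; have [->|rt] := eqVneq rr.[t] 0.
  by rewrite mul0r.
rewrite horner_along (meval_eq (v2 := crd (act (1%:M + t *: B) (Om0 + t *: Om1)))).
  by rewrite (gf _ _ (rP t rt)) ?mulr0 //; exists 1; rewrite oner_neq0 scale1r.
by move=> i; have [-> _] := gamE i.
Qed.

Section Ideal.
Variable I : {mpoly C[N]} -> Prop.
Hypotheses (I_ideal : is_ideal I) (I_family : forall g, I g -> on_family g).
Hypothesis I_foliations : forall g, (forall Om, is_kform 2 Om ->
  (forall J, Om J \is homog 4) -> frob Om -> meval (crd Om) g = 0) -> I g.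

(** The Zariski tangent space of [I] at Om0. *)
Definition normal (v : 'rV[C]_N) :=
  forall g, I g -> \sum_i v 0 i * meval (crd Om0) (mderiv i g) = 0.

Definition deformation (v : 'rV[C]_N) := exists B Om1, base Om1 /\
  forall i, v 0 i = crd (of_ent (lie B Om0) + Om1) i.

Lemma deformation_normal v : deformation v -> normal v.
Proof.
move=> [B [Om1 [b1 vE]]] g Ig; have [gam [gamE gam0]] := family_arc B b1.
have := deriv_along gam g; rewrite (gam0 _ (I_family Ig)) deriv0.
move=> /(congr1 (fun P : {poly C} => P.[0])); rewrite horner0 horner_sum => e; rewrite [RHS]e {e}.
apply: eq_bigr => i _; rewrite hornerM !horner_coef0 coef_deriv mulr1n along_coef0 mulrC.
have [_ ->] := gamE i; rewrite vE; congr (_ * _); apply: meval_eq => j.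
by have [-> _] := gamE j.
Qed.

(** [I] contains the coordinates of wrong degree or shape and the Frobenius coefficients; the
    vanishing of their differentials on [v] gives the three conclusions. *)
Lemma normal_form v : normal v -> let eta := form_of (fun i => v 0 i) in
  [/\ is_kform 2 eta, forall J, eta J \is homog 4 &
    forall a i j k l, frobq Om0 eta a i j k l + frobq eta Om0 a i j k l = 0].
Proof.
move=> nv eta; have [_ h0 _ _] := b0.
have v0 (i : 'I_N) : (#|(enum_val i).1| != 2%N) || (mdeg (bmnm (enum_val i).2) != 4) -> v 0 i = 0.
  move=> vi; rewrite -(meval_mderivXU (crd Om0) (fun i => v 0 i) i); apply: nv.
  apply: I_foliations => Om k h _; rewrite mevalXU /coordinates.
  have [c2|c2] := eqVneq #|(enum_val i).1| 2%N; last by rewrite k // mcoeff0.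
  by apply: (homog_coef0 (h _)); rewrite c2 eqxx in vi.
split.
- move=> J J2; rewrite sum_ffunE big1 // => i _; rewrite !ffunE; case: eqP => [e|_].
    by rewrite v0 ?scale0r // -e J2.
  by rewrite scaler0.
- move=> J; rewrite sum_ffunE; apply: rpred_sum => i _; rewrite !ffunE; case: eqP => _.
    have [m4|m4] := eqVneq (mdeg (bmnm (enum_val i).2)) 4.
      by apply: dhomogZ; rewrite dhomogX; apply/eqP.
    by rewrite v0 ?scale0r ?rpred0 // m4 orbT.
  by rewrite scaler0 rpred0.
move=> a i j k l; apply/mpolyP => m; rewrite mcoeff0 addrC.
have [gE dE] := deriv_bilinear m (crd Om0) (fun x => v 0 x)
  (frobqDl a i j k l) (frobqDr a i j k l).
rewrite -[Om0 in LHS](form_of_crd h0) -dE; apply: nv; apply: I_foliations => Om k2 h4 fr.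
by rewrite gE form_of_crd // -/(frobp _ _ _ _ _ _) [frobq _ _ _ _ _ _ _]fr mcoeff0.
Qed.

Lemma deformation_linear c v w : deformation v -> deformation w -> deformation (c *: v + w).
Proof.
move=> [B1 [Om1 [b1 vE]]] [B2 [Om2 [b2 wE]]].
exists (c *: B1 + B2), (c *: Om1 + Om2); split; first exact: baseD.
move=> i; rewrite !mxE vE wE -crdD; congr crd.
have dlinD P : dlin (c *: B1 + B2) P = c *: dlin B1 P + dlin B2 P.
  rewrite /dlin scaler_sumr -big_split; apply: eq_bigr => x _ /=.
  rewrite scalerAl -mulrDl scaler_sumr -big_split; congr (_ * _).
  by apply: eq_bigr => h _; rewrite !mxE scalerDl scalerA.
have lieD k l : lie (c *: B1 + B2) Om0 k l = c *: lie B1 Om0 k l + lie B2 Om0 k l.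
  rewrite /lie dlinD scalerDr addrACA; congr (_ + _).
  rewrite scaler_sumr -big_split; apply: eq_bigr => x _ /=.
  by rewrite !mxE !scalerDl scalerDr !scalerA addrACA.
apply/ffunP => J; rewrite !ffunE; case: (enum J) => [|k [|l []]]; rewrite ?lieD ?add0r ?scalerDr //.
by rewrite addrACA.
Qed.

Lemma deformation0 : deformation 0.
Proof.
exists 0, 0; split=> [|i]; first exact: base0.
have l0 k l : lie 0 Om0 k l = 0.
  rewrite /lie /dlin !big1 ?addr0 // => x _; first by rewrite !mxE !scale0r addr0.
  by rewrite big1 ?mul0r // => h _; rewrite mxE scale0r.
rewrite addr0 mxE /coordinates ffunE; case: (enum _) => [|k [|l []]]; rewrite ?l0 ?mcoeff0 //.
Qed.

(** The deformations T are contained in the tangent space K. A vector of K orthogonal to T is a form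
    [eta] as in [rigid], hence zero, and [sub_orthogonal] gives K = T. *)
Lemma normal_deformation v : normal v -> deformation v.
Proof.
have normalD a u w : normal u -> normal w -> normal (a *: u + w).
  move=> nu nw g Ig; have := nu g Ig; have := nw g Ig => w0 u0.
  under eq_bigr => i _ do rewrite !mxE mulrDl -mulrA.
  by rewrite big_split -mulr_sumr /= u0 w0 mulr0 addr0.
have normal0 : normal 0 by move=> g _; rewrite big1 // => i _; rewrite mxE mul0r.
have [K KP] := subspace_mx normal0 normalD.
have [T TP] := subspace_mx deformation0 deformation_linear.
have TK : (T <= K)%MS by apply/rV_subP => w /TP/deformation_normal/KP.
move=> /KP vK; apply/TP; apply: (submx_trans vK); apply: sub_orthogonal => // w /KP nw wT.
have orth u : deformation u -> \sum_i u 0 i * w 0 i = 0.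
  move=> /TP/submxP[x uE]; have : (u *m w^T) 0 0 = 0.
    have e : T *m w^T = 0 by rewrite -[T]trmxK -trmx_mul wT trmx0.
    by rewrite uE -mulmxA e mulmx0 mxE.
  by rewrite mxE => e; rewrite -[RHS]e; apply: eq_bigr => i _; rewrite mxE.
have [k h fr] := normal_form nw.
pose eta := form_of (fun i => w 0 i).
have crdE i : crd eta i = w 0 i by rewrite crd_form_of.
have d0 B Om1 : base Om1 -> dot (of_ent (lie B Om0) + Om1) eta = 0.
  move=> b1; rewrite -[RHS](orth (\row_i crd (of_ent (lie B Om0) + Om1) i)).
    by apply: eq_bigr => i _; rewrite mxE crdE.
  by exists B, Om1; split=> // i; rewrite mxE.
have e0 : eta = 0.
  apply: rig => // [B|Om1 b1].
    by have := d0 B 0 (base0 _ _ _ _ _ _); rewrite addr0.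
  have := d0 0 Om1 b1; suff -> : of_ent (lie 0 Om0) = 0 by rewrite add0r.
  have l0 i j : lie 0 Om0 i j = 0.
    rewrite /lie /dlin !big1 ?addr0 // => x _; first by rewrite !mxE !scale0r addr0.
    by rewrite big1 ?mul0r // => y _; rewrite mxE scale0r.
  by apply/ffunP => J; rewrite !ffunE; case: (enum J) => [|x [|y []]]; rewrite ?l0.
by apply/rowP => i; rewrite -crdE e0 mxE /coordinates ffunE mcoeff0.
Qed.

(** Tangent vectors are deformations, hence velocities of arcs in the family, which is what
    [rigid_at] asks for. *)
Lemma avoid_ideal g : on_family g -> exists2 u, meval (crd Om0) u != 0 & I (u * g).
Proof.
move=> gf; apply: rigid_at => // v nv.
have [|B [Om1 [b1 vE]]] := @normal_deformation (\row_i v i).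
  by move=> k /nv e; rewrite -[RHS]e; apply: eq_bigr => i _; rewrite mxE.
have [gam [gamE gam0]] := family_arc B b1; exists gam; split.
- by move=> i; have [-> ->] := gamE i; rewrite -vE mxE.
- exact: gam0.
by move=> k /I_family/gam0.
Qed.

End Ideal.

(** Let Y be irreducible and contain the closure, and let [h] be an equation of a closed set
    containing the family. With I the ideal of Y, [avoid_ideal] gives u * h in I with u nonzero at
    Om0. So Y is covered by the zeros of u and of [h]; it is not in the former, as it contains
    Om0. *)
Theorem rigid_component : is_foliation_component 3 Z.
Proof.
have cf := @closure_foliations C p q r s lam; have ci := closure_irreducible b0 g0.
split=> //.
move=> Y Yfol [_ Yirr] ZY; apply/seteqP; split=> // F YF W [clW fW].
have [E [Eh WE]] := clW; rewrite WE; split=> [|h Eh0 Om FOm]; first exact: Yfol.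
have [d hd] := Eh h Eh0.
have hf : on_family h.
  by move=> F' Om' /fW; rewrite WE => -[_ W0] FOm'; apply: W0 FOm'.
have fY F' : family F' -> Y F' by move=> fF; apply: ZY; have := sub_closure fF.
pose I g := forall F' Om', Y F' -> F' Om' -> meval (crd Om') g = 0.
have idI : is_ideal I.
  split=> [F' Om' _ _|x y Ix Iy F' Om' YF' FOm'|a x Ix F' Om' YF' FOm']; first exact: meval0.
    by rewrite mevalD (Ix F') ?(Iy F') ?addr0.
  by rewrite mevalM (Ix F') ?mulr0.
have [|g gfol|u u0 uh] := @avoid_ideal I idI _ _ h hf.
- by move=> g Ig F' Om' /fY; apply: Ig.
- move=> F' Om' YF' FOm'; have [k2 h4 fr _] := foliation_class (Yfol _ YF') FOm'.
  exact: gfol.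
(* Closed sets of classes are cut out by homogeneous equations, so [u] is replaced by a homogeneous
   part that is still nonzero at Om0. *)
have [k uk] : exists k, meval (crd Om0) (pihomog mdeg k u) != 0.
  apply: contrapT => nk; move/eqP: u0; apply.
  rewrite (pihomog_partitionE (leqnn (mmeasure mdeg u))) raddf_sum big1 // => k _.
  by apply/eqP/negPn/negP => e; apply: nk; exists k.
pose U := pihomog mdeg k u; have Uk : U \is homog k by apply: pihomogP.
pose V P := [set F | foliations 3 F /\ forall Om, F Om -> meval (crd Om) P = 0]%classic.
have clV P e : P \is homog e -> @foliations_closed C 3 (V P).
  move=> Pe; exists [set P]%classic; split=> [_ ->|]; first by exists e.
  apply/seteqP; split=> G [fG GP]; split=> //; first by move=> _ ->.
  by move=> Om'; apply: GP.
have [|YU|Yh] := Yirr _ _ (clV _ _ Uk) (clV _ _ hd).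
- move=> G YG; have fG := Yfol _ YG; have [Om1 [fOm1 GE]] := fG.
  have G1 : G Om1 by rewrite GE; exists 1; rewrite oner_neq0 scale1r.
  have [_ _ _ GZ] := foliation_class fG G1.
  have VG P e : P \is homog e -> meval (crd Om1) P = 0 -> V P G.
    move=> Pe P0; split=> // Om'; rewrite GE => -[c [_ ->]].
    by rewrite (meval_crdZ _ _ Pe) P0 mulr0.
  have [h0|h0] := eqVneq (meval (crd Om1) h) 0; first by right; apply: VG hd h0.
  left; apply: VG Uk _; apply: meval_pihomog => c c0.
  have := uh G _ YG (GZ c c0); rewrite mevalM (meval_crdZ _ _ hd) => /eqP.
  rewrite mulf_eq0 mulf_eq0 (negPf h0) orbF expf_eq0 (negPf c0) andbF orbF => /eqP e.
  by rewrite -[RHS]e; apply: meval_eq => i; rewrite crdZ.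
(* Y contains the class of Om0, where the chosen part of [u] does not vanish. *)
- have [_ /(_ Om0) e] := YU _ (fY _ (family0 b0 g0)); move: uk.
  by rewrite e ?eqxx //; exists 1; rewrite oner_neq0 scale1r.
by have [_] := Yh _ YF; apply.
Qed.

End Rigid.
End Component.

(** * Polynomials as lists of terms *)

Section Terms.
Local Open Scope nat_scope.

(* A term is a list of exponents together with a coefficient in [A], on which
   the integers act by [sc]. *)
Definition terms (A : Type) := seq (seq nat * A).

Variables (A : Type) (sc : BinNums.Z -> A -> A).
Implicit Types (P : terms BinNums.Z) (L : terms A).

Fixpoint add_exp (m n : seq nat) : seq nat :=
  match m, n with
  | a :: m', b :: n' => (a + b) :: add_exp m' n'
  | [::], _ => n
  | _, [::] => m
  end.

Definition tmul P L : terms A :=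
  flatten [seq [seq (add_exp x.1 y.1, sc x.2 y.2) | y <- L] | x <- P].
Definition topp L : terms A := [seq (x.1, sc (Z.neg xH) x.2) | x <- L].
Definition tder j L : terms A :=
  [seq (set_nth 0 x.1 j (nth 0 x.1 j).-1, sc (Z.of_nat (nth 0 x.1 j)) x.2)
  | x <- L & nth 0 x.1 j != 0].
Definition tdent (E : nat -> nat -> terms A) j k l : terms A :=
  tder j (E k l) ++ topp (tder k (E j l)) ++ tder l (E j k).

End Terms.

Section TermValues.
Variables (C : numClosedFieldType) (n : nat).
Local Notation poly := {mpoly C[n]}.

Definition zc (z : BinNums.Z) : C := (int_of_Z z)%:~R.

Lemma zcM a b : zc (Z.mul a b) = zc a * zc b.
Proof. by rewrite /zc (rmorphM int_of_Z) rmorphM. Qed.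

Lemma zcD a b : zc (Z.add a b) = zc a + zc b.
Proof. by rewrite /zc (rmorphD int_of_Z) rmorphD. Qed.

Lemma zcN a : zc (Z.opp a) = - zc a.
Proof. by rewrite /zc (rmorphN int_of_Z) rmorphN. Qed.

Lemma zcN1 : zc (Z.neg xH) = -1. Proof. by []. Qed.

Lemma zc_nat k : zc (Z.of_nat k) = k%:R.
Proof. by rewrite /zc (_ : int_of_Z _ = k%:Z) //; case: k => //= k; rewrite SuccNat2Pos.id_succ. Qed.

Lemma zc_eq0 z : zc z = 0 -> z = Z0.
Proof.
move/eqP; rewrite intr_eq0 => /eqP z0; apply: (can_inj int_of_ZK); by rewrite z0.
Qed.

(** Only the first [n] exponents are read: reading five-variable terms with n = 4 sets x_5 = 1. *)
Definition mon (m : seq nat) : multinom n := Multinom [tuple nth 0%N m i | i < n].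

Lemma monE m i : mon m i = nth 0%N m i.
Proof. by rewrite multinomE tnth_mktuple. Qed.

Section Values.
Variables (A : Type) (sc : BinNums.Z -> A -> A) (val : A -> C).
Hypothesis val_sc : forall c a, val (sc c a) = zc c * val a.
Implicit Types (P : terms BinNums.Z) (L : terms A).

Definition tev L : poly := \sum_(x <- L) val x.2 *: 'X_[mon x.1].

Lemma tev_cat L1 L2 : tev (L1 ++ L2) = tev L1 + tev L2.
Proof. by rewrite /tev big_cat. Qed.

Lemma tev_flatten (I : Type) (s : seq I) (F : I -> terms A) :
  tev (flatten [seq F i | i <- s]) = \sum_(i <- s) tev (F i).
Proof.
elim: s => [|i s IHs] /=; first by rewrite /tev !big_nil.
by rewrite big_cons tev_cat IHs.
Qed.

Lemma tev_opp L : tev (topp sc L) = - tev L.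
Proof.
rewrite /tev big_map -sumrN; apply: eq_bigr => x _ /=.
by rewrite val_sc zcN1 mulN1r scaleNr.
Qed.

Lemma mon_add m1 m2 : mon (add_exp m1 m2) = mnm_add (mon m1) (mon m2).
Proof.
apply/mnmP => i; rewrite mnmDE !monE.
elim: m1 m2 (i : nat) => [|a m1 IHm] [|b m2] [|k] //=; rewrite ?nth_nil ?addn0 //.
Qed.

Lemma tev_der (i : 'I_n) L : tev (tder sc i L) = mderiv i (tev L).
Proof.
rewrite /tev big_map big_filter raddf_sum [LHS]big_mkcond; apply: eq_bigr => x _ /=.
rewrite mderivZ mderivX monE; case: (eqVneq (nth 0%N x.1 i) 0%N) => [->|mi].
  by rewrite scale0r scaler0.
rewrite val_sc zc_nat scalerA mulrC; congr (_ *: mpolyX _ _).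
apply/mnmP => j; rewrite mnmBE mnm1E !monE nth_set_nth /=.
by rewrite -val_eqE eq_sym /=; case: eqP => [->|_]; rewrite ?subn1 ?subn0.
Qed.

End Values.

Variables (A : Type) (sc : BinNums.Z -> A -> A) (val : A -> C).
Hypothesis val_sc : forall c a, val (sc c a) = zc c * val a.

Lemma tev_mul P (L : terms A) : tev val (tmul sc P L) = tev zc P * tev val L.
Proof.
rewrite tev_flatten /tev mulr_suml; apply: eq_bigr => x _; rewrite big_map mulr_sumr.
apply: eq_bigr => y _ /=; rewrite val_sc mon_add mpolyXD -scalerAl -scalerAr scalerA.
by rewrite mulrC -scalerA scalerA mulrC.
Qed.

End TermValues.

(** * Linear systems as lists of rows *)

Section Rows.
Local Open Scope nat_scope.

(* Unary digits, ended by a zero bit. *)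
Fixpoint code (s : seq nat) : positive :=
  if s is n :: s' then iter n xI (xO (code s')) else xH.

Fixpoint decode (p : positive) : seq nat :=
  match p with
  | xH => [::]
  | xO p' => 0 :: decode p'
  | xI p' => if decode p' is n :: s then n.+1 :: s else [::]
  end.

Lemma codeK : cancel code decode.
Proof. by elim=> [|n s IHs] //=; elim: n => [|n IHn] /=; rewrite ?IHs ?IHn. Qed.

Definition linear_row := seq (positive * BinNums.Z).

(** c r + d s for sparse rows listed by increasing key. The inner fixpoint recurses on the second
    row alone, which keeps the merge structural. *)
Fixpoint lcomb (c : BinNums.Z) (r : linear_row) (d : BinNums.Z) : linear_row -> linear_row :=
  fix aux (s : linear_row) : linear_row :=
  match r, s with
  | [::], _ => [seq (x.1, Z.mul d x.2) | x <- s]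
  | _, [::] => [seq (x.1, Z.mul c x.2) | x <- r]
  | (k, a) :: r', (l, b) :: s' =>
      match Pos.compare k l with
      | Lt => (k, Z.mul c a) :: lcomb c r' d s
      | Gt => (l, Z.mul d b) :: aux s'
      | Eq => let e := Z.add (Z.mul c a) (Z.mul d b) in
              if Z.eqb e Z0 then lcomb c r' d s' else (k, e) :: lcomb c r' d s'
      end
  end.

Definition z1 := Zpos xH.

Definition content (r : linear_row) := foldr (fun x g => Z.gcd x.2 g) Z0 r.
Definition primitive (r : linear_row) : linear_row := let g := content r in
  if Z.eqb g z1 then r else [seq (x.1, Z.div x.2 g) | x <- r].

Definition pivots := PositiveMap.t linear_row.

(** Integer Gaussian elimination: the leading unknown of the row is cancelled against its pivot,
    with multipliers divided by their gcd, until a new leading unknown appears. *)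
Fixpoint reduce fuel (T : pivots) (r : linear_row) : pivots :=
  if fuel is f.+1 then
    match r with
    | [::] => T
    | (k, c) :: _ =>
      match PositiveMap.find k T with
      | Some (((_, d) :: _) as s) =>
          let g := Z.gcd c d in reduce f T (lcomb (Z.div d g) r (Z.opp (Z.div c g)) s)
      | _ => PositiveMap.add k (primitive r) T
      end
    end
  else T.

(* Short rows first, which keeps the elimination sparse. *)
Definition by_length (rows : seq linear_row) :=
  flatten [seq [seq r <- rows | size r == n] | n <- iota 1 60].

(** Empty rows, rows longer than 60 and rows for which the fuel runs out are dropped. This only
    loses equations, so the unknowns found to vanish do vanish. *)
Definition eliminate fuel (rows : seq linear_row) : pivots :=
  foldl (reduce fuel) (PositiveMap.empty linear_row) (by_length rows).

Definition solve1 (T : pivots) (k : positive) (S : PositiveMap.t unit) :=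
  match PositiveMap.find k T with
  | Some ((l, c) :: r) =>
      if [&& Pos.eqb k l, ~~ Z.eqb c Z0 & all (fun x => PositiveMap.mem x.1 S) r]
      then PositiveMap.add k tt S else S
  | _ => S
  end.

(** Back substitution: the right fold treats the largest keys first, and an unknown is zero once all
    other unknowns in its pivot row are known to be zero. *)
Definition solve (T : pivots) (keys : seq positive) :=
  foldr (solve1 T) (PositiveMap.empty unit) (sort Pos.leb keys).

End Rows.

Section RowValues.
Variables (C : numClosedFieldType) (e : positive -> C).
Local Notation zc := (zc C).

Definition row_value (r : linear_row) : C := \sum_(x <- r) e x.1 * zc x.2.

Lemma rev_nil : row_value [::] = 0. Proof. by rewrite /row_value big_nil. Qed.
Lemma rev_cons x r : row_value (x :: r) = e x.1 * zc x.2 + row_value r.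
Proof. by rewrite /row_value big_cons. Qed.

Lemma rev_scale c r : row_value [seq (x.1, Z.mul c x.2) | x <- r] = zc c * row_value r.
Proof.
rewrite /row_value big_map mulr_sumr; apply: eq_bigr => x _ /=; rewrite zcM; ring.
Qed.

Lemma rev_lcomb c r d s : row_value (lcomb c r d s) = zc c * row_value r + zc d * row_value s.
Proof.
elim: r s => [|[k a] r IHr] s.
  by rewrite rev_nil mulr0 add0r -rev_scale; case: s.
elim: s => [|[l b] s IHs] /=.
  by rewrite rev_nil mulr0 addr0 rev_cons rev_scale rev_cons /= zcM; ring.
case: (Pos.compare_spec k l) => [<-|_|_].
- have E : zc c * row_value ((k, a) :: r) + zc d * row_value ((k, b) :: s) =
      e k * zc (Z.add (Z.mul c a) (Z.mul d b)) + (zc c * row_value r + zc d * row_value s).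
    by rewrite !rev_cons zcD !zcM /=; ring.
  rewrite E; case: (Z.eqb_spec _ Z0) => [->|_]; last by rewrite rev_cons IHr.
  by rewrite IHr mulr0 add0r.
- by rewrite !rev_cons IHr !rev_cons /= zcM; ring.
by rewrite rev_cons IHs !rev_cons /= zcM; ring.
Qed.

#[global] Arguments lcomb : simpl never.

Lemma content_dvd r : forall x, List.In x r -> Z.divide (content r) x.2.
Proof.
elim: r => [|y r IHr] x //= [->|/IHr].
  exact: Z.gcd_divide_l.
by apply: Z.divide_trans; apply: Z.gcd_divide_r.
Qed.

Lemma rev_div g r : g <> Z0 -> (forall x, List.In x r -> Z.divide g x.2) ->
  row_value r = zc g * row_value [seq (x.1, Z.div x.2 g) | x <- r].
Proof.
move=> g0; elim: r => [|x r IHr] dv; first by rewrite /= rev_nil mulr0.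
rewrite /= !rev_cons IHr /= => [|y yr]; last by apply: dv; right.
have /(Z.div_exact _ _ g0) {1}-> : Z.modulo x.2 g = Z0.
  by apply/Z.mod_divide => //; apply: dv; left.
by rewrite zcM; ring.
Qed.

Lemma zc0 : zc Z0 = 0. Proof. by rewrite /zc mulr0z. Qed.

Lemma rev_primitive r : row_value r = 0 -> row_value (primitive r) = 0.
Proof.
move=> r0; rewrite /primitive; case: ifP => // _.
have [g0|g0] := Z.eq_dec (content r) Z0.
  by rewrite /row_value big_map big1 // => x _ /=; rewrite g0 Zdiv_0_r zc0 mulr0.
move/eqP: r0; rewrite (rev_div g0 (@content_dvd r)) mulf_eq0.
by move=> /orP[/eqP/zc_eq0 //|/eqP].
Qed.

Definition pivots_ok (T : pivots) := forall k r, PositiveMap.find k T = Some r -> row_value r = 0.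

Fixpoint rows_ok (rows : seq linear_row) :=
  if rows is r :: rows' then row_value r = 0 /\ rows_ok rows' else True.

Lemma add_ok k r T : row_value r = 0 -> pivots_ok T -> pivots_ok (PositiveMap.add k r T).
Proof.
move=> r0 T0 l s; have [->|lk] := Pos.eq_dec l k.
  by rewrite PositiveMap.gss => -[<-].
by rewrite PositiveMap.gso //; apply: T0.
Qed.

Lemma reduce_ok fuel T r : row_value r = 0 -> pivots_ok T -> pivots_ok (reduce fuel T r).
Proof.
elim: fuel T r => [|f IHf] T [|[k c] r] //= r0 T0.
case E: (PositiveMap.find k T) => [[|[l d] s]|]; try exact/add_ok/T0/rev_primitive.
by apply: IHf => //; rewrite rev_lcomb r0 (T0 _ _ E) !mulr0 addr0.
Qed.

Lemma rows_ok_cat rows1 rows2 : rows_ok (rows1 ++ rows2) <-> rows_ok rows1 /\ rows_ok rows2.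
Proof. by elim: rows1 => [|r rows1 IH] /=; [split=> [|[]]|rewrite IH; tauto]. Qed.

Lemma rows_ok_flatten (I : Type) (P : pred I) (s : seq I) (F : I -> seq linear_row) :
  all P s -> (forall i, P i -> rows_ok (F i)) -> rows_ok (flatten [seq F i | i <- s]).
Proof.
move=> sP F0; elim: s sP => //= i s IHs /andP[/F0 i0 /IHs s0]; exact/rows_ok_cat.
Qed.

Lemma rows_ok_filter P rows : rows_ok rows -> rows_ok [seq r <- rows | P r].
Proof. by elim: rows => //= r rows IH [r0 /IH]; case: (P r). Qed.

Lemma eliminate_ok fuel rows : rows_ok rows -> pivots_ok (eliminate fuel rows).
Proof.
move=> ok; rewrite /eliminate; have : rows_ok (by_length rows).
  by apply: (@rows_ok_flatten _ predT); rewrite ?all_predT // => n _; apply: rows_ok_filter.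
have : pivots_ok (PositiveMap.empty linear_row) by move=> k r; rewrite PositiveMap.gempty.
elim: (by_length rows) (PositiveMap.empty linear_row) => //= r s IHs T T0 [r0 /IHs]; apply.
exact: reduce_ok.
Qed.

Lemma solve_ok T keys : pivots_ok T ->
  forall k, PositiveMap.mem k (solve T keys) -> e k = 0.
Proof.
move=> T0; rewrite /solve; elim: (sort _ _) => [|k s IHs] l /=.
  by rewrite PositiveMap.mem_find PositiveMap.gempty.
rewrite /solve1; case E: (PositiveMap.find k T) => [[|[k' c] r]|]; try exact: IHs.
case: ifP => [/and3P[/Pos.eqb_eq kk' c0 rS]|_]; last exact: IHs.
have r0 : row_value r = 0.
  elim: r rS {E} => [|x r IHr] /=; first by rewrite rev_nil.
  by move=> /andP[/IHs x0 /IHr r0]; rewrite rev_cons x0 r0 mul0r addr0.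
rewrite PositiveMap.mem_find; have [->|lk] := Pos.eq_dec l k; last first.
  by rewrite PositiveMap.gso // -PositiveMap.mem_find; apply: IHs.
move=> _; have := T0 _ _ E; rewrite rev_cons r0 addr0 -kk' /= => /eqP.
rewrite mulf_eq0 => /orP[/eqP //|/eqP/zc_eq0 cZ]; by rewrite cZ in c0.
Qed.

End RowValues.

Section Unknowns.
Local Open Scope nat_scope.

Definition normal_exp n (m : seq nat) := [seq nth 0 m i | i <- iota 0 n].

Definition row_at (T : pivots) k : linear_row := if PositiveMap.find k T is Some r then r else [::].

(* The coefficients, which are linear forms, of the monomials in [n] variables. *)
Definition collect n (L : terms (positive * BinNums.Z)) : pivots :=
  foldr (fun x T => let k := code (normal_exp n x.1) in
    PositiveMap.add k (lcomb z1 [:: x.2] z1 (row_at T k)) T) (PositiveMap.empty linear_row) L.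

Definition rows_of (T : pivots) : seq linear_row := [seq x.2 | x <- PositiveMap.elements T].

(** Integer coefficients are collected as multiples of one dummy unknown [xH], which is later given
    the value 1. *)
Definition vanish n (L : terms BinNums.Z) : bool :=
  all (fun r => all (fun x => Z.eqb x.2 Z0) r)
    (rows_of (collect n [seq (x.1, (xH, x.2)) | x <- L])).

Definition scale_unknown (c : BinNums.Z) (u : positive * BinNums.Z) := (u.1, Z.mul c u.2).

Fixpoint monos n d : seq (seq nat) :=
  if n is n'.+1 then flatten [seq [seq a :: m | m <- monos n' (d - a)] | a <- iota 0 d.+1]
  else if d is 0 then [:: [::]] else [::].

(* The entries of a 2-form with unknown coefficients. *)
Definition unknown k l : terms (positive * BinNums.Z) :=
  if k < l then [seq (m, (code (k :: l :: m), z1)) | m <- monos 5 4]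
  else if l < k then [seq (m, (code (l :: k :: m), Z.opp z1)) | m <- monos 5 4]
  else [::].

Definition pairs n := [seq u <- [seq (i, j) | i <- iota 0 n, j <- iota 0 n] | u.1 < u.2].

Definition unknowns : seq positive :=
  flatten [seq [seq code (u.1 :: u.2 :: m) | m <- monos 5 4] | u <- pairs 5].

Definition solved (T : pivots) := let S := solve T unknowns in
  all (fun u => all (fun m => PositiveMap.mem (code (u.1 :: u.2 :: m)) S) (monos 5 4)) (pairs 5).

Lemma mem_monos n d m : (m \in monos n d) = (size m == n) && (sumn m == d).
Proof.
have monosS k b : monos k.+1 b = flatten [seq [seq a :: m' | m' <- monos k (b - a)] | a <- iota 0 b.+1].
  by [].
elim: n d m => [|n IHn] d [|a m]; rewrite ?monosS; try by case: d.
  by apply/negbTE/negP => /flatten_mapP[b _ /mapP[]].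
apply/flatten_mapP/idP => [[b]|/andP[sm /eqP <-]].
  rewrite mem_iota add0n /= ltnS => bd /mapP[m' + [-> ->]].
  by rewrite IHn eqSS => /andP[-> /eqP ->]; rewrite subnKC ?eqxx.
exists a; first by rewrite mem_iota /= ltnS leq_addr.
by apply/mapP; exists m => //; rewrite IHn addKn eqxx andbT.
Qed.

Lemma mem_pairs n i j : ((i, j) \in pairs n) = [&& i < j & j < n].
Proof.
rewrite mem_filter /=; apply: andb_id2l => ij; apply/allpairsP/idP => [[[a b] /= [_ + [_ ->]]]|jn].
  by rewrite mem_iota.
by exists (i, j); rewrite !mem_iota /= jn (ltn_trans ij).
Qed.

End Unknowns.

Section UnknownValues.
Variables (C : numClosedFieldType) (n : nat).
Implicit Types (m : seq nat) (e : positive -> C).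
Local Notation mon := (mon n).

Lemma normal_mon m1 m2 : (normal_exp n m1 == normal_exp n m2) = (mon m1 == mon m2).
Proof.
apply/eqP/eqP => [E|E].
  apply/mnmP => i; rewrite !monE; have := congr1 (nth 0%N ^~ i) E.
  by rewrite !(nth_map 0%N) ?size_iota // nth_iota.
apply: (@eq_from_nth _ 0%N); first by rewrite !size_map.
move=> i; rewrite size_map size_iota => ni; rewrite !(nth_map 0%N) ?size_iota // nth_iota //.
by have := congr1 (fun M : multinom n => M (Ordinal ni)) E; rewrite !monE.
Qed.

Lemma normal_idem m : normal_exp n (normal_exp n m) = normal_exp n m.
Proof.
apply/eqP; rewrite normal_mon; apply/eqP/mnmP => i; rewrite !monE.
by rewrite (nth_map 0%N) ?size_iota // nth_iota.
Qed.

Lemma mon_tval (M : multinom n) : mon (val M) = M.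
Proof. by apply/mnmP => i; rewrite monE; case: M => t; rewrite multinomE (tnth_nth 0%N). Qed.

Lemma code_eqb m1 m2 :
  Pos.eqb (code (normal_exp n m1)) (code (normal_exp n m2)) = (mon m1 == mon m2).
Proof.
rewrite -normal_mon; apply/idP/eqP => [/Pos.eqb_eq/(can_inj codeK) //|->].
exact: Pos.eqb_refl.
Qed.

Definition uval e (u : positive * BinNums.Z) : C := e u.1 * zc C u.2.

Lemma uval_scale e c u : uval e (scale_unknown c u) = zc C c * uval e u.
Proof. by rewrite /uval zcM /=; ring. Qed.

Lemma rev_collect e L k : row_value e (row_at (collect n L) k) =
  \sum_(x <- L | Pos.eqb (code (normal_exp n x.1)) k) uval e x.2.
Proof.
elim: L => [|x L IHL] /=; first by rewrite /row_at PositiveMap.gempty rev_nil big_nil.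
rewrite big_cons -IHL {1}/row_at; case: (Pos.eqb_spec _ k) => [->|xk]; last first.
  by rewrite PositiveMap.gso => [|/esym].
by rewrite PositiveMap.gss rev_lcomb rev_cons rev_nil /uval (_ : zc C z1 = 1) //; ring.
Qed.

Lemma coef_tev A (val : A -> C) L m :
  (tev n val L)@_(mon m) = \sum_(x <- L | Pos.eqb (code (normal_exp n x.1)) (code (normal_exp n m))) val x.2.
Proof.
rewrite raddf_sum [RHS]big_mkcond; apply: eq_bigr => x _.
by rewrite /= mcoeffZ mcoeffX code_eqb; case: eqP; rewrite ?mulr1 ?mulr0.
Qed.

Lemma rows_of_ok e T : (forall k, row_value e (row_at T k) = 0) -> rows_ok e (rows_of T).
Proof.
move=> T0; rewrite /rows_of; have : forall x, List.In x (PositiveMap.elements T) -> row_value e x.2 = 0.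
  move=> [k r] kr; have kE := PositiveMap.elements_complete _ _ _ kr.
  by have := T0 k; rewrite /row_at kE.
elim: (PositiveMap.elements T) => //= x s IHs h; split; first by apply: h; left.
by apply: IHs => y ys; apply: h; right.
Qed.

Lemma collect_ok e L : tev n (uval e) L = 0 -> rows_ok e (rows_of (collect n L)).
Proof.
move=> L0; apply: rows_of_ok => k; rewrite rev_collect.
(* A key that is not the code of a normalized exponent list collects no term. *)
have [kE|kE] := Pos.eq_dec (code (normal_exp n (decode k))) k.
  by have := coef_tev (uval e) L (decode k); rewrite L0 mcoeff0 kE.
rewrite big1 // => x /Pos.eqb_eq xk; case: kE.
by rewrite -xk codeK normal_idem.
Qed.

Lemma vanishP L : vanish n L -> tev n (zc C) L = 0.
Proof.
move=> v; apply/mpolyP => M; rewrite mcoeff0 -[M]mon_tval coef_tev.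
move: v; rewrite /vanish; set L' := [seq (x.1, (xH, x.2)) | x <- L] => v.
have := rev_collect (fun=> 1) L' (code (normal_exp n (val M))).
rewrite big_map; under eq_bigr => x _ do rewrite /uval mul1r.
move=> <-; rewrite /row_at; case E: (PositiveMap.find _ _) => [r|]; last by rewrite rev_nil.
have rin : List.In r (rows_of (collect n L')).
  have := PositiveMap.elements_correct _ _ E; rewrite /rows_of.
  elim: (PositiveMap.elements _) => //= x s IHs [->|/IHs]; [by left|by right].
have : all (fun x => Z.eqb x.2 Z0) r.
  elim: (rows_of _) rin v => //= y s IHs [->|/IHs h] /andP[] // _ /h.
elim: r {E rin} => [|x r IHr] /=; first by rewrite rev_nil.
by move=> /andP[/Z.eqb_eq x0 /IHr r0]; rewrite rev_cons x0 r0 zc0 mulr0 addr0.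
Qed.

Lemma homog_monos d (P : {mpoly C[n]}) : P \is homog d -> uniq (monos n d) ->
  \sum_(m <- monos n d) P@_(mon m) *: 'X_[mon m] = P.
Proof.
move=> Pd un; apply/mpolyP => M; rewrite raddf_sum /=.
under eq_bigr => m _ do rewrite mcoeffZ mcoeffX.
have [Md|Md] := eqVneq (mdeg M) d; last first.
  rewrite (homog_coef0 Pd Md) big1 // => m _; case: eqP => [->|_]; last by rewrite mulr0.
  by rewrite (homog_coef0 Pd Md) mul0r.
have MM : tval (val M) \in monos n d.
  rewrite mem_monos size_tuple eqxx -Md mdegE sumnE; apply/eqP.
  by rewrite big_tuple; apply: eq_bigr => i _; case: (M).
rewrite (bigD1_seq _ MM un) /= mon_tval eqxx mulr1 big_seq_cond big1 ?addr0 // => m.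
rewrite mem_monos => /andP[/andP[/eqP sm _] mM]; case: eqP => [E|_]; last by rewrite mulr0.
case/eqP: mM; apply: (@eq_from_nth _ 0%N); first by rewrite size_tuple.
move=> i; rewrite sm => ni; have := congr1 (fun N : multinom n => N (Ordinal ni)) E.
by rewrite monE => ->; case: (M) => t; rewrite multinomE (tnth_nth 0%N).
Qed.

End UnknownValues.

(** * The infinitesimal certificate *)

Section FrobRows.
Local Open Scope nat_scope.
Variable E : nat -> nat -> terms BinNums.Z.

(** The Frobenius expression linearized at the form listed by [E], applied to the unknown 2-form. *)
Definition tfrob v i j k l : terms (positive * BinNums.Z) :=
  let F := unknown in let sc := scale_unknown in
  let M a b D := tmul sc (E a b) D in let D := tdent sc F in
  let D0 := tdent Z.mul E in
  (M v i (D j k l) ++ topp sc (M v j (D i k l)) ++ M v k (D i j l) ++ topp sc (M v l (D i j k)))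
  ++ (tmul sc (D0 j k l) (F v i) ++ topp sc (tmul sc (D0 i k l) (F v j))
  ++ tmul sc (D0 i j l) (F v k) ++ topp sc (tmul sc (D0 i j k) (F v l))).

(* These instances of the Frobenius equations turn out to be enough. *)
Definition frob_indices : seq (nat * (nat * nat * nat * nat)) :=
  [:: (1, (0, 1, 2, 3)); (2, (0, 1, 2, 3)); (3, (0, 1, 2, 4));
      (4, (0, 1, 3, 4)); (4, (0, 1, 2, 4)); (4, (0, 1, 2, 3))].

Definition frob_rows : seq linear_row :=
  flatten [seq (let: (i, j, k, l) := u.2 in rows_of (collect 5 (tfrob u.1 i j k l)))
          | u <- frob_indices].

Definition dot_row (F : nat -> nat -> terms BinNums.Z) : linear_row :=
  foldr (fun x r => lcomb z1 [:: x] z1 r) [::]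
    (flatten [seq [seq (code (u.1 :: u.2 :: x.1), x.2) | x <- F u.1 u.2] | u <- pairs 5]).

Definition var b : seq nat := [seq (i == b : nat) | i <- iota 0 5].

(** The Lie derivative along x_b d/dx_a; these fields form a basis of gl_5. *)
Definition tlie a b k l : terms BinNums.Z :=
  tmul Z.mul [:: (var b, z1)] (tder Z.mul a (E k l))
  ++ (if k == b then E a l else [::]) ++ (if l == b then E k a else [::]).

Definition upper A (sc : BinNums.Z -> A -> A) (F : nat -> nat -> terms A) k l : terms A :=
  if k < l then F k l else if l < k then topp sc (F l k) else [::].

End FrobRows.

Lemma sum_pairs n (V : nmodType) (G : nat * nat -> V) :
  \sum_(u <- pairs n) G u = \sum_(p : 'I_n * 'I_n | (p.1 < p.2)%N) G (val p.1, val p.2).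
Proof.
rewrite /pairs big_filter big_mkcond big_allpairs /=.
have E (H : nat -> V) : \sum_(i <- iota 0 n) H i = \sum_(i < n) H i.
  by rewrite -(big_mkord xpredT H) /index_iota subn0.
rewrite E.
transitivity (\sum_(i < n) \sum_(j < n) (if (i < j)%N then G (val i, val j) else 0)).
  by apply: eq_bigr => i _; exact: E.
by rewrite pair_big [RHS]big_mkcond.
Qed.

Section FrobRowValues.
Variable C : numClosedFieldType.
Implicit Types (Om : form 5 {mpoly C[5]}) (B : 'M[C]_5).
Local Notation zv := (tev 5 (zc C)).

(* [E] lists the terms of the entries of [Om]. *)
Definition lists (E : nat -> nat -> terms BinNums.Z) Om :=
  forall k l : 'I_5, zv (E k l) = ent Om k l.

Lemma tev_dent A (sc : BinNums.Z -> A -> A) (val : A -> C) (F : nat -> nat -> terms A) Om :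
  (forall c a, val (sc c a) = zc C c * val a) -> (forall k l : 'I_5, tev 5 val (F k l) = ent Om k l) ->
  forall j k l : 'I_5, tev 5 val (tdent sc F j k l) = dent Om j k l.
Proof.
move=> vs FE j k l; rewrite !tev_cat tev_opp // !tev_der // !FE /dent.
by rewrite addrA.
Qed.

(** The assignment of the unknowns given by [eta], with [decode] inverting the keys used in
    [unknown]. *)
Definition coef_of (eta : form 5 {mpoly C[5]}) (x : positive) : C :=
  if decode x is k :: l :: m then (ent eta (inord k) (inord l))@_(mon 5 m) else 0.

Lemma coef_ofE eta (k l : 'I_5) m : coef_of eta (code (val k :: val l :: m)) = (ent eta k l)@_(mon 5 m).
Proof. by rewrite /coef_of codeK !inord_val. Qed.

Lemma monos54 : uniq (monos 5 4). Proof. by vm_compute. Qed.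

Section Eta.
Variable eta : form 5 {mpoly C[5]}.
Hypotheses (k2 : is_kform 2 eta) (h4 : forall I, eta I \is homog 4).
Local Notation e := (coef_of eta).
Local Notation uv := (tev 5 (uval e)).

Lemma tev_unknown (k l : 'I_5) : uv (unknown k l) = ent eta k l.
Proof.
have H (i j : 'I_5) c : uv [seq (m, (code [:: val i, val j & m], c)) | m <- monos 5 4] =
    zc C c *: ent eta i j.
  rewrite -[in RHS](homog_monos (ent_homog i j h4) monos54) /tev big_map scaler_sumr.
  by apply: eq_bigr => m _ /=; rewrite /uval /= coef_ofE scalerA mulrC.
rewrite /unknown; case: (ltngtP k l) => [kl|lk|/val_inj ->]; rewrite ?H.
- by rewrite (_ : zc C z1 = 1) ?scale1r.
- by rewrite (_ : zc C _ = -1) // scaleN1r -entN.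
by rewrite /tev big_nil entii.
Qed.

Lemma tev_frob E Om (v i j k l : 'I_5) : lists E Om ->
  uv (tfrob E v i j k l) = frobq Om eta v i j k l + frobq eta Om v i j k l.
Proof.
move=> EO; have vs := uval_scale e; have zs := @zcM C.
rewrite /tfrob !tev_cat !tev_opp // !tev_mul //.
rewrite !(tev_dent vs tev_unknown) !(tev_dent zs EO) !EO !tev_unknown /frobq.
move: (ent _ _ _) (ent _ _ _) (ent _ _ _) (ent _ _ _) (ent _ _ _) (ent _ _ _) (ent _ _ _) (ent _ _ _).
move: (dent _ _ _ _) (dent _ _ _ _) (dent _ _ _ _) (dent _ _ _ _) (dent _ _ _ _) (dent _ _ _ _) (dent _ _ _ _) (dent _ _ _ _) => *.
ring.
Qed.

Lemma frob_rows_ok E Om : lists E Om ->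
  (forall v i j k l, frobq Om eta v i j k l + frobq eta Om v i j k l = 0) ->
  rows_ok e (frob_rows E).
Proof.
move=> EO fr; have ok (v i j k l : 'I_5) : rows_ok e (rows_of (collect 5 (tfrob E v i j k l))).
  by apply: collect_ok; rewrite (tev_frob _ _ _ _ _ EO).
pose small (u : nat * (nat * nat * nat * nat)) := let: (i, j, k, l) := u.2 in
  [&& u.1 < 5, i < 5, j < 5, k < 5 & l < 5]%N.
apply: (rows_ok_flatten (P := small)) => // -[v [[[i j] k] l]] /and5P[v5 i5 j5 k5 l5].
exact: (ok (Ordinal v5) (Ordinal i5) (Ordinal j5) (Ordinal k5) (Ordinal l5)).
Qed.

Lemma tev_dot (F : nat -> nat -> terms BinNums.Z) Om : is_kform 2 Om ->
  (forall k l : 'I_5, (k < l)%N -> zv (F k l) = ent Om k l) -> row_value e (dot_row F) = dot Om eta.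
Proof.
move=> Om2 FO; rewrite /dot_row.
have -> L : row_value e (foldr (fun x r => lcomb z1 [:: x] z1 r) [::] L) = row_value e L.
  elim: L => //= x L IHL; rewrite rev_lcomb IHL !rev_cons rev_nil (_ : zc C z1 = 1) //.
  by rewrite addr0 !mul1r.
have revcat L1 L2 : row_value e (L1 ++ L2) = row_value e L1 + row_value e L2 by rewrite /row_value big_cat.
have revflat (I : Type) (s : seq I) (G : I -> linear_row) :
    row_value e (flatten [seq G i | i <- s]) = \sum_(i <- s) row_value e (G i).
  by elim: s => [|i s IHs] /=; rewrite ?big_nil ?rev_nil // big_cons revcat IHs.
rewrite revflat sum_pairs.
have cE (P Q : {mpoly C[5]}) L : Q \is homog 4 -> P = zv L ->
    \sum_(m : bmultinom 5 5) P@_m * Q@_m = \sum_(x <- L) zc C x.2 * Q@_(mon 5 x.1).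
  move=> Q4 ->; under eq_bigr => m _ do rewrite raddf_sum mulr_suml.
  rewrite exchange_big; apply: eq_bigr => x _ /=.
  under eq_bigr => m _ do rewrite mcoeffZ mcoeffX.
  have [x5|x5] := ltnP (mdeg (mon 5 x.1)) 5; last first.
    rewrite (@homog_coef0 _ _ _ _ _ Q4) ?gtn_eqF // mulr0 big1 // => m _.
    case: eqP => [E|_]; last by rewrite mulr0 mul0r.
    by move: x5; rewrite E leqNgt bmdeg.
  rewrite (bigD1 (BMultinom x5)) //= eqxx mulr1 big1 ?addr0 // => m mx.
  by case: eqP => [E|_]; [case/eqP: mx; apply: val_inj; rewrite /= E|rewrite mulr0 mul0r].
have -> : dot Om eta = \sum_(x : coord_index 3) (Om x.1)@_(bmnm x.2) * (eta x.1)@_(bmnm x.2).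
  rewrite /dot (reindex (@enum_rank (coord_index 3))) /=; last exact/onW_bij/enum_rank_bij.
  by apply: eq_bigr => x _; rewrite /coordinates enum_rankK.
rewrite -(pair_bigA _ (fun I m => (Om I)@_(bmnm m) * (eta I)@_(bmnm m))) /=.
rewrite sum_card2 => [|I I2]; last by apply: big1 => m _; rewrite Om2 // mcoeff0 mul0r.
apply: eq_bigr => -[i j] /= ij.
rewrite -!ent_lt // (cE _ _ (F i j)) ?ent_homog ?FO // /row_value big_map.
by apply: eq_bigr => x _ /=; rewrite coef_ofE mulrC.
Qed.

Definition tform (F : nat -> nat -> terms BinNums.Z) : form 5 {mpoly C[5]} :=
  of_ent (fun k l : 'I_5 => zv (upper Z.mul F k l)).

Lemma tform_kform F : is_kform 2 (tform F). Proof. exact: of_ent_kform. Qed.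

Lemma tform_lists F : lists (upper Z.mul F) (tform F).
Proof.
have zs := @zcM C.
move=> k l; rewrite ent_of_ent // => [i j|i]; rewrite /upper; last by rewrite ltnn /tev big_nil.
by case: ltngtP => _; rewrite ?tev_opp // ?opprK // /tev big_nil oppr0.
Qed.

Lemma tlie_lists E Om a b : lists E Om -> forall k l : 'I_5,
  zv (tlie E (val a) (val b) k l) = lie (delta_mx a b) Om k l.
Proof.
move=> EO k l; have zs := @zcM C; rewrite /tlie tev_cat tev_mul // tev_cat tev_der // EO /lie.
have -> : zv [:: (var b, z1)] = 'X_b.
  rewrite /tev big_seq1 /= (_ : zc C z1 = 1) // scale1r; congr (mpolyX _ _).
  apply/mnmP => i; rewrite monE /var (nth_map 0%N) ?size_iota // nth_iota // add0n mnm1E.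
  by rewrite eq_sym.
have -> : dlin (delta_mx a b) (ent Om k l) = 'X_b * mderiv a (ent Om k l).
  rewrite /dlin (bigD1 a) //= (bigD1 b) //= mxE !eqxx scale1r big1 => [|h /negPf hb].
    rewrite addr0 big1 ?addr0 // => c /negPf ca.
    by rewrite big1 ?mul0r // => h _; rewrite mxE ca scale0r.
  by rewrite mxE hb andbF scale0r.
rewrite big_split /=; congr (_ + (_ + _)).
  rewrite (bigD1 a) //= mxE eqxx big1 ?addr0 => [|i /negPf ia].
    by rewrite -val_eqE; case: eqP => _; rewrite ?scale1r ?EO // scale0r /tev big_nil.
  by rewrite mxE ia scale0r.
rewrite (bigD1 a) //= mxE eqxx big1 ?addr0 => [|i /negPf ia].
  by rewrite -val_eqE; case: eqP => _; rewrite ?scale1r ?EO // scale0r /tev big_nil.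
by rewrite mxE ia scale0r.
Qed.

End Eta.
End FrobRowValues.

(** * Quadratic vector fields *)

Section Fields.
Local Open Scope nat_scope.

(* The vector field \sum c x_a x_b d/dx_i on the affine 5-space, for (c, (i, (a, b)))
   in the list. *)
Definition qfield := seq (BinNums.Z * (nat * (nat * nat))).

Variables (w : seq nat) (lam : nat).
Implicit Type X : qfield.

Definition sign2 i j := if i < j then z1 else if j < i then Z.opp z1 else Z0.
(** The Levi-Civita symbol, as the product of the signs of all differences. *)
Definition eps (t : seq nat) : BinNums.Z :=
  foldr (fun u z => Z.mul (sign2 (nth 0 t u.1) (nth 0 t u.2)) z) z1 (pairs 5).

(* The contraction of the volume form by the radial field, by the diagonal
   field with weights [w], and by [X]. *)
Definition form_terms X k l : terms BinNums.Z :=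
  flatten [seq [seq (add_exp (add_exp (var u.1) (var u.2)) (add_exp (var x.2.2.1) (var x.2.2.2)),
    Z.mul x.1 (Z.mul (eps [:: k; l; x.2.1; u.1; u.2])
      (Z.sub (Z.of_nat (nth 0 w u.2)) (Z.of_nat (nth 0 w u.1)))))
    | u <- pairs 5 & ~~ Z.eqb (eps [:: k; l; x.2.1; u.1; u.2]) Z0] | x <- X].

Definition entries X := upper Z.mul (form_terms X).

Definition diag_terms i : terms BinNums.Z := [:: (var i, Z.of_nat (nth 0 w i))].

(* The restriction of X - (X_5 / x_5) R to the hyperplane x_5 = 1; the exponents
   of x_5 are ignored. *)
Definition affine_terms X i : terms BinNums.Z :=
  flatten [seq (if x.2.1 == i then [:: (add_exp (var x.2.2.1) (var x.2.2.2), Z.opp x.1)] else [::])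
    ++ (if x.2.1 == 4 then [:: (add_exp (var i) (add_exp (var x.2.2.1) (var x.2.2.2)), x.1)]
        else [::]) | x <- X].

Definition entSX_terms X i j : terms BinNums.Z :=
  let f a b := tmul Z.mul (diag_terms a) (affine_terms X b)
    ++ topp Z.mul (tmul Z.mul (diag_terms b) (affine_terms X a)) in
  match i, j with
  | 0, 1 => topp Z.mul (f 2 3) | 0, 2 => f 1 3 | 0, 3 => topp Z.mul (f 1 2)
  | 1, 2 => topp Z.mul (f 0 3) | 1, 3 => f 0 2 | 2, 3 => topp Z.mul (f 0 1)
  | _, _ => [::]
  end.

Definition bracket_terms X i : terms BinNums.Z :=
  flatten [seq tmul Z.mul (diag_terms j) (tder Z.mul j (affine_terms X i))
    ++ topp Z.mul (tmul Z.mul (affine_terms X j) (tder Z.mul j (diag_terms i))) | j <- iota 0 4]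
  ++ topp Z.mul [seq (x.1, Z.mul (Z.of_nat lam) x.2) | x <- affine_terms X i].

(** Certifies, in order: degree 4, radial contraction zero, [S, X] = lam X for the affine field, and
    agreement on x_5 = 1 with i_S i_X nu_4. *)
Definition base_check X :=
  [&& all (fun u => all (fun x => sumn (normal_exp 5 x.1) == 4) (entries X u.1 u.2)) (pairs 5),
      all (fun l => vanish 5 (flatten [seq tmul Z.mul [:: (var k, z1)] (entries X k l) | k <- iota 0 5]))
        (iota 0 5),
      all (fun i => vanish 4 (bracket_terms X i)) (iota 0 4) &
      all (fun u => vanish 4 (entries X u.1 u.2 ++ topp Z.mul (entSX_terms X u.1 u.2))) (pairs 4)].

(* Polynomials in one variable, by increasing degree. *)
Fixpoint padd (f g : seq BinNums.Z) : seq BinNums.Z :=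
  match f, g with
  | a :: f', b :: g' => Z.add a b :: padd f' g'
  | [::], _ => g
  | _, [::] => f
  end.

Definition pscale c (f : seq BinNums.Z) := map (Z.mul c) f.

Definition pmul (f g : seq BinNums.Z) : seq BinNums.Z :=
  foldr (fun a r => padd (pscale a g) (Z0 :: r)) [::] f.

Definition line_terms (u v : seq nat) (L : terms BinNums.Z) : seq BinNums.Z :=
  foldr (fun x r => padd (pscale x.2 (foldr (fun i r => iter (nth 0 x.1 i)
    (pmul [:: Z.of_nat (nth 0 u i); Z.of_nat (nth 0 v i)]) r) [:: z1] (iota 0 5))) r) [::] L.

(* Cancelling the constant terms gives a polynomial divisible by the variable, so
   the quotient keeps the common nonzero roots. *)
Fixpoint no_common_root fuel (f g : seq BinNums.Z) : bool :=
  if fuel is n.+1 then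
    match f, g with
    | a :: f', b :: g' =>
        if Z.eqb a Z0 then no_common_root n f' g
        else if Z.eqb b Z0 then no_common_root n f g'
        else if nilp f' || nilp g' then true
        else let h := padd (pscale b f') (pscale (Z.opp a) g') in
          if size f < size g then no_common_root n f h else no_common_root n h g
    | _, _ => false
    end
  else false.

(** [line_base] and [line_dir] span one plane that serves all ten parameter lists. *)
Definition line_base := [:: 1; 0; 0; 1; 0].
Definition line_dir := [:: 3; 2; 2; 1; 1].
Definition origin := [:: 0; 0; 0; 0; 0].

(** Transversality of the entries (1, 2) and (0, 2). The third test excludes the common root 0,
    since [no_common_root] only concerns nonzero roots. *)
Definition line_check X :=
  let f u v := line_terms u v (entries X 1 2) in
  let g u v := line_terms u v (entries X 0 2) in
  [&& ~~ Z.eqb (head Z0 (f line_dir origin)) Z0, ~~ Z.eqb (head Z0 (g line_dir origin)) Z0,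
      ~~ Z.eqb (head Z0 (f line_base line_dir)) Z0 &
      no_common_root 20 (f line_base line_dir) (g line_base line_dir)].

(** The linear system on [eta] behind [rigid]: linearized Frobenius equations, orthogonality to the
    Lie derivatives along gl_5, and orthogonality to the form of each monomial field of [X]. *)
Definition rigid_rows X : seq linear_row := frob_rows (entries X)
  ++ [seq dot_row (tlie (entries X) u.1 u.2) | u <- [seq (i, j) | i <- iota 0 5, j <- iota 0 5]]
  ++ [seq dot_row (form_terms [:: (z1, x.2)]) | x <- X].

Definition component_check fuel X :=
  [&& base_check X, all (fun x => base_check [:: (z1, x.2)]) X, line_check X &
      solved (eliminate fuel (rigid_rows X))].

(** All monomial fields x_a x_b d/dx_i of weight [lam], with small explicit coefficients making the
    combination general enough for the checks. There are at most 11 of them for the ten lists, and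
    [zip] discards the surplus coefficients. *)
Definition general_field : qfield := zip [seq Z.of_nat c | c <- [:: 1; 1; 2; 1; 3; 2; 1; 3; 2; 1; 1]]
  [seq x <- [seq (i, u) | i <- iota 0 5, u <- [seq (a, b) | a <- iota 0 5, b <- iota 0 5]] |
    (x.2.1 <= x.2.2) && (nth 0 w x.2.1 + nth 0 w x.2.2 == lam + nth 0 w x.1)].

End Fields.


(** * Soundness of the checks *)

Section LineValues.
Variable C : numClosedFieldType.

Definition pev (f : seq BinNums.Z) (x : C) : C := foldr (fun c r => zc C c + x * r) 0 f.

Lemma pev_add f g x : pev (padd f g) x = pev f x + pev g x.
Proof.
elim: f g => [|a f IHf] [|b g] //=; rewrite ?add0r ?addr0 // IHf zcD; ring.
Qed.

Lemma pev_scale c f x : pev (pscale c f) x = zc C c * pev f x.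
Proof. by elim: f => [|a f IHf] /=; rewrite ?mulr0 // IHf zcM; ring. Qed.

Lemma pev_mul f g x : pev (pmul f g) x = pev f x * pev g x.
Proof.
elim: f => [|a f IHf] /=; first by rewrite mul0r.
by rewrite pev_add pev_scale /= IHf zc0; ring.
Qed.

Lemma no_common_rootP n f g x : no_common_root n f g -> x != 0 ->
  ~ (pev f x = 0 /\ pev g x = 0).
Proof.
move=> + x0; elim: n f g => [|n IHn] [|a f] [|b g] //=.
have cancel y : x * y = 0 -> y = 0 by move/eqP; rewrite mulf_eq0 (negPf x0) => /eqP.
case: (Z.eqb_spec a Z0) => [->|a0].
  by move=> /IHn nc [f0 g0]; apply: nc; split=> //; apply: cancel; rewrite -f0 zc0 add0r.
case: (Z.eqb_spec b Z0) => [->|b0].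
  by move=> /IHn nc [f0 g0]; apply: nc; split=> //; apply: cancel; rewrite -g0 zc0 add0r.
have const c : c <> Z0 -> zc C c + x * 0 <> 0 by move=> c0; rewrite mulr0 addr0 => /zc_eq0.
case: ifP => [/orP[/nilP -> _ [/const]|/nilP -> _ [_ /const]]|_ nc [f0 g0]] //.
have h0 : pev (padd (pscale b f) (pscale (Z.opp a) g)) x = 0.
  apply: cancel; rewrite pev_add !pev_scale zcN.
  transitivity (zc C b * (zc C a + x * pev f x) - zc C a * (zc C b + x * pev g x)); first by ring.
  by rewrite f0 g0 !mulr0 subrr.
by move: nc; case: ifP => _ /IHn; apply.
Qed.

Definition zrow (u : seq nat) : 'rV[C]_5 := \row_i (nth 0%N u i)%:R.

Lemma pev_line u v L x : pev (line_terms u v L) x = eval_at (zrow u + x *: zrow v) (tev 5 (zc C) L).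
Proof.
rewrite /tev eval_at_sum; elim: L => [|y L IHL] /=; first by rewrite big_nil.
rewrite big_cons pev_add IHL pev_scale eval_atZ; congr (_ * _ + _).
rewrite /eval_at mevalX.
have E : pev (foldr (fun i r => iter (nth 0%N y.1 i)
    (pmul [:: Z.of_nat (nth 0%N u i); Z.of_nat (nth 0%N v i)]) r) [:: z1] (iota 0 5)) x =
    \prod_(i <- iota 0 5) ((nth 0%N u i)%:R + x * (nth 0%N v i)%:R) ^+ nth 0%N y.1 i.
  elim: (iota 0 5) => [|i s IHs]; first by rewrite big_nil /= mulr0 addr0.
  rewrite big_cons -IHs [foldr _ _ (i :: s)]/=; elim: (nth 0%N y.1 i) => [|k IHk].
    by rewrite expr0 mul1r.
  by rewrite iterS pev_mul IHk exprS mulrA /= !zc_nat mulr0 addr0.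
rewrite E -[iota 0 5]/(index_iota 0 5) big_mkord; apply: eq_bigr => i _.
by rewrite monE !mxE.
Qed.

End LineValues.

Section FieldValues.
Variables (C : numClosedFieldType) (p q r s lam : nat).
Local Notation w := [:: p; q; r; s; 0%N].
Implicit Type X : qfield.

Definition quadratic_form X : form 5 {mpoly C[5]} := tform C (form_terms w X).

Lemma entries_lists X : lists (entries w X) (quadratic_form X).
Proof. exact: tform_lists. Qed.

Lemma tev_var n c (b : 'I_n) : (n <= 5)%N -> tev n (zc C) [:: (var b, c)] = zc C c *: 'X_b.
Proof.
move=> n5; rewrite /tev big_seq1 /=; congr (_ *: mpolyX _ _).
apply/mnmP => i; have i5 := leq_trans (ltn_ord i) n5.
by rewrite monE /var (nth_map 0%N) ?size_iota // nth_iota // add0n mnm1E eq_sym.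
Qed.

Lemma tev_homog n A (val : A -> C) d (L : terms A) :
  all (fun x => sumn (normal_exp n x.1) == d) L -> tev n val L \is homog d.
Proof.
rewrite /tev; elim: L => [|x L IHL] /=; first by rewrite big_nil rpred0.
move=> /andP[/eqP xd /IHL Ld]; rewrite big_cons rpredD //; apply: dhomogZ.
rewrite dhomogX; apply/eqP; rewrite -xd; apply: etrans (mdegE _) _.
rewrite sumnE big_map -[in RHS](subn0 n) -/(index_iota 0 n) big_mkord.
by apply: eq_bigr => i _; rewrite monE.
Qed.

Lemma comp_emb_tev L : comp_mpoly (emb C) (tev 5 (zc C) L) = tev 4 (zc C) L.
Proof.
apply: eval_at_inj => z; rewrite eval_emb /tev !eval_at_sum; apply: eq_bigr => x _.
rewrite !eval_atZ /eval_at !mevalX big_ord_recr /=; have [-> pk] := ptE z.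
rewrite expr1n mulr1; congr (_ * _); apply: eq_bigr => i _.
by rewrite !monE -[widen_ord _ _]/(w4 i) pk.
Qed.

Lemma base_checkP X : base_check w lam X -> base (C := C) p q r s lam%:Z (quadratic_form X).
Proof.
have zs := @zcM C; have EX := entries_lists X.
have van n L : vanish n L -> tev n (zc C) L = 0 := @vanishP C n L.
move=> /and4P[/allP homX /allP radX /allP brX /allP affX].
have k2 := tform_kform C (form_terms w X).
pose S := diagonal_field C p q r s.
have SE (i : 'I_4) : tev 4 (zc C) (diag_terms w i) = S i.
  rewrite tev_var // zc_nat /S /diagonal_field (tnth_nth 0%N); congr (_%:R *: _).
  by case: i => [[|[|[|[|]]]]].
pose Y (i : 'I_4) := tev 4 (zc C) (affine_terms X i).
split=> //.
- move=> I; case: (eqVneq #|I| 2%N) => [/card2P[i [j [ij ->]]]|/k2 ->]; last exact: rpred0.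
  by rewrite -ent_lt // -EX; apply/tev_homog/(homX (val i, val j)); rewrite mem_pairs ij /=.
- apply/contraction_radial => //; apply/contraction_eq0 => // l.
  have := radX (val l); rewrite mem_iota ltn_ord => /(_ isT)/van e; rewrite -[RHS]e {e}.
  rewrite tev_flatten -[iota 0 5]/(index_iota 0 5) big_mkord.
  apply: eq_bigr => i _; rewrite tev_mul // tev_var // (_ : zc C z1 = 1) // scale1r.
  by rewrite EX.
exists Y; split=> [i|].
  have := brX (val i); rewrite mem_iota ltn_ord => /(_ isT)/van; rewrite tev_cat tev_opp // tev_flatten -[iota 0 4]/(index_iota 0 4) big_mkord.
  move=> /eqP; rewrite subr_eq0 => /eqP E; rewrite /bracket.
  have -> : lam%:Z%:~R *: Y i =
      tev 4 (zc C) [seq (x.1, Z.mul (Z.of_nat lam) x.2) | x <- affine_terms X i].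
    rewrite /Y /tev big_map scaler_sumr; apply: eq_bigr => x _ /=.
    by rewrite zcM zc_nat scalerA.
  rewrite -E; apply: eq_bigr => j _.
  by rewrite -/S tev_cat tev_opp // !tev_mul // !tev_der // !SE.
have EL (k l : 'I_4) : comp_mpoly (emb C) (ent (quadratic_form X) (w4 k) (w4 l)) =
    tev 4 (zc C) (entries w X k l) by rewrite -EX comp_emb_tev.
have lt (k l : 'I_4) : (k < l)%N -> comp_mpoly (emb C) (ent (quadratic_form X) (w4 k) (w4 l)) =
    ent (contraction S (contraction Y (volume 4 _))) k l.
  move=> kl; rewrite EL [RHS]ent_lt // contraction2_volume //.
  have := affX (val k, val l); rewrite mem_pairs kl ltn_ord => /(_ isT)/van; rewrite tev_cat tev_opp // => /eqP; rewrite subr_eq0 => /eqP ->.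
  have So i : (i < 4)%N -> tev 4 (zc C) (diag_terms w i) = S (o4 i).
    by move=> i4; rewrite -SE /= val_o4.
  have Yo i : (i < 4)%N -> tev 4 (zc C) (affine_terms X i) = Y (o4 i).
    by move=> i4; rewrite /Y val_o4.
  have f a b : (a < 4)%N -> (b < 4)%N ->
      tev 4 (zc C) (tmul Z.mul (diag_terms w a) (affine_terms X b)
        ++ topp Z.mul (tmul Z.mul (diag_terms w b) (affine_terms X a))) =
      S (o4 a) * Y (o4 b) - S (o4 b) * Y (o4 a).
    by move=> a4 b4; rewrite tev_cat tev_opp // !tev_mul // !So // !Yo.
  rewrite /entSX_terms /entSX; move: kl.
  by case: k => [[|[|[|[|]]]] ?] //; case: l => [[|[|[|[|]]]] ?] //= _;
    rewrite ?tev_opp // f.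
move=> k l; case: (ltngtP k l) => [/lt //|lk|/val_inj ->].
  by rewrite entN rmorphN /= lt // -entN.
by rewrite !entii comp_mpoly0.
Qed.

Lemma line_checkP X : line_check w X -> general (quadratic_form X).
Proof.
have EX := entries_lists X.
pose o (a : nat) : 'I_5 := inord a.
have oE a : (a < 5)%N -> (o a : nat) = a by move=> a5; rewrite inordK.
pose sel (k l : 'I_5) (i j : 'I_5) : C := ((i == k) && (j == l))%:R.
have combE k l Om : comb (sel k l) Om = ent Om k l.
  rewrite /comb (bigD1 k) //= (bigD1 l) //= /sel !eqxx scale1r big1 => [|j /negPf jl].
    by rewrite addr0 big1 ?addr0 // => i /negPf ik; rewrite big1 // => j _; rewrite ik scale0r.
  by rewrite jl scale0r.
have E u v x k l : (k < 5)%N -> (l < 5)%N ->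
    eval_at (zrow C u + x *: zrow C v) (comb (sel (o k) (o l)) (quadratic_form X)) =
    pev (line_terms u v (entries w X k l)) x.
  by move=> k5 l5; rewrite combE -EX !oE // pev_line.
have pev0 f : pev f (0 : C) = zc C (head Z0 f).
  by case: f => [|a f] /=; rewrite ?zc0 // mul0r addr0.
have z0 f : ~~ Z.eqb (head Z0 f) Z0 -> pev f (0 : C) != 0.
  by rewrite pev0; apply: contraNneq => /zc_eq0 ->.
move=> /and4P[f0 g0 w0 nc].
exists (sel (o 1%N) (o 2%N)), (sel (o 0%N) (o 2%N)), (zrow C line_dir), (zrow C line_base).
split.
- by have := z0 _ f0; rewrite -E // scale0r addr0.
- by have := z0 _ g0; rewrite -E // scale0r addr0.
move=> x; rewrite !E //; have [->|x0] := eqVneq x 0; last exact: no_common_rootP nc x0.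
by move=> [e _]; have := z0 _ w0; rewrite e eqxx.
Qed.

Lemma rows_ok_map (I : Type) (e : positive -> C) (P : pred I) (t : seq I) (F : I -> linear_row) :
  all P t -> (forall i, P i -> row_value e (F i) = 0) -> rows_ok e [seq F i | i <- t].
Proof. by move=> tP F0; elim: t tP => //= i t IHt /andP[/F0 i0 /IHt]. Qed.

(** [X] gives the form Om0 of [rigid_component]. A form [eta] as in [rigid] satisfies all rows of
    the system, so the elimination proves that each of its coefficients is zero. *)
Theorem component_checkP fuel X : component_check w lam fuel X ->
  is_foliation_component 3 (@family_closure C p q r s lam%:Z 3).
Proof.
move=> /and4P[/base_checkP bX sX /line_checkP gX slv].
apply: (rigid_component bX gX) => eta k2 h4 fr dl db.
have EX := entries_lists X.
have dot_lie (a b : 'I_5) : row_value (coef_of eta) (dot_row (tlie (entries w X) a b)) = 0.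
  rewrite -(dl (delta_mx a b)); apply: (tev_dot h4 (of_ent_kform _)) => k l kl.
  by rewrite (tlie_lists _ _ EX) ent_lt // ffunE enum_set2.
have dot_base (x : BinNums.Z * (nat * (nat * nat))) : base_check w lam [:: (z1, x.2)] ->
    row_value (coef_of eta) (dot_row (form_terms w [:: (z1, x.2)])) = 0.
  move=> /base_checkP/db <-; apply: (tev_dot h4 (tform_kform C _)) => k l kl.
  by rewrite -(tform_lists C _ k l) /upper kl.
have ok : rows_ok (coef_of eta) (rigid_rows w X).
  rewrite /rigid_rows; apply/rows_ok_cat; split; first exact: frob_rows_ok EX fr.
  apply/rows_ok_cat; split; last exact: rows_ok_map sX dot_base.
  pose P (u : nat * nat) := ((u.1 < 5) && (u.2 < 5))%N.
  have sP : all P [seq (i, j) | i <- iota 0 5, j <- iota 0 5] by [].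
  apply: rows_ok_map sP _ => -[a b] /andP[a5 b5].
  exact: (dot_lie (Ordinal a5) (Ordinal b5)).
have zero := solve_ok (eliminate_ok (fuel := fuel) ok).
apply: (eq_kform2 k2) => [I _|i j ij]; first by rewrite ffunE.
rewrite -(homog_monos (ent_homog i j h4) monos54) big_seq big1 => [|m mm]; last first.
  rewrite -coef_ofE (zero unknowns) ?scale0r //.
  have /allP/(_ (val i, val j)) := slv; rewrite mem_pairs ij ltn_ord => /(_ isT)/allP.
  exact.
by rewrite /ent ij ffunE.
Qed.

End FieldValues.

(** * The ten parameter lists *)

Definition parameters : seq (nat * nat * nat * nat * int) :=
  [:: (15, 14, 12, 8, Posz 16); (15, 7, 6, 4, Posz 8);
      (14, 11, 6, 4, Posz 8); (12, 8, 3, 2, Posz 4);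
      (8, 7, 6, 4, Posz 8); (8, 4, 3, 2, Posz 4);
      (7, 4, 3, 2, Posz 4); (6, 5, 4, 2, Posz 4);
      (6, 5, 3, 2, Posz 4); (4, 3, 2, 1, Posz 2)].

Definition parameter_check (t : nat * nat * nat * nat * int) : bool :=
  if t is (p, q, r, s, Posz l) then
    let w := [:: p; q; r; s; 0%N] in component_check w l 1000 (general_field w l)
  else false.

(** The whole certificate, over the integers, is evaluated by the kernel. *)
Lemma parameters_check : all parameter_check parameters.
Proof. by vm_compute. Qed.

Theorem corollary4p11 (R : realType) (p q r s : nat) (lam : int) :
  (p, q, r, s, lam) \in
    [:: (15, 14, 12, 8, Posz 16); (15, 7, 6, 4, Posz 8);
        (14, 11, 6, 4, Posz 8); (12, 8, 3, 2, Posz 4);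
        (8, 7, 6, 4, Posz 8); (8, 4, 3, 2, Posz 4);
        (7, 4, 3, 2, Posz 4); (6, 5, 4, 2, Posz 4);
        (6, 5, 3, 2, Posz 4); (4, 3, 2, 1, Posz 2)] ->
  is_foliation_component (C := R[i]) 3
    (family_closure (C := R[i]) p q r s lam 3).
Proof.
move=> /(allP parameters_check); case: lam => // l.
exact: component_checkP.
Qed.
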